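(* Let $0\le k\le n-1$ and let $\Sigma^n$ be a connected orientable self-shrinker of the $Q_k$-flow properly immersed in $\mathbb{R}^{n+1}$. If $\sigma_k$ is bounded and $P_k$ is coercive, then $\Sigma$ has finite weighted volume, i.e. $\int_\Sigma e^{-|x|^2/4}\,dv_g<+\infty$, and polynomial volume growth.
   Context: Hypersurfaces are smooth, without boundary, with induced metric $g$, immersion $x:\Sigma^n\to\mathbb{R}^{n+1}$ (also the position vector) and chosen unit normal field $\nu$. With $\overline{\nabla}$ the flat connection of $\mathbb{R}^{n+1}$, the shape operator is $A(X)=\overline{\nabla}_X\nu$, with eigenvalues (principal curvatures) $\lambda_1,\dots,\lambda_n$. For $1\le k\le n$, $\sigma_k=\sum_{i_1<\cdots<i_k}\lambda_{i_1}\cdots\lambda_{i_k}$, with $\sigma_0=1$ and $\sigma_j=0$ for $j>n$. The Newton transformations are $P_0=I$, $P_k=\sigma_k I-AP_{k-1}$. A symmetric endomorphism $P$ of $T\Sigma$ is coercive if there is a constant $\delta>0$ with $\langle P(X),X\rangle\ge\delta|X|^2$ for all $X\in T\Sigma$. A hypersurface with $\sigma_k\ne0$ everywhere is a self-shrinker of the $Q_k$-flow if \[ \frac{\sigma_{k+1}}{\sigma_k}=\frac{1}{2(k+1)}\langle x,\nu\rangle . \] Polynomial volume growth means that there are constants $C,d\ge0$ such that the $g$-volume of $\{q\in\Sigma:|x(q)|\le r\}$ is at most $Cr^d$ for all sufficiently large $r$. *)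

(* Defs.v *)
From HB Require Import structures.
From mathcomp Require Import all_boot all_order all_algebra.
From mathcomp Require Import all_classical all_reals all_analysis.

Set Implicit Arguments.
Unset Strict Implicit.
Unset Printing Implicit Defensive.

Import Order.TTheory GRing.Theory Num.Theory.
Import numFieldNormedType.Exports.

Local Open Scope classical_set_scope.
Local Open Scope ring_scope.

(* MathComp-Analysis norms 'rV[R]_m by the sup norm, hence the explicit
   Euclidean structure. *)
Definition dot {R : realType} {m : nat} (u v : 'rV[R]_m) : R :=
  \sum_(i < m) u 0 i * v 0 i.

Definition enorm {R : realType} {m : nat} (u : 'rV[R]_m) : R :=
  Num.sqrt (dot u u).

Fixpoint Ck_on {R : realType} {n m : nat} (j : nat)
    (U : set 'rV[R]_n) (f : 'rV[R]_n -> 'rV[R]_m) : Prop :=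
  match j with
  | 0 => forall u, U u -> {for u, continuous f}
  | j'.+1 => (forall u, U u -> differentiable f u) /\
      forall i : 'I_n, Ck_on j' U (fun u => 'D_(delta_mx 0 i) f u)
  end.

(* Only used for open U. *)
Definition smooth_on {R : realType} {n m : nat}
    (U : set 'rV[R]_n) (f : 'rV[R]_n -> 'rV[R]_m) : Prop :=
  forall j : nat, Ck_on j U f.

(* The Lebesgue integral over R^n as an iterated integral; by Tonelli it is
   the integral against n-dimensional Lebesgue measure for nonnegative Borel
   functions, the only ones to which it is applied. *)
Fixpoint integral_rV {R : realType} (n : nat) : ('rV[R]_n -> \bar R) -> \bar R :=
  match n return ('rV[R]_n -> \bar R) -> \bar R with
  | 0 => fun f => f 0
  | n'.+1 => fun f =>
      (\int[@lebesgue_measure R]_t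
         integral_rV (fun u : 'rV[R]_n' => f (row_mx (const_mx t : 'rV_1) u)))%E
  end.

Record chart (R : realType) (n : nat) (M : topologicalType) := Chart {
  chart_dom : set M ;
  chart_map : M -> 'rV[R]_n ;
  chart_inv : 'rV[R]_n -> M ;
  chart_dom_open : open chart_dom ;
  chart_codom_open : open (chart_map @` chart_dom) ;
  chart_mapK : forall p, chart_dom p -> chart_inv (chart_map p) = p ;
  chart_map_continuous : {within chart_dom, continuous chart_map} ;
  chart_inv_continuous :
    {within chart_map @` chart_dom, continuous chart_inv}
}.

Definition chart_codom {R : realType} {n : nat} {M : topologicalType}
    (c : chart R n M) : set 'rV[R]_n :=
  chart_map c @` chart_dom c.

Definition transition_dom {R : realType} {n : nat} {M : topologicalType}
    (c d : chart R n M) : set 'rV[R]_n :=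
  chart_map c @` (chart_dom c `&` chart_dom d).

Definition transition {R : realType} {n : nat} {M : topologicalType}
    (c d : chart R n M) : 'rV[R]_n -> 'rV[R]_n :=
  chart_map d \o chart_inv c.

Definition compatible {R : realType} {n : nat} {M : topologicalType}
    (c d : chart R n M) : Prop :=
  smooth_on (transition_dom c d) (transition c d) /\
  smooth_on (transition_dom d c) (transition d c).

Definition smooth_atlas {R : realType} {n : nat} {M : topologicalType}
    (At : set (chart R n M)) : Prop :=
  (forall p, exists2 c, At c & chart_dom c p) /\
  (forall c d, At c -> At d -> compatible c d).

Definition smooth_manifold {R : realType} {n : nat} {M : topologicalType}
    (At : set (chart R n M)) : Prop :=
  [/\ hausdorff_space M, @second_countable M & smooth_atlas At].

Definition orientable {R : realType} {n : nat} {M : topologicalType}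
    (At : set (chart R n M)) : Prop :=
  exists B : set (chart R n M),
    [/\ smooth_atlas B,
        (forall c d, At c -> B d -> compatible c d) &
        (forall c d, B c -> B d -> forall u, transition_dom c d u ->
           0 < \det ('J (transition c d) u))].

Definition smooth_map {R : realType} {n m : nat} {M : topologicalType}
    (At : set (chart R n M)) (F : M -> 'rV[R]_m) : Prop :=
  forall c, At c -> smooth_on (chart_codom c) (F \o chart_inv c).

(* The differential of F at p in the chart c. Vectors are rows: a tangent
   vector with coordinates v is sent to v *m coord_diff c F p, and the matrix
   of an endomorphism acts on coordinates by right multiplication, so that
   S *m T is the matrix of "first S, then T". *)
Definition coord_diff {R : realType} {n m : nat} {M : topologicalType}
    (c : chart R n M) (F : M -> 'rV[R]_m) (p : M) : 'M[R]_(n, m) :=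
  'J (F \o chart_inv c) (chart_map c p).

Definition metric {R : realType} {n m : nat} {M : topologicalType}
    (x : M -> 'rV[R]_m) (c : chart R n M) (p : M) (v w : 'rV[R]_n) : R :=
  dot (v *m coord_diff c x p) (w *m coord_diff c x p).

Definition metric_mx {R : realType} {n m : nat} {M : topologicalType}
    (x : M -> 'rV[R]_m) (c : chart R n M) (p : M) : 'M[R]_n :=
  \matrix_(i < n, j < n) metric x c p (delta_mx 0 i) (delta_mx 0 j).

Record immersed_hypersurface {R : realType} {n : nat} {M : topologicalType}
    (At : set (chart R n M)) (x nu : M -> 'rV[R]_n.+1) : Prop := {
  hyp_manifold : smooth_manifold At ;
  hyp_position_smooth : smooth_map At x ;
  hyp_immersion : forall c p, At c -> chart_dom c p ->
    row_free (coord_diff c x p) ;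
  hyp_normal_smooth : smooth_map At nu ;
  hyp_normal_unit : forall p, enorm (nu p) = 1 ;
  hyp_normal_orth : forall c p, At c -> chart_dom c p ->
    forall v, dot (v *m coord_diff c x p) (nu p) = 0
}.

Definition proper_map {R : realType} {m : nat} {M : topologicalType}
    (f : M -> 'rV[R]_m) : Prop :=
  continuous f /\ forall K : set 'rV[R]_m, compact K -> compact (f @^-1` K).

(* The matrix of X |-> D_X nu. As nu is a unit normal of an immersion, the
   rows of coord_diff c nu p lie in the row space of coord_diff c x p, so this
   is the only S with S *m coord_diff c x p = coord_diff c nu p (mulmxKpV). *)
Definition shape_operator {R : realType} {n : nat} {M : topologicalType}
    (x nu : M -> 'rV[R]_n.+1) (c : chart R n M) (p : M) : 'M[R]_n :=
  coord_diff c nu p *m pinvmx (coord_diff c x p).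

(* Eigenvalues with multiplicity, in some order; 0 if char_poly does not
   split, which cannot happen for the self-adjoint shape operator. *)
Definition eigenvalues {R : realType} {n : nat} (S : 'M[R]_n) : 'rV[R]_n :=
  xget 0 [set l : 'rV[R]_n | char_poly S = \prod_(i < n) ('X - (l 0 i)%:P)].

Definition elem_sym {R : realType} {n : nat} (j : nat) (l : 'rV[R]_n) : R :=
  \sum_(I : {set 'I_n} | #|I| == j) \prod_(i in I) l 0 i.

Definition sigma {R : realType} {n : nat} {M : topologicalType}
    (x nu : M -> 'rV[R]_n.+1) (j : nat) (c : chart R n M) (p : M) : R :=
  elem_sym j (eigenvalues (shape_operator x nu c p)).

Fixpoint newton {R : realType} {n : nat} {M : topologicalType}
    (x nu : M -> 'rV[R]_n.+1) (j : nat) (c : chart R n M) (p : M) : 'M[R]_n :=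
  match j with
  | 0 => 1%:M
  | j'.+1 => (sigma x nu j'.+1 c p)%:M
             - newton x nu j' c p *m shape_operator x nu c p
  end.

Definition coercive {R : realType} {n : nat} {M : topologicalType}
    (At : set (chart R n M)) (x : M -> 'rV[R]_n.+1)
    (P : chart R n M -> M -> 'M[R]_n) : Prop :=
  (forall c p, At c -> chart_dom c p -> forall v w,
     metric x c p (v *m P c p) w = metric x c p v (w *m P c p)) /\
  exists2 delta : R, 0 < delta &
    forall c p, At c -> chart_dom c p -> forall v,
      delta * metric x c p v v <= metric x c p (v *m P c p) v.

Definition Qk_self_shrinker {R : realType} {n : nat} {M : topologicalType}
    (k : nat) (At : set (chart R n M)) (x nu : M -> 'rV[R]_n.+1) : Prop :=
  forall c p, At c -> chart_dom c p ->
    sigma x nu k c p != 0 /\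
    sigma x nu k.+1 c p / sigma x nu k c p
      = (2 * k.+1%:R)^-1 * dot (x p) (nu p).

Definition sigma_bounded {R : realType} {n : nat} {M : topologicalType}
    (k : nat) (At : set (chart R n M)) (x nu : M -> 'rV[R]_n.+1) : Prop :=
  exists K : R, forall c p, At c -> chart_dom c p ->
    `|sigma x nu k c p| <= K.

Notation borel M := (g_sigma_algebraType (@open M)).

(* The Riemannian volume is the Borel measure given in every chart by the
   density sqrt (det g) against Lebesgue measure; M being second countable,
   there is exactly one such measure. *)
Definition riemannian_volume {R : realType} {n m : nat} {M : ptopologicalType}
    (At : set (chart R n M)) (x : M -> 'rV[R]_m)
    (mu : {measure set (borel M) -> \bar R}) : Prop :=
  forall (c : chart R n M) (B : set (borel M)),
    At c -> measurable B -> B `<=` chart_dom c ->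
    mu B = integral_rV (fun u : 'rV[R]_n =>
      (\1_(chart_map c @` B) u
        * Num.sqrt (\det (metric_mx x c (chart_inv c u))))%:E).

Definition finite_weighted_volume {R : realType} {m : nat}
    {M : ptopologicalType} (x : M -> 'rV[R]_m)
    (mu : {measure set (borel M) -> \bar R}) : Prop :=
  (\int[mu]_p (expR (- (enorm (x p) ^+ 2 / 4)))%:E < +oo)%E.

Definition polynomial_volume_growth {R : realType} {m : nat}
    {M : ptopologicalType} (x : M -> 'rV[R]_m)
    (mu : {measure set (borel M) -> \bar R}) : Prop :=
  exists C d : R, [/\ 0 <= C, 0 <= d &
    \forall r \near +oo,
      (mu [set q | (enorm (x q) <= r)%R] <= (C * r `^ d)%:E)%E].

(* Main.v *)
(* For a C^1 function psi of compact support the divergence of psi P_k(x^T)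
   integrates to 0. The trace identities tr P_k = (n - k) sigma_k and
   tr (P_k A) = (k + 1) sigma_(k+1) together with the shrinker equation give
   div P_k(x^T) = sigma_k ((n - k) - <x, nu>^2 / 2). Coercivity bounds sigma_k
   below through tr P_k, and |x|^2 = |x^T|^2 + <x, nu>^2; hence
   psi = (r - |x|^2)_+^p yields, with A independent of r and p,
     0 <= int (A psi - |x|^2 min (psi, p (r - |x|^2)_+^(p-1))).
   With r = 8 p and p going to infinity, psi / r^p dominates exp(-|x|^2/4) where
   |x|^2 <= r / 2, and the weighted volume is finite. With p fixed and large, the
   volume of {|x|^2 <= r / 2} is at most a constant times that of
   {|x|^2 <= r / 4}, which gives polynomial growth.

   The formula for div P_k(x^T) is obtained in a chart without covariant
   derivatives: P_k is a fixed linear combination of the adj (1 + t A) for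
   t = 0, ..., n - 1 (Lagrange interpolation), and the components of
   adj (1 + t A) x^T are, up to the volume density, determinants with rows nu, x
   and the d_j (x + t nu), whose divergence simplifies by the symmetry of second
   derivatives. *)
Require Import Defs.
From HB Require Import structures.
From mathcomp Require Import all_boot all_order all_algebra.
From mathcomp Require Import all_classical all_reals all_analysis.
From mathcomp Require Import complex measurable_realfun.
From mathcomp Require Import ring lra zify.

Set Implicit Arguments.
Unset Strict Implicit.
Unset Printing Implicit Defensive.

Import Order.TTheory GRing.Theory Num.Theory.
Import numFieldNormedType.Exports.

Local Open Scope classical_set_scope.
Local Open Scope ring_scope.

(** * Spectra and Newton transformations *)

(** Nothing is known to be integrable at the start, so the test functions have compact support and
    powers must imitate the Gaussian. If $0\le w\le 1$ and $rw\le p$, then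
    $\min(\psi,p(r-|x|^2)_+^{p-1})\ge w\psi$, and the integrand is at most $\psi(A-w|x|^2)$. With
    $r=8p$ and $w=1/8$ this is at most $-\psi$ where $|x|^2\ge 8A+8$, a bound free of $p$, while
    $(1-t/(8p))^p\ge e^{-t/4}$ for $0\le t\le 4p$: hence the 8. With $w=p/r$ and $p\ge 4A+4$ it is
    at most $-\psi$ where $|x|^2\ge r/4$, which gives doubling. The minimum arises because $|x^T|^2$
    and $\langle x,\nu\rangle^2$ carry different factors and only the common part adds up to
    $|x|^2$. The other obstacle is regularity: $\sigma_k$ and $P_k$ are defined through a choice of
    eigenvalues, so not even their continuity is visible. Interpolation turns
    $\det(\nu,X)\,P_k(x^T)$ into a polynomial in $x$, $\nu$ and their first derivatives, where the
    rows of $X$ are the $\partial_j x$. The volume density is $|\det(\nu,X)|$, and the sign, being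
    locally constant, passes through derivatives. *)

Section LinearAlgebra.
Context {R : realType}.

Lemma dotE {m} (u v : 'rV[R]_m) : (u *m v^T) 0 0 = dot u v.
Proof. by rewrite mxE; apply: eq_bigr => i _; rewrite mxE. Qed.

Lemma dotC {m} (u v : 'rV[R]_m) : dot u v = dot v u.
Proof. by apply: eq_bigr => i _; rewrite mulrC. Qed.

Lemma dotDl {m} (u v w : 'rV[R]_m) : dot (u + v) w = dot u w + dot v w.
Proof. by rewrite -!dotE mulmxDl mxE. Qed.

Lemma dotZl {m} (a : R) (u v : 'rV[R]_m) : dot (a *: u) v = a * dot u v.
Proof. by rewrite -!dotE -scalemxAl mxE. Qed.

Lemma dotDr {m} (u v w : 'rV[R]_m) : dot w (u + v) = dot w u + dot w v.
Proof. by rewrite dotC dotDl !(dotC w). Qed.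

Lemma dotZr {m} (a : R) (u v : 'rV[R]_m) : dot u (a *: v) = a * dot u v.
Proof. by rewrite dotC dotZl dotC. Qed.

Lemma dot_ge0 {m} (u : 'rV[R]_m) : 0 <= dot u u.
Proof. by apply: sumr_ge0 => i _; rewrite -expr2 sqr_ge0. Qed.

Lemma dot_eq0 {m} (u : 'rV[R]_m) : dot u u = 0 -> u = 0.
Proof.
move=> /eqP; rewrite psumr_eq0 => [/allP h|i _]; last by rewrite -expr2 sqr_ge0.
apply/rowP => i; rewrite mxE; have /(_ _) := h i; rewrite mem_index_enum.
by rewrite implyTb mulf_eq0 orbb => /(_ isT)/eqP.
Qed.

Lemma dot_gt0 {m} (u : 'rV[R]_m) : u != 0 -> 0 < dot u u.
Proof.
by move=> u0; rewrite lt0r dot_ge0 andbT; apply: contra_neq u0 => /dot_eq0.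
Qed.

(* If [S] has the eigenvector [a + i b] for [p + i q], self-adjointness gives
   [q (|a|^2 + |b|^2) = 0]. *)
Lemma self_adjoint_spectrum {n m} (X : 'M[R]_(n, m)) (S : 'M[R]_n) :
  row_free X ->
  (forall v w, dot (v *m S *m X) (w *m X) = dot (v *m X) (w *m S *m X)) ->
  exists2 l : 'rV[R]_n, char_poly S = \prod_(i < n) ('X - (l 0 i)%:P) &
    forall i, exists2 v, v *m S = l 0 i *: v & 0 < dot (v *m X) (v *m X).
Proof.
move=> fX sS.
have posX v : v != 0 -> 0 < dot (v *m X) (v *m X).
  move=> v0; apply: dot_gt0; apply: contra_neq v0 => vX0.
  by apply: (row_free_inj fX); rewrite vX0 mul0mx.
pose f := real_complex R.
have [r] := closed_field_poly_normal (char_poly (map_mx f S)).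
have /monicP -> := char_poly_monic (map_mx f S); rewrite scale1r => rE.
have realr z : z \in r -> z = real_complex R (complex.Re z).
  move=> zr; have : eigenvalue (map_mx f S) z.
    by rewrite eigenvalue_root_char rE root_prod_XsubC.
  move=> /eigenvalueP[v vS v0].
  pose a := map_mx (@complex.Re R) v; pose b := map_mx (@complex.Im R) v.
  have aS : a *m S = complex.Re z *: a - complex.Im z *: b.
    apply/rowP => j; have /rowP/(_ j) := vS; rewrite !mxE => /(congr1 (@complex.Re R)).
    rewrite raddf_sum /= => h; transitivity (complex.Re (z * v 0 j)); last first.
      by case: (z) (v 0 j) => [? ?] [? ?] /=.
    rewrite -h; apply: eq_bigr => i _; rewrite !mxE.
    by case: (v 0 i) => [? ?] /=; rewrite mulr0 subr0.
  have bS : b *m S = complex.Im z *: a + complex.Re z *: b.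
    apply/rowP => j; have /rowP/(_ j) := vS; rewrite !mxE => /(congr1 (@complex.Im R)).
    rewrite raddf_sum /= => h; transitivity (complex.Im (z * v 0 j)); last first.
      by case: (z) (v 0 j) => [? ?] [? ?] /=; rewrite addrC.
    rewrite -h; apply: eq_bigr => i _; rewrite !mxE.
    by case: (v 0 i) => [? ?] /=; rewrite mulr0 add0r.
  have /eqP : complex.Im z * (dot (a *m X) (a *m X) + dot (b *m X) (b *m X)) = 0.
    have := sS a b; rewrite aS bS !mulmxDl -scaleNr -!scalemxAl.
    rewrite !(dotDl, dotDr, dotZl, dotZr); lra.
  rewrite mulf_eq0 => /orP[/eqP z0|].
    by apply/eqP; rewrite eq_complex /= z0 !eqxx.
  have : v != 0 -> (a != 0) || (b != 0).
    apply: contraNT; rewrite negb_or !negbK => /andP[/eqP a0 /eqP b0].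
    apply/eqP/rowP => j; rewrite mxE; apply/eqP; rewrite eq_complex /=.
    by move/rowP/(_ j): a0; move/rowP/(_ j): b0; rewrite !mxE => -> ->; rewrite eqxx.
  move=> /(_ v0)/orP[] /posX h /eqP s0.
    by have := ltr_wpDr (dot_ge0 (b *m X)) h; rewrite s0 ltxx.
  by have := ltr_wpDl (dot_ge0 (a *m X)) h; rewrite s0 ltxx.
have sr : size r = n.
  by have := size_char_poly (map_mx f S); rewrite rE size_prod_XsubC => -[].
pose l : 'rV[R]_n := \row_i complex.Re r`_i.
have SE : char_poly S = \prod_(i < n) ('X - (l 0 i)%:P).
  apply: (map_poly_inj f); rewrite map_char_poly rE rmorph_prod /=.
  rewrite (big_nth 0) big_mkord sr; apply: eq_bigr => i _.
  have ri : r`_i \in r by rewrite mem_nth// sr.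
  by rewrite rmorphB /= map_polyX map_polyC /= mxE {1}(realr _ ri).
exists l => // i; have : eigenvalue S (l 0 i).
  by rewrite eigenvalue_root_char SE /root horner_prod (bigD1 i)//= hornerXsubC subrr mul0r.
by move=> /eigenvalueP[v vS v0]; exists v => //; exact: posX.
Qed.

End LinearAlgebra.

Section NewtonTransformations.
Context {R : realType}.

Lemma poly_ext (p q : {poly R}) : (forall t, p.[t] = q.[t]) -> p = q.
Proof.
move=> pq; apply/eqP; rewrite -subr_eq0; apply/eqP.
apply: (@roots_geq_poly_eq0 _ _ [seq i%:R | i <- iota 0 (size (p - q))]).
- by apply/allP => t _; rewrite /root hornerD hornerN pq subrr.
- by rewrite map_inj_uniq ?iota_uniq// => i j /eqP; rewrite eqr_nat => /eqP.
- by rewrite size_map size_iota.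
Qed.

(** Lets the trace identities be proved all at once, as identities between generating functions in
    [t]. *)
Lemma coef_eq_horner n (a b : nat -> R) :
  (forall t, \sum_(j < n) t ^+ j * a j = \sum_(j < n) t ^+ j * b j) ->
  forall j, (j < n)%N -> a j = b j.
Proof.
move=> ab j jn.
have /polyP/(_ j) : \poly_(j < n) a j = \poly_(j < n) b j.
  apply: poly_ext => t; rewrite !horner_poly.
  under eq_bigr do rewrite mulrC.
  by under [RHS]eq_bigr do rewrite mulrC.
by rewrite !coef_poly jn.
Qed.

Lemma elem_sym0 n (l : 'rV[R]_n) : elem_sym 0 l = 1.
Proof.
rewrite /elem_sym (big_pred1 finset.set0) ?big_set0// => I.
by rewrite cards_eq0.
Qed.

Lemma prod_one_add n (l : 'rV[R]_n) t :
  \prod_(i < n) (1 + t * l 0 i) = \sum_(j < n.+1) t ^+ j * elem_sym j l.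
Proof.
under eq_bigr do rewrite addrC.
rewrite bigA_distr; transitivity (\sum_(I : {set 'I_n}) t ^+ #|I| * \prod_(i in I) l 0 i).
  apply: eq_bigr => I _; rewrite -big_mkcond /= big_split /=.
  by rewrite prodr_const.
rewrite (partition_big (fun I : {set 'I_n} => (inord #|I| : 'I_n.+1)) xpredT) //=.
apply: eq_bigr => j _; rewrite mulr_sumr; apply: eq_big => [I|I /eqP <-].
  rewrite -val_eqE /= inordK// ltnS.
  by rewrite -[n in (_ <= n)%N]card_ord max_card.
by rewrite inordK// ltnS -[n in (_ <= n)%N]card_ord max_card.
Qed.

(** The recursion of [newton] freed from charts; [s j] stands for $\sigma_j$. *)
Fixpoint newton_mx n (s : nat -> R) (S : 'M[R]_n) j : 'M[R]_n :=
  if j is j'.+1 then (s j'.+1)%:M - newton_mx s S j' *m S else 1%:M.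

(** Powers are written with [iter] because [T ^+ i] requires a size of the form [m.+1], while size 0
    is to be covered too. *)
Lemma Cayley_Hamilton_sum m (T : 'M[R]_m) :
  \sum_(i < m.+1) (char_poly T)`_i *: iter i (mulmx T) 1%:M = 0.
Proof.
case: m T => [T|m T]; first by apply/matrixP => -[].
have := Cayley_Hamilton T; rewrite /horner_mx /= /horner_morph.
rewrite (@horner_coef_wide _ m.+2) => [CH|]; last first.
  by rewrite (leq_trans (size_poly _ _))// size_char_poly.
rewrite -[RHS]CH; apply: eq_bigr => i _.
rewrite coef_map_id0 ?raddf0// -[RHS]/(_ *m _) mul_scalar_mx.
by congr (_ *: _); elim: (nat_of_ord i) => [|k IH]; rewrite ?expr0// iterS IH exprS.
Qed.

(** Column [k] of the inverse Vandermonde matrix at the nodes $0,\dots,m-1$. These weights recover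
    the coefficient of $t^k$ of a polynomial of degree less than $m$ from its values at the
    nodes. *)
Lemma interpolation_weights m (k : 'I_m) :
  exists c : 'I_m -> R, forall j : 'I_m, \sum_i c i * i%:R ^+ j = (j == k)%:R.
Proof.
pose V := Vandermonde m (\row_(i < m) i%:R : 'rV[R]_m).
have uV : V \in unitmx.
  rewrite unitmxE unitfE det_Vandermonde; apply/prodf_neq0 => i _.
  apply/prodf_neq0 => j ij; rewrite !mxE subr_eq0 eqr_nat.
  by rewrite gtn_eqF.
exists (fun i => invmx V i k) => j.
have /matrixP/(_ j k) := mulmxV uV; rewrite !mxE => <-.
by apply: eq_bigr => i _; rewrite !mxE mulrC.
Qed.

Context {n : nat} (S : 'M[R]_n) (l : 'rV[R]_n).
Hypothesis splitS : char_poly S = \prod_(i < n) ('X - (l 0 i)%:P).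
Let P := newton_mx (elem_sym ^~ l) S.

Lemma det_one_addZ t :
  \det (1%:M + t *: S) = \sum_(j < n.+1) t ^+ j * elem_sym j l.
Proof.
rewrite -prod_one_add; have [->|t0] := eqVneq t 0.
  rewrite scale0r addr0 det1 big1// => i _; by rewrite mul0r addr0.
have cpE a : (char_poly S).[a] = \det (a%:M - S).
  rewrite -[_.[_]]/(horner_eval a _) -det_map_mx; congr (\det _).
  apply/matrixP => i j; rewrite !mxE /= /horner_eval hornerD hornerN hornerC.
  by rewrite hornerMn hornerX.
have -> : 1%:M + t *: S = - t *: ((- t^-1)%:M - S).
  by rewrite scalerBr scale_scalar_mx mulrNN divff// scaleNr opprK.
rewrite detZ -cpE splitS horner_prod -{1}(card_ord n) -prodr_const -big_split.
apply: eq_bigr => i _ /=; rewrite hornerXsubC mulrBr mulrNN divff//.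
by rewrite mulNr opprK.
Qed.

(** Unfolding the recursion gives $P_j=\sum_i(-1)^i\sigma_{j-i}S^i$; for $j=n$ this is $(-1)^n$
    times the characteristic polynomial evaluated at $S$, so Cayley-Hamilton applies. *)
Lemma newton_mx_n : P n = 0.
Proof.
have PE j : P j = \sum_(i < j.+1) ((-1) ^+ i * elem_sym (j - i) l) *: iter i (mulmx S) 1%:M.
  elim: j => [|j IH]; first by rewrite big_ord1 expr0 mul1r elem_sym0 scale1r.
  rewrite big_ord_recl expr0 mul1r subn0 /P /= -/P /= -[1%:M]/(1%:M : 'M[R]_n).
  rewrite scalemx1; congr (_ + _); rewrite -/(P j) IH mulmx_suml -sumrN.
  apply: eq_bigr => i _; rewrite -scalemxAl exprS mulN1r mulNr scaleNr.
  rewrite [bump _ _]add1n add0n subSS; congr (- (_ *: _)).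
  elim: (nat_of_ord i) => [|k IHk]; first by rewrite /= mul1mx mulmx1.
  by rewrite [in LHS]iterS -mulmxA IHk.
have sz : size [seq l 0 i | i : 'I_n] = n by rewrite size_map size_enum_ord.
rewrite PE; apply: (scalerI (a := (-1) ^+ n)); first by rewrite signr_eq0.
rewrite scaler0 -[RHS](Cayley_Hamilton_sum S) scaler_sumr splitS.
have -> : \prod_(i < n) ('X - (l 0 i)%:P) = \prod_(a <- [seq l 0 i | i : 'I_n]) ('X - a%:P).
  by rewrite big_map big_enum.
apply: eq_bigr => -[i /=]; rewrite ltnS => iln _.
rewrite coef_prod_XsubC sz// scalerA mulrA -exprD; congr (_ * _ *: _).
  by rewrite -[LHS]signr_odd -[RHS]signr_odd oddD oddB.
apply: eq_bigr => I _; apply: eq_bigr => a _.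
by rewrite (nth_map a) ?size_enum_ord// nth_ord_enum.
Qed.

(** Since $P_jS=\sigma_{j+1}I-P_{j+1}$, the product telescopes down to $P_0$, a multiple of $P_n=0$,
    and the scalar terms that sum to the determinant. *)
Lemma newton_mx_mul t :
  (\sum_(j < n) t ^+ j *: P j) *m (1%:M + t *: S) = (\det (1%:M + t *: S))%:M.
Proof.
rewrite det_one_addZ mulmxDr mulmx1 -scalemxAr mulmx_suml scaler_sumr.
transitivity (\sum_(j < n) t ^+ j *: P j + \sum_(j < n) (t ^+ j.+1 * elem_sym j.+1 l)%:M
   - \sum_(j < n) t ^+ j.+1 *: P j.+1).
  rewrite -addrA; congr (_ + _); rewrite -sumrB; apply: eq_bigr => j _.
  rewrite {2}/P /= -/P scalerBr opprB addrCA scale_scalar_mx subrr addr0.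
  by rewrite -scalemxAl scalerA exprS.
rewrite addrAC -(big_mkord xpredT (fun j => t ^+ j *: P j)).
rewrite -(big_mkord xpredT (fun j => t ^+ j.+1 *: P j.+1)).
rewrite -opprB -sumrB (telescope_sumr_eq (fun j => t ^+ j *: P j))//.
rewrite newton_mx_n scaler0 sub0r opprK expr0 scale1r.
by rewrite big_ord_recl expr0 mul1r elem_sym0 raddfD /= raddf_sum.
Qed.

(* Cancelling [1 + X S] requires polynomial coefficients: its determinant is
   a nonzero polynomial but may vanish at a given [t]. *)
Lemma newton_mx_adj t :
  \adj (1%:M + t *: S) = \sum_(j < n) t ^+ j *: P j.
Proof.
pose A : 'M[{poly R}]_n := 1%:M + 'X *: map_mx polyC S.
pose Q : 'M[{poly R}]_n := \sum_(j < n) 'X ^+ j *: map_mx polyC (P j).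
have evA u : map_mx (horner_eval u) A = 1%:M + u *: S.
  apply/matrixP => i j.
  by rewrite !mxE /= /horner_eval hornerD hornerM hornerX hornerC hornerMn hornerC.
have evQ u : map_mx (horner_eval u) Q = \sum_(j < n) u ^+ j *: P j.
  rewrite raddf_sum; apply: eq_bigr => j _; apply/matrixP => a b.
  by rewrite !mxE /= /horner_eval hornerM hornerXn hornerC.
have QA : Q *m A = (\det A)%:M.
  apply/matrixP => a b; apply: poly_ext => u.
  have /matrixP/(_ a b) := newton_mx_mul u.
  rewrite -evA -evQ -map_mxM det_map_mx !mxE /= /horner_eval => ->.
  by rewrite hornerMn.
have dA0 : \det A != 0.
  apply/eqP => /(congr1 (fun p => p.[0])); rewrite -[LHS]/(horner_eval 0 _).
  by rewrite -det_map_mx evA scale0r addr0 det1 horner0 => /eqP; rewrite oner_eq0.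
have QE : Q = \adj A.
  have : \det A *: Q = \det A *: \adj A.
    by rewrite -mul_mx_scalar -mul_mx_adj mulmxA QA mul_scalar_mx.
  move=> /matrixP QE; apply/matrixP => a b; have := QE a b; rewrite !mxE.
  exact: mulfI.
by rewrite -evQ QE map_mx_adj evA.
Qed.

(** $P_k$ is the coefficient of $t^k$ in $\mathrm{adj}(1+tS)$. The right-hand side is polynomial in
    the entries of [S] and does not mention the eigenvalues [l]; the regularity of the Newton field
    rests on this. *)
Lemma newton_mx_interpolation (k : 'I_n) (c : 'I_n -> R) :
  (forall j : 'I_n, \sum_i c i * i%:R ^+ j = (j == k)%:R) ->
  P k = \sum_(i < n) c i *: \adj (1%:M + i%:R *: S).
Proof.
move=> cE; under eq_bigr do rewrite newton_mx_adj scaler_sumr.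
rewrite exchange_big /=; under eq_bigr => j _.
  under eq_bigr do rewrite scalerA.
  rewrite -scaler_suml cE.
  over.
by rewrite (bigD1 k)//= eqxx scale1r big1 ?addr0// => j /negPf ->; rewrite scale0r.
Qed.

End NewtonTransformations.

(** * C^1 functions and the divergence of the flux *)

Section DirectionalDerivatives.
Context {R : realType} {V : normedModType R}.

Lemma is_derive_line (f : V -> R) (p v : V) (s df : R) :
  is_derive (p + s *: v) v f df ->
  is_derive s (1 : R) (fun t => f (p + t *: v)) df.
Proof.
have E : (fun h : R => h^-1 *: ((f \o shift (p + s *: v)) (h *: v) - f (p + s *: v))) =
  (fun h : R => h^-1 *: (((fun t => f (p + t *: v)) \o shift s) (h *: (1:R)) - f (p + s *: v))).
  apply/funext => h /=; congr (_ *: (f _ - _)).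
  by rewrite [_%:A]mulr1 scalerDl addrCA.
move=> [fd <-]; apply: DeriveDef; first by rewrite /derivable -E.
by rewrite /derive -E.
Qed.

Lemma is_derive_translate {W : normedModType R} (f : V -> W) (p v w : V) df :
  is_derive (p + w) v f df -> is_derive p v (fun q => f (q + w)) df.
Proof.
have E : (fun h : R => h^-1 *: ((f \o shift (p + w)) (h *: v) - f (p + w))) =
  (fun h : R => h^-1 *: (((fun q => f (q + w)) \o shift p) (h *: v) - f (p + w))).
  by apply/funext => h /=; rewrite addrA.
move=> [fd <-]; apply: DeriveDef; first by rewrite /derivable -E.
by rewrite /derive -E.
Qed.

Lemma MVT_line (f df : V -> R) (p v : V) (h : R) : 0 < h ->
  (forall s, 0 <= s <= h -> is_derive (p + s *: v) v f (df (p + s *: v))) ->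
  exists2 s, 0 < s < h & f (p + h *: v) - f p = h * df (p + s *: v).
Proof.
move=> h0 dfP.
have dl s : 0 <= s <= h -> is_derive s (1 : R) (fun t => f (p + t *: v)) (df (p + s *: v)).
  by move=> /dfP; exact: is_derive_line.
have [| |s] := @MVT R (fun t => f (p + t *: v)) (fun s => df (p + s *: v)) 0 h h0.
- by move=> s; rewrite in_itv /= => /andP[s0 sh]; apply: dl; rewrite !ltW.
- have dw : {in `[0, h], forall s, derivable (fun t : R => f (p + t *: v)) s (1 : R)}.
    by move=> s; rewrite in_itv /= => sh; have [] := dl s sh.
  exact: derivable_within_continuous dw.
- rewrite in_itv /= => sh; rewrite scale0r addr0 subr0 => ->.
  by exists s => //; rewrite mulrC.
Qed.

(** The mean value theorem twice: along [v] for [f (p + h *: w) - f p], then along [w] for [fv]. *)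
Lemma second_difference (f fv fvw : V -> R) (u v w : V) (h : R) : 0 < h ->
  (forall s t, 0 <= s <= h -> 0 <= t <= h ->
     is_derive (u + s *: v + t *: w) v f (fv (u + s *: v + t *: w)) /\
     is_derive (u + s *: v + t *: w) w fv (fvw (u + s *: v + t *: w))) ->
  exists s t, [/\ 0 < s < h, 0 < t < h &
    f (u + h *: v + h *: w) - f (u + h *: v) - (f (u + h *: w) - f u) =
    h * (h * fvw (u + s *: v + t *: w))].
Proof.
move=> h0 df.
have hh : 0 <= h <= h by rewrite lexx ltW.
have z0 : 0 <= (0 : R) <= h by rewrite lexx ltW.
have [|s sh ->] := @MVT_line (fun p => f (p + h *: w) - f p)
    (fun p => fv (p + h *: w) - fv p) u v h h0.
  move=> s sh; have [d1 _] := df s h sh hh; have [d2 _] := df s 0 sh z0.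
  rewrite scale0r addr0 in d2; apply: is_deriveB d2.
  exact: is_derive_translate d1.
have sh' : 0 <= s <= h by case/andP: sh => *; rewrite !ltW.
have [|t th ->] := @MVT_line fv fvw (u + s *: v) w h h0.
  by move=> t th; exact: (df s t sh' th).2.
by exists s, t.
Qed.

(** The second difference is symmetric in [v] and [w], so [fvw] and [fwv] take a common value at two
    points arbitrarily close to [u]; continuity at [u] concludes. *)
Lemma derive_symmetric (f fv fw fvw fwv : V -> R) (u v w : V) :
  (\forall p \near u, is_derive p v f (fv p) /\ is_derive p w f (fw p)) ->
  (\forall p \near u, is_derive p w fv (fvw p) /\ is_derive p v fw (fwv p)) ->
  {for u, continuous fvw} -> {for u, continuous fwv} -> fvw u = fwv u.
Proof.
move=> d1 d2 /cvgrPdist_lt cvw /cvgrPdist_lt cwv.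
apply/eqP; rewrite -subr_eq0 -normr_le0; apply/ler_addgt0Pl => e e0.
have e20 : 0 < e / 2 by rewrite divr_gt0.
have /nbhs_normP[r /= r0 rP] : \forall p \near u,
    (is_derive p v f (fv p) /\ is_derive p w f (fw p)) /\
    (is_derive p w fv (fvw p) /\ is_derive p v fw (fwv p)) /\
    `|fvw u - fvw p| < e / 2 /\ `|fwv u - fwv p| < e / 2.
  apply: filterI => //; apply: filterI => //; apply: filterI; [exact: cvw|exact: cwv].
pose c := `|v| + `|w| + 1.
have c0 : 0 < c by rewrite /c -addrA ltr_wpDl// ltr_wpDl.
(* Chosen so that [s *: v + t *: w] with [s] and [t] in $[0,h]$ has norm at most [h * c = r / 2];
   the summand 1 in [c] only keeps [c] positive. *)
pose h := r / 2 / c.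
have h0 : 0 < h by rewrite !divr_gt0.
have small s t : 0 <= s <= h -> 0 <= t <= h -> ball_ Num.Def.normr u r (u + s *: v + t *: w).
  move=> /andP[s0 sh] /andP[t0 th]; rewrite /= -addrA opprD addrA subrr sub0r normrN.
  apply: (@le_lt_trans _ _ (h * c)); last by rewrite divfK ?gt_eqF// ltr_pdivrMr// ltr_pMr// ltr1n.
  apply: le_trans (ler_normD _ _) _; rewrite !normrZ !ger0_norm//.
  rewrite /c !mulrDr mulr1; apply: ler_wpDr; first exact: ltW.
  by apply: lerD; rewrite ler_wpM2r.
have [|s [t [sh th E1]]] := @second_difference f fv fvw u v w h h0.
  by move=> s t sh th; have [[? ?] [[? ?] _]] := rP _ (small s t sh th).
have [|s' [t' [sh' th' E2]]] := @second_difference f fw fwv u w v h h0.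
  move=> s' t' sh' th'; rewrite [u + _ + _]addrAC.
  by have [[? ?] [[? ?] _]] := rP _ (small t' s' th' sh').
have lw (a : R) : 0 < a < h -> 0 <= a <= h by case/andP => *; rewrite !ltW.
have [_ [_ [/= A1 _]]] := rP _ (small s t (lw _ sh) (lw _ th)).
have [_ [_ [/= _ A2]]] := rP _ (small t' s' (lw _ th') (lw _ sh')).
have EE : fvw (u + s *: v + t *: w) = fwv (u + t' *: v + s' *: w).
  have hn : h != 0 by rewrite gt_eqF.
  apply: (mulfI hn); apply: (mulfI hn); rewrite -E1 [in RHS]addrAC -E2.
  by rewrite [u + h *: v + h *: w]addrAC; ring.
rewrite addr0 -(subrKA (fvw (u + s *: v + t *: w))).
apply: le_trans (ler_normD _ _) _; rewrite (splitr e) lerD// ltW//.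
by rewrite EE distrC.
Qed.

Lemma is_derive_bigsum {W : normedModType R} (I : Type) (r : seq I) (P : pred I)
    (f : I -> V -> W) (df : I -> W) (x v : V) :
  (forall i, P i -> is_derive x v (f i) (df i)) ->
  is_derive x v (fun y => \sum_(i <- r | P i) f i y) (\sum_(i <- r | P i) df i).
Proof.
move=> h; elim: r => [|i r IH].
  rewrite big_nil; under eq_fun do rewrite big_nil; exact: is_derive_cst.
rewrite big_cons; under eq_fun do rewrite big_cons; case: ifPn => [/h hi|//].
exact: is_deriveD.
Qed.

Lemma is_derive_prod (I : eqType) (r : seq I) (f : I -> V -> R) (df : I -> R) (x v : V) :
  uniq r -> (forall i, is_derive x v (f i) (df i)) ->
  is_derive x v (fun y => \prod_(i <- r) f i y)
    (\sum_(k <- r) \prod_(i <- r) (if i == k then df i else f i x)).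
Proof.
move=> ur h; elim: r ur => [_|i r IH /= /andP[ir ur]].
  rewrite big_nil; under eq_fun do rewrite big_nil; exact: is_derive_cst.
under eq_fun do rewrite big_cons.
have := is_deriveM (h i) (IH ur) => /is_derive_eq; apply.
rewrite big_cons big_cons eqxx addrC; congr (_ + _).
  rewrite [LHS]mulrC; congr (_ * _); apply: eq_big_seq => j jr.
  by rewrite ifN//; apply: contraNneq ir => <-.
rewrite [LHS]mulr_sumr; apply: eq_big_seq => k kr; rewrite big_cons ifN//.
by apply: contraNneq ir => ->.
Qed.

Lemma is_derive_det n (A : V -> 'M[R]_n) (dA : 'M[R]_n) (x v : V) :
  (forall i j, is_derive x v (fun y => A y i j) (dA i j)) ->
  is_derive x v (fun y => \det (A y))
    (\sum_k \det (\matrix_(i, j) (if i == k then dA i j else A x i j))).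
Proof.
move=> h; rewrite /determinant.
rewrite exchange_big /=.
apply: is_derive_bigsum => s _; rewrite -mulr_sumr.
have dp := is_derive_prod (index_enum_uniq 'I_n) (fun i => h i (perm.fun_of_perm s i)).
apply: (is_derive_eq (is_deriveZ ((-1) ^+ perm.odd_perm s : R) dp)).
congr (_ * _); apply: eq_bigr => k _.
by apply: eq_bigr => i _; rewrite mxE.
Qed.

End DirectionalDerivatives.

Lemma near_eq_differentiable {R : realType} {V W : normedModType R} (f g : V -> W) (u : V) :
  (\forall p \near u, f p = g p) -> differentiable f u -> differentiable g u.
Proof.
move=> fg df; have [cd fE] := (diff_locallyP _ _).1 df.
have gE : g \o shift u = cst (g u) + 'd f u +o_ 0 id.
  apply/eqaddoP => eps eps0; move/eqaddoP : fE => /(_ eps eps0).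
  have := fg; rewrite (near_shift 0) subr0 -(nbhs_singleton fg).
  by apply: filterS2 => h; rewrite /= => fgh; rewrite /= !fctE /= fgh.
have dE := diff_unique cd gE.
by apply/diff_locallyP; rewrite dE.
Qed.

Section C1Functions.
Context {R : realType} {n : nat}.
Implicit Types (f g : 'rV[R]_n -> R) (u : 'rV[R]_n).

Let e (i : 'I_n) : 'rV[R]_n := delta_mx 0 i.

(** The partial derivatives are asked to be continuous at [u] alone; required at all points of an
    open set, this is the usual $C^1$ there. *)
Definition C1_at u f :=
  (\forall p \near u, differentiable f p) /\
  forall i, {for u, continuous ('D_(e i) f)}.

Lemma near_near (P : 'rV[R]_n -> Prop) u :
  (\forall p \near u, P p) -> \forall p \near u, \forall q \near p, P q.
Proof. by move=> /nbhs_interior. Qed.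

Lemma C1_at_near f g u :
  (\forall p \near u, f p = g p) -> C1_at u f -> C1_at u g.
Proof.
move=> /near_near fg [df cf]; split.
  by apply: filterS2 fg df => p; exact: near_eq_differentiable.
move=> i; have E : \forall p \near u, 'D_(e i) f p = 'D_(e i) g p.
  by apply: filterS fg => p; exact: near_eq_derive.
rewrite /prop_for /continuous_at -(nbhs_singleton E).
exact: cvg_trans (near_eq_cvg E) (cf i).
Qed.

Lemma C1_at_differentiable u f : C1_at u f -> differentiable f u.
Proof. by case=> /nbhs_singleton. Qed.

Lemma C1_at_is_derive u f v : C1_at u f -> is_derive u v f ('D_v f u).
Proof. by move=> /C1_at_differentiable df; apply/derivableP/diff_derivable. Qed.

Lemma C1_at_continuous u f : C1_at u f -> {for u, continuous f}.
Proof. by move=> /C1_at_differentiable/differentiable_continuous. Qed.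

Lemma C1_at_intro u f (df : 'I_n -> 'rV[R]_n -> R) :
  (\forall p \near u, differentiable f p /\ forall i, is_derive p (e i) f (df i p)) ->
  (forall i, {for u, continuous (df i)}) -> C1_at u f.
Proof.
move=> dfP cdf; split; first by apply: filterS dfP => p [].
move=> i; have E : \forall p \near u, df i p = 'D_(e i) f p.
  by apply: filterS dfP => p [_ /(_ i)[]].
rewrite /prop_for /continuous_at -(nbhs_singleton E).
exact: cvg_trans (near_eq_cvg E) (cdf i).
Qed.

Lemma C1_at_cst u (a : R) : C1_at u (cst a).
Proof.
apply: (@C1_at_intro _ _ (fun _ => cst 0)) => [|i]; last exact: cst_continuous.
by near=> p; split=> [|i]; [exact: differentiable_cst|exact: is_derive_cst].
Unshelve. all: by end_near. Qed.

Lemma C1_atD u f g : C1_at u f -> C1_at u g -> C1_at u (f + g).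
Proof.
move=> [df cf] [dg cg].
apply: (@C1_at_intro _ _ (fun i => 'D_(e i) f + 'D_(e i) g)) => [|i].
  near=> p.
  have dfp : differentiable f p by near: p.
  have dgp : differentiable g p by near: p.
  split; first exact: differentiableD.
  by move=> i; apply: is_deriveD; apply/derivableP/diff_derivable.
exact: cvgD (cf i) (cg i).
Unshelve. all: by end_near. Qed.

Lemma C1_atM u f g : C1_at u f -> C1_at u g -> C1_at u (f * g).
Proof.
move=> Cf Cg; have [df cf] := Cf; have [dg cg] := Cg.
apply: (@C1_at_intro _ _ (fun i => f * 'D_(e i) g + g * 'D_(e i) f)) => [|i].
  near=> p.
  have dfp : differentiable f p by near: p.
  have dgp : differentiable g p by near: p.
  split; first exact: differentiableM.
  by move=> i; apply: is_deriveM; apply/derivableP/diff_derivable.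
exact: cvgD (cvgM (C1_at_continuous Cf) (cg i)) (cvgM (C1_at_continuous Cg) (cf i)).
Unshelve. all: by end_near. Qed.

Lemma C1_at_sum u (I : Type) (r : seq I) (P : pred I) (f : I -> 'rV[R]_n -> R) :
  (forall i, P i -> C1_at u (f i)) -> C1_at u (fun p => \sum_(i <- r | P i) f i p).
Proof.
move=> h; elim: r => [|i r IH].
  by under eq_fun do rewrite big_nil; exact: C1_at_cst.
under eq_fun do rewrite big_cons; case: (boolP (P i)) => [/h hi|//].
exact: C1_atD.
Qed.

Lemma C1_at_prod u (I : Type) (r : seq I) (f : I -> 'rV[R]_n -> R) :
  (forall i, C1_at u (f i)) -> C1_at u (fun p => \prod_(i <- r) f i p).
Proof.
move=> h; elim: r => [|i r IH].
  by under eq_fun do rewrite big_nil; exact: C1_at_cst.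
under eq_fun do rewrite big_cons.
exact: C1_atM.
Qed.

Lemma C1_at_det u m (A : 'rV[R]_n -> 'M[R]_m) :
  (forall i j, C1_at u (fun p => A p i j)) -> C1_at u (fun p => \det (A p)).
Proof.
move=> h; apply: C1_at_sum => s _.
by apply: C1_atM; [exact: C1_at_cst|exact: C1_at_prod].
Qed.

Lemma C1_at_comp u f (h dh : R -> R) :
  (forall y, is_derive y (1 : R) h (dh y)) -> continuous dh ->
  C1_at u f -> C1_at u (h \o f).
Proof.
move=> hP cdh Cf; have [df cf] := Cf.
apply: (@C1_at_intro _ _ (fun i p => dh (f p) * 'D_(e i) f p)) => [|i].
  near=> p.
  have dfp : differentiable f p by near: p.
  have dhp : differentiable h (f p) by apply/derivable1_diffP; have [] := hP (f p).
  split; first exact: differentiable_comp.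
  move=> i; have dc := differentiable_comp dfp dhp.
  apply: (@DeriveDef _ _ _ _ _ _ _); first exact: diff_derivable.
  have [_ <-] := hP (f p).
  rewrite deriveE// [in RHS]deriveE// [X in _ * X]deriveE// diff_comp// /=.
  by rewrite -[X in 'd h _ X = _]mulr1 [LHS]linearZ mulrC.
exact: cvgM (continuous_comp (C1_at_continuous Cf) (cdh (f u))) (cf i).
Unshelve. all: by end_near. Qed.

End C1Functions.

(** * Determinants in the frame of normal and tangent vectors *)

Section RowReplacement.
Context {R : comNzRingType}.

Definition rowset {n m} (A : 'M[R]_(n, m)) (i : 'I_n) (v : 'rV[R]_m) : 'M[R]_(n, m) :=
  \matrix_(r, j) if r == i then v 0 j else A r j.

Lemma rowset_mulmx n m p (A : 'M[R]_(n, m)) i v (B : 'M[R]_(m, p)) :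
  rowset A i v *m B = rowset (A *m B) i (v *m B).
Proof.
apply/matrixP => r j; rewrite !mxE; case: (eqVneq r i) => [->|ri].
  by apply: eq_bigr => k _; rewrite mxE eqxx.
by apply: eq_bigr => k _; rewrite mxE (negPf ri).
Qed.

(** Cramer's rule: the cofactors along row [i] do not involve row [i] itself. *)
Lemma det_rowset n (A : 'M[R]_n) i v : \det (rowset A i v) = (v *m \adj A) 0 i.
Proof.
rewrite (expand_det_row _ i) mxE; apply: eq_bigr => j _.
rewrite !mxE eqxx; congr (_ * (_ * \det _)).
by apply/matrixP => r k; rewrite !mxE [_ == i]eq_sym (negPf (neq_lift _ _)).
Qed.

Lemma det_xrow n (A : 'M[R]_n) i j : i != j -> \det (xrow i j A) = - \det A.
Proof.
move=> ij; rewrite [xrow i j A]row_permE det_mulmx det_perm.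
by rewrite perm.odd_tperm ij expr1 mulN1r.
Qed.

Lemma rowset_swap n m (A : 'M[R]_(n, m)) i j v w : i != j ->
  xrow i j (rowset (rowset A i v) j w) = rowset (rowset A j v) i w.
Proof.
move=> ij; apply/matrixP => r k; rewrite !mxE.
case: perm.tpermP => [->|->|/eqP ri /eqP rj].
- by rewrite !eqxx.
- by rewrite !eqxx (negPf ij) [j == i]eq_sym (negPf ij).
- by rewrite (negPf ri) (negPf rj).
Qed.

(* The matrices below have the rows [nu; Y_0; ...; Y_(n-1)]; in the frame
   [nu; X] they become block matrices. *)
Lemma det_frame n (nu : 'rV[R]_n.+1) (X : 'M[R]_(n, n.+1)) (M : 'M[R]_n) i a b :
  \det (col_mx nu (rowset (M *m X) i (a *m X + b *: nu)) : 'M[R]_(1 + n)) =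
  \det (col_mx nu X : 'M[R]_(1 + n)) * (a *m \adj M) 0 i.
Proof.
have -> : col_mx nu (rowset (M *m X) i (a *m X + b *: nu)) =
    block_mx 1%:M 0 (b *: delta_mx i 0) (rowset M i a) *m col_mx nu X.
  rewrite mul_block_col mul1mx mul0mx addr0; congr col_mx.
  rewrite rowset_mulmx; apply/matrixP => r j; rewrite !mxE big_ord1 !mxE.
  by case: eqP; rewrite ?mulr1 ?mulr0 ?mul0r ?add0r// addrC.
by rewrite (@det_mulmx _ (1 + n)) det_lblock det1 mul1r det_rowset mulrC.
Qed.

(** Here the first row is tangential, so only the normal part [b *: nu] of row [i] contributes.
    Exchanging these two rows makes the coefficient matrix block triangular, whence the minus
    sign. *)
Lemma det_frame_normal n (nu : 'rV[R]_n.+1) (X : 'M[R]_(n, n.+1)) (M S : 'M[R]_n) i a b :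
  \det (col_mx (row i S *m X) (rowset (M *m X) i (a *m X + b *: nu)) : 'M[R]_(1 + n)) =
  - (b * (\det (col_mx nu X : 'M[R]_(1 + n)) * (S *m \adj M) i i)).
Proof.
pose s := row i S.
have -> : col_mx (s *m X) (rowset (M *m X) i (a *m X + b *: nu)) =
    block_mx 0 s (b *: delta_mx i 0) (rowset M i a) *m col_mx nu X.
  rewrite mul_block_col mul0mx add0r; congr col_mx.
  rewrite rowset_mulmx; apply/matrixP => r j; rewrite !mxE big_ord1 !mxE.
  by case: eqP; rewrite ?mulr1 ?mulr0 ?mul0r ?add0r// addrC.
rewrite (@det_mulmx _ (1 + n)).
have {1}-> : block_mx 0 s (b *: delta_mx i 0) (rowset M i a) =
    xrow (lshift n ord0) (rshift 1 i) (block_mx b%:M a 0 (rowset M i s)) :> 'M[R]_(1 + n).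
  apply/matrixP => r j; rewrite [RHS]mxE.
  case: (split_ordP r) => r' ->.
    rewrite !ord1 perm.tpermL /block_mx col_mxEu col_mxEd.
    case: (split_ordP j) => j' ->; first by rewrite !row_mxEl !mxE.
    by rewrite !row_mxEr [in RHS]mxE eqxx.
  have [->|r'i] := eqVneq r' i.
    rewrite perm.tpermR /block_mx col_mxEu col_mxEd.
    case: (split_ordP j) => j' ->; last by rewrite !row_mxEr mxE eqxx.
    by rewrite !row_mxEl !ord1 !mxE !eqxx mulr1.
  rewrite perm.tpermD ?eq_lrshift// 1?eq_sym ?eq_rshift// 1?eq_sym// /block_mx !col_mxEd.
  case: (split_ordP j) => j' ->.
    by rewrite !row_mxEl !mxE (negPf r'i) mulr0.
  by rewrite !row_mxEr !mxE (negPf r'i).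
rewrite (@det_xrow (1 + n)) ?eq_lrshift// (@det_ublock _ 1 n) det_scalar1 det_rowset.
by rewrite mulNr -mulrA; congr (- (_ * _)); rewrite mulrC -row_mul mxE.
Qed.

End RowReplacement.

Section SmoothMaps.
Context {R : realType} {n m : nat} (U : set 'rV[R]_n) (F : 'rV[R]_n -> 'rV[R]_m).
Hypotheses (oU : open U) (sF : smooth_on U F).

Let e (i : 'I_n) : 'rV[R]_n := delta_mx 0 i.

Lemma smooth_on_derive i : smooth_on U ('D_(e i) F).
Proof. by move=> j; exact: (sF j.+1).2. Qed.

Lemma smooth_on_differentiable u : U u -> differentiable F u.
Proof. exact: (sF 1).1. Qed.

Lemma is_derive_coord u a v : U u ->
  is_derive u v (fun p => F p 0 a) ('D_v F u 0 a).
Proof.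
move=> Uu; have dF : derivable F u v by exact/diff_derivable/smooth_on_differentiable.
apply: DeriveDef; first exact: (derivable_mxP F u v).1 dF 0 a.
by rewrite derive_mx// mxE.
Qed.

Lemma jacobianE u i a : U u -> 'J F u i a = 'D_(e i) F u 0 a.
Proof.
move=> Uu; rewrite deriveEjacobian; last exact: smooth_on_differentiable.
rewrite /e -rowE [RHS]mxE; reflexivity.
Qed.

Lemma open_near u : U u -> \forall p \near u, U p.
Proof. by move=> Uu; exact: open_nbhs_nbhs. Qed.

Lemma smooth_on_C1_at u a : U u -> C1_at u (fun p => F p 0 a).
Proof.
move=> Uu; apply: (@C1_at_intro _ _ _ _ (fun i p => 'D_(e i) F p 0 a)) => [|i].
  apply: filterS (open_near Uu) => p Up; split; last by move=> i; exact: is_derive_coord.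
  apply: (@differentiable_comp _ _ _ _ F (fun v : 'rV[R]_m => v 0 a)).
    exact: smooth_on_differentiable.
  exact: differentiable_coord.
have c1 : {for u, continuous ('D_(e i) F)} by exact: (smooth_on_derive i 0%N).
exact: (continuous_comp c1 (@coord_continuous R 1 m 0 a _)).
Qed.

End SmoothMaps.

Section SecondDerivatives.
Context {R : realType} {n m : nat} (U : set 'rV[R]_n) (F : 'rV[R]_n -> 'rV[R]_m).
Hypotheses (oU : open U) (sF : smooth_on U F).

Let e (i : 'I_n) : 'rV[R]_n := delta_mx 0 i.

Lemma C1_at_jacobian u i a : U u -> C1_at u (fun p => 'J F p i a).
Proof.
move=> Uu; apply: C1_at_near (smooth_on_C1_at oU (smooth_on_derive sF i) a Uu).
by apply: filterS (open_near oU Uu) => p Up; rewrite (jacobianE sF).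
Qed.

Lemma is_derive_jacobian u i j a : U u ->
  is_derive u (e j) (fun p => 'J F p i a) ('D_(e j) ('D_(e i) F) u 0 a).
Proof.
move=> Uu; apply: near_eq_is_derive (is_derive_coord (smooth_on_derive sF i) a (e j) Uu).
by apply: filterS (open_near oU Uu) => p Up; rewrite (jacobianE sF).
Qed.

Lemma smooth_on_symmetric u i j a : U u ->
  'D_(e j) ('D_(e i) F) u 0 a = 'D_(e i) ('D_(e j) F) u 0 a.
Proof.
move=> Uu.
apply: (@derive_symmetric _ _ (fun p => F p 0 a) (fun p => 'D_(e i) F p 0 a)
  (fun p => 'D_(e j) F p 0 a) (fun p => 'D_(e j) ('D_(e i) F) p 0 a)
  (fun p => 'D_(e i) ('D_(e j) F) p 0 a) u (e i) (e j)).
- apply: filterS (open_near oU Uu) => p Up.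
  by split; exact: (is_derive_coord sF).
- apply: filterS (open_near oU Uu) => p Up.
  by split; apply: (is_derive_coord (smooth_on_derive sF _)).
- exact: (C1_at_continuous (smooth_on_C1_at oU (smooth_on_derive (smooth_on_derive sF i) j) a Uu)).
- exact: (C1_at_continuous (smooth_on_C1_at oU (smooth_on_derive (smooth_on_derive sF j) i) a Uu)).
Qed.

End SecondDerivatives.

Section LocalDivergence.
Context {R : realType} {n : nat} (U : set 'rV[R]_n) (xi ni : 'rV[R]_n -> 'rV[R]_n.+1).
Hypotheses (oU : open U) (sx : smooth_on U xi) (sn : smooth_on U ni).

Let e (i : 'I_n) : 'rV[R]_n := delta_mx 0 i.

(* [flux t i] is the [i]-th component, times the density [det (nu, X)], of the
   field [a adj(1 + t S)], where [a] is the tangential part of the position. *)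
Definition flux (t : R) (i : 'I_n) (u : 'rV[R]_n) : R :=
  \det (col_mx (ni u) (rowset ('J xi u + t *: 'J ni u) i (xi u)) : 'M[R]_(1 + n)).

Lemma C1_at_flux t i u : U u -> C1_at u (flux t i).
Proof.
move=> Uu; apply: (@C1_at_det R n u (1 + n)) => r j.
case: (split_ordP r) => r' ->.
  rewrite (_ : (fun p => _) = (fun p => ni p 0 j)); last first.
    by apply/funext => p; rewrite col_mxEu (ord1 r').
  exact: (smooth_on_C1_at oU sn _ Uu).
rewrite (_ : (fun p => _) = (fun p => rowset ('J xi p + t *: 'J ni p) i (xi p) r' j)); last first.
  by apply/funext => p; rewrite col_mxEd.
have [r'i|r'i] := eqVneq r' i.
  rewrite (_ : (fun p => _) = (fun p => xi p 0 j)); last first.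
    by apply/funext => p; rewrite mxE r'i eqxx.
  exact: (smooth_on_C1_at oU sx _ Uu).
rewrite (_ : (fun p => _) = (fun p => 'J xi p r' j + t * 'J ni p r' j)); last first.
  by apply/funext => p; rewrite mxE (negPf r'i) mxE [X in _ + X]mxE.
apply: C1_atD; first exact: (C1_at_jacobian oU sx _ _ Uu).
apply: C1_atM; first exact: C1_at_cst.
exact: (C1_at_jacobian oU sn _ _ Uu).
Qed.

Lemma sum_antisymmetric (T : 'I_n -> 'I_n -> R) :
  (forall i r, i != r -> T i r = - T r i) -> \sum_i \sum_(r | r != i) T i r = 0.
Proof.
move=> Tas; set s := \sum_i _.
suff : s = - s by move=> sN; lra.
rewrite {1}/s (exchange_big_dep xpredT) //= -sumrN; apply: eq_bigr => i _.
rewrite -sumrN; apply: eq_big => [r|r ri]; first by rewrite eq_sym.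
by rewrite Tas// eq_sym.
Qed.

(** Row-wise differentiation gives three kinds of terms: the row [nu] yields the trace with factor
    [b], the row holding [xi] yields the trace of the adjugate since $\partial_i x$ is row [i] of
    $X$, and the remaining rows yield second derivatives, which cancel in pairs. *)
Lemma divergence_flux t u (S : 'M[R]_n) (a : 'rV[R]_n) (b : R) : U u ->
  'J ni u = S *m 'J xi u -> xi u = a *m 'J xi u + b *: ni u ->
  \sum_i 'D_(e i) (flux t i) u =
  \det (col_mx (ni u) ('J xi u) : 'M[R]_(1 + n)) *
    (\tr (\adj (1%:M + t *: S)) - b * \tr (S *m \adj (1%:M + t *: S))).
Proof.
move=> Uu NS xE; set M := 1%:M + t *: S; set X := 'J xi u.
pose Y := X + t *: 'J ni u.
have YE : Y = M *m X by rewrite /Y NS mulmxDl mul1mx scalemxAl.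
(* [H i r] is $\partial_i\partial_r(x+t\nu)$, kept opaque with its symmetry as the property used in
   the cancellation. *)
have [H [HE Hsym]] : exists H : 'I_n -> 'I_n -> 'rV[R]_n.+1,
    (forall i r j, H i r 0 j =
       'D_(e i) ('D_(e r) xi) u 0 j + t * 'D_(e i) ('D_(e r) ni) u 0 j) /\
    forall i r, H i r = H r i.
  exists (fun i r => \row_j ('D_(e i) ('D_(e r) xi) u 0 j + t * 'D_(e i) ('D_(e r) ni) u 0 j)).
  split=> [i r j|i r]; first by rewrite mxE.
  apply/rowP => j; rewrite [LHS]mxE [RHS]mxE.
  apply: (f_equal2 (fun y z => y + t * z)).
    exact: (smooth_on_symmetric oU sx _ _ _ Uu).
  exact: (smooth_on_symmetric oU sn _ _ _ Uu).
(* The term of $\partial_i$ in which row [r] is differentiated. As [H i r = H r i], exchanging [i]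
   and [r] amounts to swapping two rows, so [T] is antisymmetric. *)
pose T i r := \det (col_mx (ni u) (rowset (rowset Y i (xi u)) r (H i r)) : 'M[R]_(1 + n)).
have dflux i : 'D_(e i) (flux t i) u =
    \det (col_mx (row i S *m X) (rowset Y i (xi u)) : 'M[R]_(1 + n)) +
    (\det (col_mx (ni u) (rowset Y i (row i X)) : 'M[R]_(1 + n)) +
    \sum_(r | r != i) T i r).
  pose A p : 'M[R]_(1 + n) := col_mx (ni p) (rowset ('J xi p + t *: 'J ni p) i (xi p)).
  pose dA : 'M[R]_(1 + n) := col_mx (row i S *m X) (\matrix_(r, j) (if r == i then X i j else H i r 0 j)).
  have dAP r j : is_derive u (e i) (fun p => A p r j) (dA r j).
    rewrite /A /dA; case: (split_ordP r) => r' ->.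
      rewrite (_ : (fun p => _) = (fun p => ni p 0 j)); last first.
        by apply/funext => p; rewrite col_mxEu (ord1 r').
      rewrite col_mxEu (ord1 r') -row_mul -NS mxE (jacobianE sn)//.
      exact: (is_derive_coord sn _ _ Uu).
    rewrite (_ : (fun p => _) = (fun p => rowset ('J xi p + t *: 'J ni p) i (xi p) r' j)); last first.
      by apply/funext => p; rewrite col_mxEd.
    rewrite col_mxEd mxE; have [r'i|r'i] := eqVneq r' i.
      rewrite (_ : (fun p => _) = (fun p => xi p 0 j)); last first.
        by apply/funext => p; rewrite mxE r'i eqxx.
      rewrite /X (jacobianE sx)//; exact: (is_derive_coord sx _ _ Uu).
    rewrite (_ : (fun p => _) = (fun p => 'J xi p r' j + t * 'J ni p r' j)); last first.
      by apply/funext => p; rewrite mxE (negPf r'i) mxE [X in _ + X]mxE.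
    rewrite HE.
    apply: is_deriveD; first exact: (is_derive_jacobian oU sx _ _ _ Uu).
    by apply: is_deriveZ; exact: (is_derive_jacobian oU sn _ _ _ Uu).
  have [_ ->] := is_derive_det dAP.
  rewrite big_split_ord /= big_ord1 (bigD1 i) //=; congr (_ + (_ + _)).
  - congr (\det _); apply/matrixP => r j; rewrite mxE /A /dA.
    case: (split_ordP r) => r' ->; rewrite ?col_mxEu ?col_mxEd.
      by rewrite (ord1 r') eqxx.
    by rewrite eq_rlshift.
  - congr (\det _); apply/matrixP => r j; rewrite mxE /A /dA.
    case: (split_ordP r) => r' ->; rewrite ?col_mxEu ?col_mxEd.
      by rewrite eq_lrshift.
    by rewrite eq_rshift !mxE; case: eqP => // ->.
  - apply: eq_bigr => r ri; congr (\det _); apply/matrixP => q j; rewrite mxE /A /dA.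
    case: (split_ordP q) => q' ->; rewrite ?col_mxEu ?col_mxEd.
      by rewrite eq_lrshift.
    rewrite eq_rshift [in LHS]mxE [in RHS]mxE; case: (eqVneq q' r) => [->|_].
      by rewrite (negPf ri).
    by [].
under eq_bigr do rewrite dflux.
rewrite !big_split /= sum_antisymmetric ?addr0; last first.
  move=> i r ir; rewrite /T Hsym -(@det_xrow _ (1 + n) _ (rshift 1 i) (rshift 1 r)) ?eq_rshift//.
  congr (\det _); rewrite -(@rowset_swap _ n _ Y r i (xi u) (H r i)) 1?eq_sym//.
  apply/matrixP => q j; rewrite [RHS]mxE.
  case: (split_ordP q) => q' ->; rewrite ?col_mxEu ?col_mxEd.
    by rewrite perm.tpermD ?eq_rlshift// col_mxEu.
  rewrite mxE perm.tpermC.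
  case: perm.tpermP => [->|->|/eqP qi /eqP qr].
  - by rewrite perm.tpermL col_mxEd.
  - by rewrite perm.tpermR col_mxEd.
  - by rewrite perm.tpermD ?eq_rshift 1?eq_sym// col_mxEd.
rewrite mulrBr addrC; congr (_ + _).
  rewrite /mxtrace mulr_sumr; apply: eq_bigr => i _.
  rewrite YE -[row i X]addr0 -(scale0r (ni u)) rowE det_frame.
  by rewrite -rowE mxE.
rewrite mulrCA mulr_sumr mulr_sumr -sumrN; apply: eq_bigr => i _.
by rewrite YE {1}xE det_frame_normal.
Qed.

End LocalDivergence.

Section NewtonTraces.
Context {R : realType} {n : nat} (S : 'M[R]_n) (l : 'rV[R]_n).
Hypothesis splitS : char_poly S = \prod_(i < n) ('X - (l 0 i)%:P).
Let P := newton_mx (elem_sym ^~ l) S.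

(** Jacobi's formula $\frac{d}{dt}\det(1+tS)=\mathrm{tr}(S\,\mathrm{adj}(1+tS))$, read coefficient
    by coefficient. *)
Lemma trace_mul_newton_mx j : (j < n)%N -> \tr (S *m P j) = j.+1%:R * elem_sym j.+1 l.
Proof.
move: j; apply: coef_eq_horner => t.
have -> : \sum_(j < n) t ^+ j * \tr (S *m P j) = \tr (S *m \adj (1%:M + t *: S)).
  rewrite (newton_mx_adj splitS) mulmx_sumr raddf_sum; apply: eq_bigr => j _.
  by rewrite /= -scalemxAr mxtraceZ.
pose p := \poly_(j < n.+1) elem_sym j l.
(* The same function is differentiated as a polynomial in [dp] and as a determinant in [dd];
   uniqueness of the derivative gives the identity. *)
have pE : horner p = (fun t => \det (1%:M + t *: S)).
  apply/funext => y; rewrite (det_one_addZ splitS) horner_poly.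
  by apply: eq_bigr => j _; rewrite mulrC.
have dp := is_derive_poly p t; rewrite pE in dp.
have dA i j : is_derive t (1 : R) (fun y : R => (1%:M + y *: S) i j) (S i j).
  have d := @is_deriveD R R R (cst ((1%:M : 'M[R]_n) i j)) (S i j *: id) t 1 0 (S i j *: 1)
    (is_derive_cst _ _ _) (is_deriveZ _ (is_derive_id _ _)).
  rewrite add0r [_%:A]mulr1 in d.
  rewrite (_ : (fun y => _) = cst ((1%:M : 'M[R]_n) i j) + S i j *: id)//.
  by apply/funext => y; rewrite !mxE !fctE [y * _]mulrC.
have dd := is_derive_det dA.
have <- : p^`().[t] = \tr (S *m \adj (1%:M + t *: S)).
  have [_ <-] := dp; have [_ ->] := dd; apply: eq_bigr => k _.
  have -> : (S *m \adj (1%:M + t *: S)) k k = (row k S *m \adj (1%:M + t *: S)) 0 k.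
    by rewrite -row_mul [RHS]mxE.
  rewrite -det_rowset; congr (\det _); apply/matrixP => i j; rewrite !mxE.
  by case: eqP => // ->.
rewrite (@horner_coef_wide _ n); last first.
  apply/leq_sizeP => j nj; rewrite coef_deriv nth_default ?mul0rn//.
  by rewrite (leq_trans (size_poly _ _)).
apply: eq_bigr => j _; rewrite coef_deriv coef_poly ltnS ltn_ord.
by rewrite mulrC mulr_natl.
Qed.

(** The recursion gives $\mathrm{tr}\,P_k=n\sigma_k-\mathrm{tr}(SP_{k-1})=n\sigma_k-k\sigma_k$. *)
Lemma trace_newton_mx k : (k < n)%N -> \tr (P k) = (n - k)%:R * elem_sym k l.
Proof.
case: k => [|k] kn; first by rewrite mxtrace1 elem_sym0 subn0 mulr1.
rewrite /P /= -/P raddfB /= mxtrace_scalar mxtrace_mulC trace_mul_newton_mx; last exact: ltnW.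
by rewrite natrB 1?ltnW// mulrBl [n%:R * _]mulr_natl.
Qed.

End NewtonTraces.

(** * Lebesgue integration on row vectors *)

Section BorelMeasurability.
Context {R : realType}.

Lemma measurable_open (T : ptopologicalType) (A : set T) :
  open A -> measurable (A : set (borel T)).
Proof. exact: sub_sigma_algebra. Qed.

Lemma open_preimage_on (T T' : topologicalType) (U : set T) (f : T -> T') (O : set T') :
  open U -> (forall u, U u -> {for u, continuous f}) -> open O ->
  open (U `&` f @^-1` O).
Proof.
move=> oU cf oO; rewrite openE => u [Uu fu].
apply: filterI; first exact: open_nbhs_nbhs.
by apply: (cf u Uu); exact: open_nbhs_nbhs.
Qed.

Lemma measurable_fun_continuous_on (T T' : ptopologicalType) (U : set T) (f : T -> T') :
  open U -> (forall u, U u -> {for u, continuous f}) ->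
  measurable_fun (U : set (borel T)) (f : borel T -> borel T').
Proof.
move=> oU cf; apply: (@measurability _ _ (borel T) (borel T') U f (@open T')) => //.
by move=> _ [B oB <-]; apply: measurable_open; exact: open_preimage_on.
Qed.

Lemma measurable_fun_continuous_real (T : ptopologicalType) (U : set T) (f : T -> R) :
  open U -> (forall u, U u -> {for u, continuous f}) ->
  measurable_fun (U : set (borel T)) (f : borel T -> R).
Proof.
move=> oU cf; apply: (measurability _ (RGenOpens.measurableE R)) => //.
move=> _ [_ [a [b ->]] <-]; apply: measurable_open; exact: open_preimage_on.
Qed.

(** An open set is the countable union of the sup-norm balls with rational centre and radius
    $1/(k+1)$ that it contains, and the preimage of such a ball is a finite intersection of
    conditions on single coordinates. *)
Lemma measurable_fun_rV d (T : measurableType d) n (f : T -> 'rV[R]_n) :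
  (forall i, measurable_fun [set: T] (fun x => f x 0 i)) ->
  measurable_fun [set: T] (f : T -> borel 'rV[R]_n).
Proof.
move=> mf; apply: (@measurability _ _ T (borel 'rV[R]_n) setT f (@open 'rV[R]_n)) => //.
move=> _ [B oB <-]; rewrite setTI.
pose q (z : 'rV[rat]_n * nat) : 'rV[R]_n := map_mx ratr z.1.
pose r (z : 'rV[rat]_n * nat) : R := z.2.+1%:R^-1.
pose P z := ball (q z) (r z) `<=` B.
pose F z := if `[< P z >] then f @^-1` ball (q z) (r z) else set0.
have -> : f @^-1` B = \bigcup_z F z.
  apply/seteqP; split=> [x /= Bfx|x [z _]]; last first.
    by rewrite /F; case: asboolP => // Pz /Pz.
  have [e e0 eB] := (nbhs_ballP _ _).1 (open_nbhs_nbhs (conj oB Bfx)).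
  have [k ke] : exists k : nat, k.+1%:R^-1 < e / 2.
    exists (Num.truncn (e / 2)^-1).
    rewrite -[ltRHS]invrK ltf_pV2 ?posrE ?invr_gt0 ?divr_gt0//.
    exact: Num.Theory.truncnS_gt.
  have dense_q i : exists z : rat, `|ratr z - f x 0 i| < k.+1%:R^-1.
    have /rat_in_itvoo[z] : f x 0 i - k.+1%:R^-1 < f x 0 i + k.+1%:R^-1.
      by rewrite ltrD2l gtrN// invr_gt0.
    by rewrite in_itv /= => zi; exists z; rewrite ltr_distl.
  pose z := (\row_i xchoose (dense_q i), k).
  have zx : ball (q z) (r z) (f x).
    by split=> [|i j]; rewrite ?invr_gt0// /ball /= ord1 !mxE; exact: (xchooseP (dense_q j)).
  exists z => //; rewrite /F asboolT// => y zy; apply: eB.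
  have := ball_triangle (ball_sym zx) zy; apply: le_ball.
  by rewrite [e]splitr lerD// ltW.
apply: countable_bigcupT_measurable => [|z]; first exact: countableP.
rewrite /F; case: asboolP => // _.
have -> : f @^-1` ball (q z) (r z) = \bigcap_(i in [set: 'I_n]) [set x | ball (q z 0 i) (r z) (f x 0 i)].
  apply/seteqP; split=> x.
    by move=> [_ bx] i _; exact: bx.
  by move=> bx; split; [rewrite invr_gt0|move=> i j; rewrite ord1; exact: bx].
apply: fin_bigcap_measurable => // i _.
rewrite -[X in measurable X]setTI; apply: (mf i) => //.
by apply: open_measurable; apply: ball_open; rewrite invr_gt0.
Qed.

End BorelMeasurability.

Section LebesgueMeasureRV.
Context {R : realType}.

Definition cons_rV {n} (z : R * 'rV[R]_n) : 'rV[R]_n.+1 :=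
  row_mx (const_mx z.1 : 'rV_1) z.2.

Definition uncons_rV {n} (u : 'rV[R]_n.+1) : R * 'rV[R]_n :=
  (u 0 ord0, rsubmx (u : 'rV_(1 + n))).

Lemma cons_rVK n : cancel (@cons_rV n) uncons_rV.
Proof.
move=> [t u]; rewrite /uncons_rV /cons_rV row_mxKr; congr pair.
have -> : ord0 = lshift n ord0 :> 'I_(1 + n) by apply/val_inj.
by rewrite [LHS](@row_mxEl R 1 1 n) mxE.
Qed.

Lemma measurable_coord n (i : 'I_n) :
  measurable_fun setT ((fun u => u 0 i) : borel 'rV[R]_n -> R).
Proof.
apply: measurable_fun_continuous_real; first exact: openT.
by move=> u _; exact: coord_continuous.
Qed.

Lemma measurable_cons_rV n :
  measurable_fun setT (cons_rV : R * borel 'rV[R]_n -> borel 'rV[R]_n.+1).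
Proof.
apply: measurable_fun_rV => i.
case: (split_ordP (i : 'I_(1 + n))) => j ->.
  rewrite (_ : (fun x => _) = fst); first exact: measurable_fst.
  by apply/funext => z; rewrite /cons_rV (@row_mxEl R 1 1 n) mxE.
rewrite (_ : (fun x => _) = (fun u : borel 'rV[R]_n => u 0 j) \o snd).
  by apply: measurableT_comp; [exact: measurable_coord|exact: measurable_snd].
by apply/funext => z; rewrite /cons_rV (@row_mxEr R 1 1 n).
Qed.

Lemma measurable_uncons_rV n :
  measurable_fun setT (uncons_rV : borel 'rV[R]_n.+1 -> R * borel 'rV[R]_n).
Proof.
apply: measurable_fun_pair; first exact: measurable_coord.
apply: measurable_fun_rV => i.
rewrite (_ : (fun x => _) = (fun u : borel 'rV[R]_n.+1 => u 0 (rshift 1 i))).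
  exact: measurable_coord.
by apply/funext => u; rewrite mxE.
Qed.

Definition cons_measure n (m : set (borel 'rV[R]_n) -> \bar R) :=
  pushforward (@lebesgue_measure R \x m)%E
    (cons_rV : R * borel 'rV[R]_n -> borel 'rV[R]_n.+1).

Section cons_measure.
Context n (m : {sigma_finite_measure set (borel 'rV[R]_n) -> \bar R}).

HB.instance Definition _ := Measure.copy (cons_measure m)
  (@measure_function_pushforward__canonical__measure_function_Measure _ _ _ _ _
   (@lebesgue_measure R \x m)%E _ (@measurable_cons_rV n)).

Lemma sigma_finite_cons_measure : sigma_finite setT (cons_measure m).
Proof.
have /sigma_finiteP[F [TF ndF Foo]] := sigma_finiteT (@lebesgue_measure R).
have /sigma_finiteP[G [TG ndG Goo]] := sigma_finiteT m.
exists (fun k => uncons_rV @^-1` (F k `*` G k)).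
  apply/seteqP; split=> // u _.
  have [i _ Fi] : (\bigcup_i F i) (uncons_rV u).1 by rewrite -TF.
  have [j _ Gj] : (\bigcup_i G i) (uncons_rV u).2 by rewrite -TG.
  exists (maxn i j) => //; split => /=.
    by move: Fi; exact/subsetPset/ndF/leq_maxl.
  by move: Gj; exact/subsetPset/ndG/leq_maxr.
move=> k; have [mF Fk] := Foo k; have [mG Gk] := Goo k; split.
  rewrite -[X in measurable X]setTI; apply: measurable_uncons_rV => //.
  exact: measurableX.
rewrite /cons_measure /pushforward (_ : _ @^-1` _ = F k `*` G k); last first.
  by apply/seteqP; split=> z; rewrite /preimage /mkset cons_rVK.
by rewrite product_measure1E// lte_mul_pinfty// ge0_fin_numE.
Qed.

HB.instance Definition _ := Measure_isSigmaFinite.Build _ _ _ (cons_measure m)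
  sigma_finite_cons_measure.

End cons_measure.

Definition dirac_rV0 : set (borel 'rV[R]_0) -> \bar R := dirac (0 : borel 'rV[R]_0).

HB.instance Definition _ := Measure.on dirac_rV0.

Lemma sigma_finite_dirac_rV0 : sigma_finite setT dirac_rV0.
Proof.
exists (fun=> setT); first by rewrite bigcup_const//; exists 0%N.
by move=> _; split => //; rewrite /dirac_rV0 diracT ltry.
Qed.

HB.instance Definition _ := Measure_isSigmaFinite.Build _ _ _ dirac_rV0
  sigma_finite_dirac_rV0.

(** Follows the recursion of [integral_rV], so that Tonelli identifies the two in [integral_rVE].
    Sigma-finiteness is carried along because the next product measure requires it. *)
Fixpoint lebesgue_rV n : {sigma_finite_measure set (borel 'rV[R]_n) -> \bar R} :=
  match n with
  | 0 => dirac_rV0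
  | n'.+1 => cons_measure (lebesgue_rV n')
  end.

Local Open Scope ereal_scope.

Lemma integral_rVE n (f : borel 'rV[R]_n -> \bar R) :
  measurable_fun setT f -> (forall u, 0 <= f u) ->
  integral_rV f = \int[lebesgue_rV n]_u f u.
Proof.
elim: n f => [|n IH] f mf f0 /=.
  rewrite /dirac_rV0 integral_dirac//.
  by rewrite diracT mul1e.
rewrite /cons_measure ge0_integral_pushforward//; last exact: measurable_cons_rV.
have mfc : measurable_fun setT (f \o cons_rV : R * borel 'rV[R]_n -> \bar R).
  by apply: measurableT_comp => //; exact: measurable_cons_rV.
rewrite preimage_setT fubini_tonelli1//; last by move=> z; exact: f0.
apply: eq_integral => t _; rewrite IH//.
exact: (measurableT_comp mfc (pair1_measurable t)).
Qed.

Lemma eq_integral_rV n (f g : 'rV[R]_n -> \bar R) : f =1 g -> integral_rV f = integral_rV g.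
Proof. by move=> /funext ->. Qed.

End LebesgueMeasureRV.

Section CompactSupport.
Context {R : realType}.

Lemma compact_support_bounded (T : topologicalType) (K : set T) (f : T -> R) :
  compact K -> continuous f -> (forall x, ~ K x -> f x = 0) ->
  exists2 C, 0 <= C & forall x, `|f x| <= C.
Proof.
move=> cK cf f0; have [K0|/set0P/negP/negPn/eqP K0] := pselect (K !=set0); last first.
  exists 0 => // x; rewrite f0 ?normr0// => Kx.
  by have : set0 x by rewrite -K0.
have cn : {within K, continuous (fun x => `|f x|)}.
  apply: continuous_subspaceT => x; apply: continuous_comp; first exact: cf.
  exact: norm_continuous.
have [c Kc cM] := compact_EVT_max K0 cK cn.
exists `|f c| => // x; have [Kx|nKx] := pselect (K x); first by apply: cM; rewrite inE.
by rewrite f0// normr0.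
Qed.

Lemma compact_support_integrable (T : ptopologicalType) (mu : {measure set (borel T) -> \bar R})
    (K : set T) (f : T -> R) :
  hausdorff_space T -> compact K -> (mu K < +oo)%E ->
  continuous f -> (forall x, ~ K x -> f x = 0) -> mu.-integrable setT (EFin \o f).
Proof.
move=> hT cK muK cf f0.
have mK : measurable (K : set (borel T)).
  rewrite -[K]setCK; apply: measurableC; apply: measurable_open.
  by apply: closed_openC; exact: compact_closed.
have mf : measurable_fun setT (f : borel T -> R).
  by apply: measurable_fun_continuous_real; [exact: openT|move=> u _; exact: cf].
have [C C0 fC] := compact_support_bounded cK cf f0.
have : mu.-integrable K (EFin \o f).
  apply: measurable_bounded_integrable => //; first exact: measurable_funTS.
  by exists C; split; [exact: num_real|move=> M CM x _ /=; rewrite (le_trans (fC x))// ltW].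
rewrite integrable_mkcond//; congr (mu.-integrable _ _); apply/funext => x.
by rewrite patchE; case: ifPn => // /negP; rewrite inE => nKx; rewrite /= f0.
Qed.

Definition box {n} (L : R) : set 'rV[R]_n := [set u | forall i, `|u 0 i| <= L].

Lemma compact_box n L : compact (@box n L).
Proof.
have -> : @box n L = [set u | forall i, `[- L, L]%classic (u ord0 i)].
  apply/seteqP; split=> u /= h i; have := h i; rewrite in_itv /= ler_norml; exact.
by apply: (@rV_compact R n (fun=> `[- L, L]%classic)) => i; exact: segment_compact.
Qed.

Lemma hausdorff_rV n : hausdorff_space 'rV[R]_n.
Proof. exact: norm_hausdorff. Qed.

Lemma measurable_box n L : measurable (@box n L : set (borel 'rV[R]_n)).
Proof.
rewrite -[box L]setCK; apply: measurableC; apply: measurable_open.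
by apply: closed_openC; apply: compact_closed; [exact: hausdorff_rV|exact: compact_box].
Qed.

Lemma cons_rV_box n L (t : R) (u : 'rV[R]_n) :
  box L (cons_rV (t, u)) <-> `|t| <= L /\ box L u.
Proof.
rewrite /cons_rV /=; split=> [h|[ht hu] i].
  split=> [|j]; [have := h (@lshift 1 n ord0)|have := h (rshift 1 j)].
    by rewrite (@row_mxEl R 1 1 n) mxE.
  by rewrite (@row_mxEr R 1 1 n).
by case: (split_ordP (i : 'I_(1 + n))) => j ->;
  rewrite ?(@row_mxEl R 1 1 n) ?(@row_mxEr R 1 1 n) ?mxE.
Qed.

Lemma lebesgue_rV_box n L : (lebesgue_rV n (box L) < +oo)%E.
Proof.
elim: n => [|n IH] /=; first by rewrite /dirac_rV0 diracE ltry.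
rewrite /cons_measure /pushforward.
have -> : cons_rV @^-1` box L = `[- L, L]%classic `*` box L :> set (R * borel 'rV[R]_n).
  apply/seteqP; split=> -[t u]; rewrite /preimage /mkset cons_rV_box.
    by move=> [tL uL]; split => //=; rewrite in_itv /= -ler_norml.
  by move=> [/= + uL]; rewrite in_itv /= -ler_norml.
rewrite product_measure1E//; last exact: measurable_box.
have bd : (@lebesgue_measure R [set` `[(- L)%R, L%R]%R] < +oo)%E.
  by rewrite lebesgue_measure_itv /=; case: ifP; rewrite -?EFinD ltry.
by apply: lte_mul_pinfty => //; rewrite ge0_fin_numE.
Qed.

Lemma integrable_rV n (f : 'rV[R]_n -> R) L : continuous f ->
  (forall u, ~ box L u -> f u = 0) -> (lebesgue_rV n).-integrable setT (EFin \o f).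
Proof.
move=> cf f0; apply: (@compact_support_integrable _ _ (box L)) => //.
- exact: compact_box.
- exact: lebesgue_rV_box.
Qed.

Lemma integral_derive1_eq0 (g dg : R -> R) (L : R) :
  (forall t, is_derive t (1 : R) g (dg t)) -> continuous dg ->
  (forall t, L < `|t| -> g t = 0 /\ dg t = 0) ->
  (\int[lebesgue_measure]_t (dg t)%:E = 0)%E.
Proof.
move=> gP cdg g0; pose a := `|L| + 1.
have a0 : 0 < a by rewrite ltr_wpDl.
have La : L < a by rewrite (le_lt_trans (ler_norm L))// ltrDl.
have cg : continuous g.
  move=> t; apply: differentiable_continuous; apply/derivable1_diffP.
  by have [] := gP t.
have -> : (\int[lebesgue_measure]_t (dg t)%:E = \int[lebesgue_measure]_(t in [set` `[(- a)%R, a%R]%R]) (dg t)%:E)%E.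
  rewrite [RHS]integral_mkcond; apply: eq_integral => t _.
  rewrite patchE; case: ifPn => // /negP; rewrite inE /= in_itv /= -ler_norml.
  by move=> /negP; rewrite -ltNge => at_; rewrite (g0 _ (lt_trans La at_)).2.
rewrite (@continuous_FTC2 R dg g); first last.
- by move=> t _; rewrite derive1E; have [] := gP t.
- split; first by move=> t _; have [] := gP t.
    exact: cvg_at_right_filter (cg _).
  exact: cvg_at_left_filter (cg _).
- exact: continuous_subspaceT.
- exact: gtrN.
have [-> _] : g a = 0 /\ dg a = 0 by apply: g0; rewrite gtr0_norm.
have [-> _] : g (- a) = 0 /\ dg (- a) = 0 by apply: g0; rewrite normrN gtr0_norm.
by rewrite subee.
Qed.

Lemma cons_rV_linear n (h s t : R) (u v : 'rV[R]_n) :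
  h *: cons_rV (s, v) + cons_rV (t, u) = cons_rV (h * s + t, h *: v + u).
Proof.
apply/rowP => i; rewrite /cons_rV !mxE /=.
by case: (split_ordP (i : 'I_(1 + n))) => j _; rewrite !mxE.
Qed.

Lemma is_derive_cons_rV n (w : 'rV[R]_n.+1 -> R) (t : R) (u v : 'rV[R]_n) dw :
  is_derive (cons_rV (t, u)) (cons_rV (0, v)) w dw ->
  is_derive u v (fun y => w (cons_rV (t, y))) dw.
Proof.
have E : (fun h : R => h^-1 *: ((w \o shift (cons_rV (t, u))) (h *: cons_rV (0, v)) - w (cons_rV (t, u)))) =
  (fun h : R => h^-1 *: (((fun y => w (cons_rV (t, y))) \o shift u) (h *: v) - w (cons_rV (t, u)))).
  apply/funext => h /=; congr (_ *: (w _ - _)).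
  by rewrite cons_rV_linear mulr0 add0r.
move=> [fd <-]; apply: DeriveDef; first by rewrite /derivable -E.
by rewrite /derive -E.
Qed.

Lemma is_derive_cons_rV1 n (w : 'rV[R]_n.+1 -> R) (t : R) (u : 'rV[R]_n) dw :
  is_derive (cons_rV (t, u)) (cons_rV (1, 0)) w dw ->
  is_derive t (1 : R) (fun s => w (cons_rV (s, u))) dw.
Proof.
have E : (fun h : R => h^-1 *: ((w \o shift (cons_rV (t, u))) (h *: cons_rV (1, 0)) - w (cons_rV (t, u)))) =
  (fun h : R => h^-1 *: (((fun s => w (cons_rV (s, u))) \o shift t) (h *: (1 : R)) - w (cons_rV (t, u)))).
  apply/funext => h /=; congr (_ *: (w _ - _)).
  by rewrite cons_rV_linear scaler0 add0r.
move=> [fd <-]; apply: DeriveDef; first by rewrite /derivable -E.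
by rewrite /derive -E.
Qed.

Lemma continuous_rV (T : topologicalType) n (f : T -> 'rV[R]_n) (x : T) :
  (forall i, {for x, continuous (fun y => f y 0 i)}) -> {for x, continuous f}.
Proof.
move=> cf A [P fP PA]; rewrite nbhs_simpl /=.
have : \forall y \near x, forall i, P ord0 i (f y ord0 i).
  by apply: filter_forall => i; exact: (cf i _ (fP ord0 i)).
by apply: filterS => y yP; apply: PA => r i; rewrite (ord1 r).
Qed.

Lemma continuous_cons_rVr n (t : R) : continuous (fun u : 'rV[R]_n => cons_rV (t, u)).
Proof.
move=> u; apply: continuous_rV => i; rewrite /cons_rV /=.
case: (split_ordP (i : 'I_(1 + n))) => j ->.
  rewrite (_ : (fun y => _) = cst t); first exact: cst_continuous.
  by apply/funext => y; rewrite (@row_mxEl R 1 1 n) mxE.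
rewrite (_ : (fun y => _) = (fun y : 'rV[R]_n => y 0 j)); first exact: coord_continuous.
by apply/funext => y; rewrite (@row_mxEr R 1 1 n).
Qed.

Lemma continuous_cons_rVl n (u : 'rV[R]_n) : continuous (fun t : R => cons_rV (t, u)).
Proof.
move=> t; apply: continuous_rV => i; rewrite /cons_rV /=.
case: (split_ordP (i : 'I_(1 + n))) => j ->.
  rewrite (_ : (fun y => _) = id); first exact: cvg_id.
  by apply/funext => y; rewrite (@row_mxEl R 1 1 n) mxE.
rewrite (_ : (fun y => _) = cst (u 0 j)); first exact: cst_continuous.
by apply/funext => y; rewrite (@row_mxEr R 1 1 n).
Qed.

Lemma delta_mx_lshift n : delta_mx 0 (@lshift 1 n ord0) = cons_rV (1, 0) :> 'rV[R]_n.+1.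
Proof.
apply/rowP => i; rewrite /cons_rV; case: (split_ordP (i : 'I_(1 + n))) => j ->.
  by rewrite (@row_mxEl R 1 1 n) !mxE ord1 !eqxx.
by rewrite (@row_mxEr R 1 1 n) !mxE eq_rlshift andbF.
Qed.

Lemma delta_mx_rshift n j : delta_mx 0 (@rshift 1 n j) = cons_rV (0, delta_mx 0 j) :> 'rV[R]_n.+1.
Proof.
apply/rowP => i; rewrite /cons_rV; case: (split_ordP (i : 'I_(1 + n))) => k ->.
  by rewrite (@row_mxEl R 1 1 n) !mxE eq_lrshift andbF.
by rewrite (@row_mxEr R 1 1 n) !mxE eq_rshift.
Qed.

(** By Fubini, the inner integral can be taken along the first coordinate if [i] is the first one,
    where the fundamental theorem of calculus gives 0, and over the remaining coordinates otherwise,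
    where induction does. *)
Theorem integral_derive_eq0 n (i : 'I_n) (w dw : 'rV[R]_n -> R) (L : R) :
  (forall u, is_derive u (delta_mx 0 i) w (dw u)) -> continuous dw ->
  (forall u, ~ box L u -> w u = 0 /\ dw u = 0) ->
  (\int[lebesgue_rV n]_u (dw u)%:E = 0)%E.
Proof.
elim: n i w dw => [[]//|n IH] i w dw dwP cdw w0.
have idw : (lebesgue_rV n.+1).-integrable setT (EFin \o dw).
  by apply: (@integrable_rV _ _ L) => // u /w0[].
have mc := @measurable_cons_rV R n.
have idwc : (@lebesgue_measure R \x lebesgue_rV n)%E.-integrable setT ((EFin \o dw) \o cons_rV).
  have /integrableP[mdw doo] := idw.
  apply/integrableP; split; first exact: (measurableT_comp mdw mc).
  move: doo; rewrite /= /cons_measure ge0_integral_pushforward//.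
  apply/measurable_EFinP; apply: measurableT_comp => //; exact/measurable_EFinP.
rewrite [LHS](_ : _ = \int[(@lebesgue_measure R \x lebesgue_rV n)%E]_z (dw (cons_rV z))%:E)%E; last first.
  rewrite /= /cons_measure integral_pushforward//.
  exact: measurable_int idw.
case: (split_ordP (i : 'I_(1 + n))) => j iE.
  rewrite -(integral21_prod_meas1 idwc) /fubini_G.
  rewrite integral0_eq// => u _ /=.
  apply: (@integral_derive1_eq0 (fun t => w (cons_rV (t, u))) _ L).
  - move=> t; apply: is_derive_cons_rV1; rewrite -delta_mx_lshift.
    by have := dwP (cons_rV (t, u)); rewrite iE (ord1 j).
  - move=> t; apply: (@continuous_comp _ _ _ (fun t => cons_rV (t, u)) dw).
      exact: continuous_cons_rVl.
    exact: cdw.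
  - by move=> t Lt; apply: w0; rewrite cons_rV_box => -[]; rewrite leNgt Lt.
rewrite -(integral12_prod_meas1 idwc) /fubini_F.
rewrite integral0_eq// => t _ /=.
apply: (IH j (fun u => w (cons_rV (t, u)))).
- move=> u; apply: is_derive_cons_rV; rewrite -delta_mx_rshift.
  by have := dwP (cons_rV (t, u)); rewrite iE.
- move=> u; apply: (@continuous_comp _ _ _ (fun u => cons_rV (t, u)) dw).
    exact: continuous_cons_rVr.
  exact: cdw.
- by move=> u nb; apply: w0; rewrite cons_rV_box => -[].
Qed.

End CompactSupport.

(** * Change of variables for a measure given by a density on a chart *)

Section PushforwardDensity.
Context {R : realType} d1 d2 (T1 : measurableType d1) (T2 : measurableType d2).
Variables (lam : {measure set T1 -> \bar R}) (mu : {measure set T2 -> \bar R}).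
Variables (kap : T1 -> T2) (rho : T1 -> R) (D : set T2).
Hypotheses (mkap : measurable_fun setT kap) (mrho : measurable_fun setT rho).
Hypothesis rho0 : forall u, 0 <= rho u.
Hypothesis muE : forall B, measurable B -> B `<=` D ->
  mu B = (\int[lam]_u (\1_B (kap u) * rho u)%:E)%E.

Local Open Scope ereal_scope.
Import HBNNSimple.

Lemma pushforward_density_nnsfun (h : {nnsfun T2 >-> R}) :
  (forall p, ~ D p -> h p = 0%R) ->
  \int[mu]_p (h p)%:E = \int[lam]_u ((h (kap u))%:E * (rho u)%:E).
Proof.
move=> h0.
have mind y : measurable_fun setT (fun u => (y * \1_(h @^-1` [set y]) (kap u))%:E).
  apply/measurable_EFinP; apply: measurable_funM => //.
  exact: measurableT_comp.
transitivity (\int[mu]_p (\sum_(y \in range h) (y * \1_(h @^-1` [set y]) p)%:E)).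
  by apply: eq_integral => t tE; rewrite /= fimfunE -fsumEFin.
rewrite ge0_integral_fsum//; last 2 first.
- by move=> y; apply/measurable_EFinP; exact: measurable_funM.
- by move=> m y Ey; exact: nnfun_muleindic_ge0.
transitivity (\int[lam]_u (\sum_(y \in range h)
    (y * \1_(h @^-1` [set y]) (kap u))%:E * (rho u)%:E)); last first.
  apply: eq_integral => u _.
  rewrite -ge0_mule_fsuml => [|y]; last exact: nnfun_muleindic_ge0.
  by rewrite fsumEFin // -(fimfunE _ (kap u)).
rewrite ge0_integral_fsum//; last 2 first.
- by move=> y; apply: emeasurable_funM => //; exact/measurable_EFinP.
- by move=> m y Ey; rewrite mule_ge0 ?EFinM ?nnfun_muleindic_ge0// lee_fin.
apply: eq_fsbigr => y; rewrite inE => -[t _ <-{y}].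
(* The level set of the value 0 need not lie in [D], so [muE] cannot be applied to it; its
   contribution vanishes anyway. *)
have [->|hn0] := eqVneq (h t) 0%R.
  by rewrite !integral0_eq// => u _; rewrite ?mul0r ?mul0e.
rewrite integralZl_indic_nnsfun// integral_indic// setIT muE//; last first.
  by move=> p /= hp; apply: contrapT => nDp; move: hn0; rewrite -hp h0// eqxx.
rewrite -ge0_integralZl//; last 3 first.
- apply/measurable_EFinP; apply: measurable_funM => //.
  exact: measurableT_comp.
- by move=> u _; rewrite lee_fin mulr_ge0.
- by rewrite lee_fin.
by apply: eq_integral => u _; rewrite -!EFinM mulrA.
Qed.

(** Monotone convergence along simple functions below [F]. *)
Lemma pushforward_density (F : T2 -> \bar R) :
  measurable_fun setT F -> (forall p, 0 <= F p) -> (forall p, ~ D p -> F p = 0) ->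
  \int[mu]_p F p = \int[lam]_u (F (kap u) * (rho u)%:E).
Proof.
move=> mF F0 FD.
pose h := nnsfun_approx measurableT mF.
have Fh p : F p = lim ((EFin \o h n) p @[n --> \oo]).
  by apply/esym/cvg_lim => //; exact: cvg_nnsfun_approx.
transitivity (lim (\int[mu]_p ((h n p)%:E) @[n --> \oo])).
  rewrite -monotone_convergence//.
  - by apply: eq_integral => p _; exact: Fh.
  - by move=> n; exact/measurable_EFinP.
  - by move=> n p _; rewrite lee_fin.
  - by move=> p _ a b ab; rewrite lee_fin; exact/lefP/nd_nnsfun_approx.
(* The approximants are squeezed between 0 and [F], hence supported in [D] as well. *)
have hD n p : ~ D p -> h n p = 0%R.
  move=> nDp; apply/eqP; rewrite eq_le fun_ge0 andbT.
  have := le_approx n (fun x (_ : setT x) => F0 x) (I : setT p).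
  by rewrite FD// -nnsfun_approxE lee_fin.
transitivity (lim (\int[lam]_u ((h n (kap u))%:E * (rho u)%:E) @[n --> \oo])).
  by congr (lim (_ @ \oo)); apply/funext => n; apply: pushforward_density_nnsfun; exact: hD.
rewrite -monotone_convergence//; last 3 first.
- move=> n; apply: emeasurable_funM; last exact/measurable_EFinP.
  by apply/measurable_EFinP; apply: measurableT_comp.
- by move=> n u _; rewrite mule_ge0 ?lee_fin.
- move=> u _ a b ab; rewrite lee_wpmul2r ?lee_fin//; exact/lefP/nd_nnsfun_approx.
apply: eq_integral => u _; apply/cvg_lim => //.
by apply: cvgeZr => //; exact: cvg_nnsfun_approx.
Qed.

End PushforwardDensity.

(** * Charts, frames and the shape operator *)

Section Charts.
Context {R : realType} {n : nat} {M : topologicalType} (c : chart R n M).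

Lemma chart_inv_dom u : chart_codom c u -> chart_dom c (chart_inv c u).
Proof. by move=> [p cp <-]; rewrite chart_mapK. Qed.

Lemma chart_invK u : chart_codom c u -> chart_map c (chart_inv c u) = u.
Proof. by move=> [p cp <-]; rewrite chart_mapK. Qed.

Lemma chart_map_codom p : chart_dom c p -> chart_codom c (chart_map c p).
Proof. by exists p. Qed.

Lemma open_chart_codom : open (chart_codom c).
Proof. exact: chart_codom_open. Qed.

Lemma chart_inv_cont u : chart_codom c u -> {for u, continuous (chart_inv c)}.
Proof.
move=> cu; have := @chart_inv_continuous _ _ _ c.
rewrite (continuous_open_subspace _ open_chart_codom) => /(_ u); apply.
by rewrite inE.
Qed.

Lemma chart_map_cont p : chart_dom c p -> {for p, continuous (chart_map c)}.
Proof.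
move=> cp; have := @chart_map_continuous _ _ _ c.
rewrite (continuous_open_subspace _ (chart_dom_open c)) => /(_ p); apply.
by rewrite inE.
Qed.

Lemma near_chart_dom p : chart_dom c p -> \forall q \near p, chart_dom c q.
Proof. by move=> cp; apply: open_nbhs_nbhs; split => //; exact: chart_dom_open. Qed.

Lemma near_chart_codom u : chart_codom c u -> \forall v \near u, chart_codom c v.
Proof. by move=> cu; apply: open_nbhs_nbhs; split => //; exact: open_chart_codom. Qed.

Lemma near_chart_map (P : set 'rV[R]_n) p : chart_dom c p ->
  (\forall u \near chart_map c p, P u) -> \forall q \near p, P (chart_map c q).
Proof. by move=> cp; exact: (chart_map_cont cp). Qed.

Lemma near_chart_inv (P : set M) p : chart_dom c p ->
  (\forall q \near p, P q) -> \forall u \near chart_map c p, P (chart_inv c u).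
Proof.
move=> cp hP; apply: (chart_inv_cont (chart_map_codom cp)).
by rewrite chart_mapK.
Qed.

Lemma continuous_in_chart (T : topologicalType) (F : M -> T) p : chart_dom c p ->
  {for chart_map c p, continuous (F \o chart_inv c)} -> {for p, continuous F}.
Proof.
move=> cp cF A FA.
have {}FA : \forall q \near p, A (F (chart_inv c (chart_map c q))).
  apply: (near_chart_map (P := fun u => A (F (chart_inv c u))) cp).
  by apply: (cF A); rewrite /= chart_mapK.
rewrite nbhs_simpl /=; apply: filterS2 FA (near_chart_dom cp) => q + cq.
by rewrite chart_mapK.
Qed.

End Charts.

Definition chart_density {R : realType} {n m : nat} {M : topologicalType}
    (x : M -> 'rV[R]_m) (c : chart R n M) (u : 'rV[R]_n) : R :=
  Num.sqrt (\det (metric_mx x c (chart_inv c u))).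

Section ChartIntegral.
Context {R : realType} {n m : nat} {M : ptopologicalType}.
Variables (At : set (chart R n M)) (x : M -> 'rV[R]_m)
  (mu : {measure set (borel M) -> \bar R}).
Hypothesis vol : riemannian_volume At x mu.
Variable c : chart R n M.
Hypothesis Atc : At c.

Hypothesis cdens : forall u, chart_codom c u -> {for u, continuous (chart_density x c)}.

Let U := chart_codom c.
(** Off the codomain, [chart_inv c] and the density are arbitrary. Constant values there make [kap]
    and [rho] Borel on the whole space, and [rho = 0] discards the value [point]. *)
Let kap u := if `[< U u >] then chart_inv c u else point.
Let rho u := if `[< U u >] then (chart_density x c) u else 0.

Lemma measurable_codom : measurable (U : set (borel 'rV[R]_n)).
Proof. by apply: measurable_open; exact: open_chart_codom. Qed.

Lemma measurable_kap : measurable_fun setT (kap : borel 'rV[R]_n -> borel M).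
Proof.
have mU := measurable_codom.
rewrite -(setUv U); apply/measurable_funU => //; first exact: measurableC.
split.
  apply: (@eq_measurable_fun _ _ (borel 'rV[R]_n) (borel M) U (chart_inv c) kap).
    by move=> u; rewrite inE => Uu; rewrite /kap asboolT.
  apply: measurable_fun_continuous_on; first exact: open_chart_codom.
  exact: chart_inv_cont.
apply: (@eq_measurable_fun _ _ (borel 'rV[R]_n) (borel M) (~` U) (cst point) kap); last exact: measurable_cst.
by move=> u; rewrite inE => Uu; rewrite /kap asboolF.
Qed.

Lemma measurable_rho : measurable_fun setT (rho : borel 'rV[R]_n -> R).
Proof.
have mU := measurable_codom.
rewrite -(setUv U); apply/measurable_funU => //; first exact: measurableC.
split.
  apply: (@eq_measurable_fun _ _ (borel 'rV[R]_n) R U (chart_density x c) rho).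
    by move=> u; rewrite inE => Uu; rewrite /rho asboolT.
  apply: measurable_fun_continuous_real; first exact: open_chart_codom.
  exact: cdens.
apply: (@eq_measurable_fun _ _ (borel 'rV[R]_n) R (~` U) (cst 0) rho); last exact: measurable_cst.
by move=> u; rewrite inE => Uu; rewrite /rho asboolF.
Qed.

Lemma rho_ge0 u : 0 <= rho u.
Proof. by rewrite /rho; case: ifP => // _; exact: sqrtr_ge0. Qed.

Lemma chart_volume (B : set (borel M)) : measurable B -> B `<=` chart_dom c ->
  mu B = (\int[lebesgue_rV n]_u (\1_B (kap u) * rho u)%:E)%E.
Proof.
move=> mB Bc; rewrite (vol Atc mB Bc) -integral_rVE.
- apply: eq_integral_rV => u; congr EFin.
  rewrite /rho /kap; case: asboolP => Uu.
    rewrite /chart_density; congr (_ * _); rewrite !indicE; congr (nat_of_bool _)%:R.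
    apply/idP/idP; rewrite !inE.
      by move=> [p Bp <-]; rewrite chart_mapK//; exact: Bc.
    by move=> Bu; exists (chart_inv c u) => //; exact: chart_invK.
  rewrite mulr0 indicE memNset ?mul0r// => -[p Bp pu]; apply: Uu.
  by rewrite -pu; apply: chart_map_codom; exact: Bc.
- apply/measurable_EFinP; apply: measurable_funM; last exact: measurable_rho.
  have mi : measurable_fun setT (\1_B : borel M -> R) by exact: measurable_indic.
  exact: (measurableT_comp mi measurable_kap).
- by move=> u; rewrite lee_fin mulr_ge0// rho_ge0.
Qed.

Lemma chart_integral_ge0 (F : M -> \bar R) :
  measurable_fun setT (F : borel M -> \bar R) -> (forall p, 0 <= F p)%E ->
  (forall p, ~ chart_dom c p -> F p = 0%E) ->
  (\int[mu]_p F p = \int[lebesgue_rV n]_u (F (kap u) * (rho u)%:E))%E.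
Proof.
move=> mF F0 Fc.
exact: (@pushforward_density R _ _ (borel 'rV[R]_n) (borel M) (lebesgue_rV n) mu
  kap rho (chart_dom c) measurable_kap measurable_rho rho_ge0 chart_volume F mF F0 Fc).
Qed.

Lemma chart_integral (F : M -> R) : continuous F ->
  (forall p, ~ chart_dom c p -> F p = 0) ->
  (\int[mu]_p (F p)%:E = \int[lebesgue_rV n]_u
     (if `[< chart_codom c u >] then F (chart_inv c u) * (chart_density x c) u else 0)%:E)%E.
Proof.
move=> cF Fc.
have mF : measurable_fun setT (EFin \o F : borel M -> \bar R).
  apply/measurable_EFinP; apply: (@measurable_fun_continuous_real R M setT F openT) => u _.
  exact: cF.
transitivity (\int[lebesgue_rV n]_u ((F (kap u))%:E * (rho u)%:E))%E; last first.
  apply: eq_integral => u _; rewrite -EFinM /kap /rho /U; congr EFin.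
  by case: asboolP; rewrite ?mulr0.
have E (s : R) u : Num.max (s * F (kap u)) 0 * rho u = Num.max (s * (F (kap u) * rho u)) 0.
  by rewrite maxr_pMl ?rho_ge0// mul0r mulrA.
rewrite integralE [RHS]integralE; congr (_ - _)%E.
  rewrite chart_integral_ge0//.
  - apply: eq_integral => u _; have := E 1 u; rewrite !mul1r => Eu.
    by rewrite !funeposE -EFinM -!EFin_max -EFinM Eu.
  - exact: measurable_funepos.
  - by move=> p cp; rewrite funeposE Fc// maxxx.
rewrite chart_integral_ge0//.
- apply: eq_integral => u _; have := E (- 1) u; rewrite !mulN1r => Eu.
  by rewrite !funenegE -EFinM -!EFinN -!EFin_max -EFinM Eu.
- exact: measurable_funeneg.
- by move=> p cp; rewrite funenegE Fc// oppe0 maxxx.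
Qed.

End ChartIntegral.

Section Frame.
Context {R : realType} {n : nat} (X : 'M[R]_(n, n.+1)) (nu : 'rV[R]_n.+1).
Hypotheses (fX : row_free X) (nu1 : dot nu nu = 1)
  (Xnu : forall v : 'rV_n, dot (v *m X) nu = 0).

Lemma frame_unit : \det (col_mx nu X : 'M[R]_(1 + n)) != 0.
Proof.
apply/negP => /det0P[v v0].
rewrite -[v]hsubmxK mul_row_col => vE.
have l0 : lsubmx v = 0.
  apply/rowP => j; rewrite (ord1 j) !mxE -/(lsubmx v 0 0).
  have := congr1 (dot ^~ nu) vE; rewrite dotDl Xnu addr0.
  rewrite [lsubmx v]mx11_scalar mul_scalar_mx dotZl nu1 mulr1 => h.
  have {}h : lsubmx v 0 0 = 0 by rewrite h -(scale0r nu) dotZl mul0r.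
  by move: h; rewrite mxE.
have r0 : rsubmx v = 0.
  by apply: (row_free_inj fX); rewrite mul0mx -vE l0 mul0mx add0r.
by move/eqP: v0; apply; rewrite -[v]hsubmxK l0 r0 row_mx0.
Qed.

Lemma frame_decomposition (y : 'rV[R]_n.+1) :
  exists a : 'rV_n, y = a *m X + dot y nu *: nu.
Proof.
pose B := (col_mx nu X : 'M[R]_(1 + n)).
have uB : B \in unitmx by rewrite unitmxE unitfE frame_unit.
pose v : 'rV[R]_(1 + n) := (y : 'rV[R]_(1 + n)) *m invmx B.
have yE : y = lsubmx v 0 0 *: nu + rsubmx v *m X.
  by rewrite -mul_scalar_mx -mx11_scalar -mul_row_col hsubmxK mulmxKV.
exists (rsubmx v); rewrite {1}yE addrC; congr (_ + _ *: _).
by rewrite yE dotDl Xnu addr0 dotZl nu1 mulr1.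
Qed.

(** As $\nu$ is a unit vector orthogonal to the rows of $X$, the Gram matrix of the full frame is
    block triangular with diagonal blocks 1 and $XX^T$. This identifies the density with
    $|\det(\nu,X)|$. *)
Lemma frame_gram : \det (X *m X^T) = \det (col_mx nu X : 'M[R]_(1 + n)) ^+ 2.
Proof.
pose B := (col_mx nu X : 'M[R]_(1 + n)).
have -> : \det (col_mx nu X : 'M[R]_(1 + n)) ^+ 2 = \det (B *m B^T).
  by rewrite (@det_mulmx _ (1 + n)) det_tr expr2.
rewrite /B tr_col_mx mul_col_row.
have -> : nu *m X^T = 0.
  apply/rowP => j; rewrite [RHS]mxE -(Xnu (delta_mx 0 j)) -rowE dotC.
  by rewrite mxE; apply: eq_bigr => i _; rewrite !mxE.
have -> : nu *m nu^T = 1%:M by rewrite [LHS]mx11_scalar dotE nu1.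
by rewrite det_lblock det1 mul1r.
Qed.

Lemma tangent_rows m (N : 'M[R]_(m, n.+1)) :
  (forall i, dot (row i N) nu = 0) -> N = N *m pinvmx X *m X.
Proof.
move=> Nnu; rewrite mulmxKpV//; apply/row_subP => i.
have [a ->] := frame_decomposition (row i N).
by rewrite Nnu scale0r addr0 submxMl.
Qed.

End Frame.

Section ChartChange.
Context {R : realType} {n m : nat}.

Lemma change_of_frame (J S T : 'M[R]_n) (X Y : 'M[R]_(n, m)) :
  row_free X -> row_free Y -> X = J *m Y -> S *m X = J *m (T *m Y) ->
  J \in unitmx /\ S *m J = J *m T.
Proof.
move=> fX fY XE SX; split.
  rewrite -row_free_unit /row_free eqn_leq rank_leq_row /=.
  by rewrite -[X in (X <= _)%N](eqP fX) XE mxrankM_maxl.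
by apply: (row_free_inj fY); rewrite -!mulmxA -XE SX.
Qed.

Lemma char_poly_conj (J S T : 'M[R]_n) :
  J \in unitmx -> S *m J = J *m T -> char_poly S = char_poly T.
Proof.
move=> uJ SJ; rewrite /char_poly.
have dJ : \det (map_mx polyC J) != 0.
  by rewrite det_map_mx polyC_eq0 -unitfE -unitmxE.
apply: (mulIf dJ); rewrite -det_mulmx mulrC -det_mulmx; congr (\det _).
rewrite /char_poly_mx mulmxBl mulmxBr -!map_mxM SJ; congr (_ - _).
by rewrite mul_scalar_mx mul_mx_scalar.
Qed.

Lemma newton_mx_conj (s : nat -> R) (J S T : 'M[R]_n) j :
  S *m J = J *m T -> newton_mx s S j *m J = J *m newton_mx s T j.
Proof.
move=> SJ; elim: j => [|j IH] /=; first by rewrite mul1mx mulmx1.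
by rewrite mulmxBl mulmxBr mul_scalar_mx mul_mx_scalar -mulmxA SJ !mulmxA IH.
Qed.

End ChartChange.

Lemma mul_tr_dot {R : realType} {n m p} (A : 'M[R]_(n, p)) (B : 'M[R]_(m, p)) i j :
  (A *m B^T) i j = dot (row i A) (row j B).
Proof. by rewrite mxE; apply: eq_bigr => k _; rewrite !mxE. Qed.

Lemma self_adjoint_of_symmetric {R : realType} {n m} (X N : 'M[R]_(n, m)) (S : 'M[R]_n) :
  N = S *m X -> (N *m X^T)^T = N *m X^T ->
  forall v w, dot (v *m S *m X) (w *m X) = dot (v *m X) (w *m S *m X).
Proof.
move=> NS NX v w; rewrite -2!(mulmxA _ S X) -NS -!dotE !trmx_mul !mulmxA.
by rewrite -(mulmxA v N) -NX trmx_mul trmxK mulmxA.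
Qed.

Section HypersurfaceChart.
Context {R : realType} {n : nat} {M : topologicalType}
  (At : set (chart R n M)) (x nu : M -> 'rV[R]_n.+1).
Hypothesis H : immersed_hypersurface At x nu.
Variable c : chart R n M.
Hypothesis Atc : At c.

Let U := chart_codom c.
Let xi := x \o chart_inv c.
Let ni := nu \o chart_inv c.
Let X u := 'J xi u.
Let N u := 'J ni u.

Lemma smooth_xi : smooth_on U xi. Proof. exact: hyp_position_smooth H c Atc. Qed.
Lemma smooth_ni : smooth_on U ni. Proof. exact: hyp_normal_smooth H c Atc. Qed.

Lemma jac_row_free u : U u -> row_free (X u).
Proof.
move=> Uu; have := hyp_immersion H Atc (chart_inv_dom Uu).
by rewrite /coord_diff chart_invK.
Qed.

Lemma normal_dot p : dot (nu p) (nu p) = 1.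
Proof.
have := hyp_normal_unit H p; rewrite /enorm => h.
by rewrite -(sqr_sqrtr (dot_ge0 (nu p))) h expr1n.
Qed.

Lemma jac_normal u v : U u -> dot (v *m X u) (ni u) = 0.
Proof.
move=> Uu; have := hyp_normal_orth H Atc (chart_inv_dom Uu) v.
by rewrite /coord_diff chart_invK.
Qed.

Lemma is_derive_dot (f g : 'rV[R]_n -> 'rV[R]_n.+1) u v (df dg : 'rV[R]_n.+1) :
  (forall a, is_derive u v (fun p => f p 0 a) (df 0 a)) ->
  (forall a, is_derive u v (fun p => g p 0 a) (dg 0 a)) ->
  is_derive u v (fun p => dot (f p) (g p)) (dot (f u) dg + dot df (g u)).
Proof.
move=> fP gP; rewrite /dot -big_split /=; apply: is_derive_bigsum => a _.
have := is_deriveM (fP a) (gP a) => /is_derive_eq; apply.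
by congr (_ + _); rewrite [LHS]mulrC.
Qed.

Lemma is_derive_cst_on (f : 'rV[R]_n -> R) (k : R) u v df : U u ->
  (forall p, U p -> f p = k) -> is_derive u v f df -> df = 0.
Proof.
move=> Uu fk [_ <-]; rewrite (@near_eq_derive _ _ _ _ (cst k)) ?derive_cst//.
by apply: filterS (near_chart_codom Uu) => p; exact: fk.
Qed.

Lemma normal_rows u i : U u -> dot (row i (N u)) (ni u) = 0.
Proof.
move=> Uu; have dn a : is_derive u (delta_mx 0 i) (fun p => ni p 0 a) (row i (N u) 0 a).
  by rewrite mxE (jacobianE smooth_ni)//; exact: (is_derive_coord smooth_ni).
have := is_derive_cst_on Uu _ (is_derive_dot dn dn) => /(_ 1).
rewrite [dot (ni u) _]dotC => h; have {}h := h (fun p _ => normal_dot _).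
by lra.
Qed.

Let S u := N u *m pinvmx (X u).

Lemma shape_mul u : U u -> N u = S u *m X u.
Proof.
move=> Uu; apply: (@tangent_rows _ _ (X u) (ni u)).
- exact: jac_row_free.
- exact: normal_dot.
- by move=> v; exact: jac_normal.
- by move=> i; exact: normal_rows.
Qed.

(** Differentiating $\langle\nu,\partial_jx\rangle=0$ along $\partial_i$ gives
    $\langle\partial_i\nu,\partial_jx\rangle=-\langle\nu,\partial_i\partial_jx\rangle$, which is
    symmetric in $i$ and $j$. *)
Lemma shape_symmetric u v w : U u ->
  dot (v *m S u *m X u) (w *m X u) = dot (v *m X u) (w *m S u *m X u).
Proof.
move=> Uu; apply: self_adjoint_of_symmetric (shape_mul Uu) _ v w.
have [h [NX hs]] : exists h : 'I_n -> 'I_n -> 'rV[R]_n.+1,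
    (forall i j, (N u *m (X u)^T) i j = - dot (ni u) (h i j)) /\
    (forall i j, h i j = h j i).
  exists (fun i j => \row_a 'D_(delta_mx 0 i) ('D_(delta_mx 0 j) xi) u 0 a).
  split=> i j; last first.
    apply/rowP => a; rewrite [LHS]mxE [RHS]mxE.
    exact: (smooth_on_symmetric (@open_chart_codom _ _ _ c) smooth_xi _ _ _ Uu).
  have dn a : is_derive u (delta_mx 0 i) (fun p => ni p 0 a) (row i (N u) 0 a).
    by rewrite mxE (jacobianE smooth_ni)//; exact: (is_derive_coord smooth_ni).
  have dX a : is_derive u (delta_mx 0 i) (fun p => row j (X p) 0 a)
      ((\row_a 'D_(delta_mx 0 i) ('D_(delta_mx 0 j) xi) u 0 a) 0 a).
    rewrite mxE (_ : (fun p => _) = (fun p => X p j a)); last by apply/funext => p; rewrite mxE.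
    exact: (is_derive_jacobian (@open_chart_codom _ _ _ c) smooth_xi _ _ _ Uu).
  have h := is_derive_cst_on Uu _ (is_derive_dot dn dX).
  have {h} := h 0 => /(_ _) h.
  apply/eqP; rewrite -addr_eq0 addrC; apply/eqP.
  rewrite -[RHS]h => [|p Up]; last by rewrite dotC rowE jac_normal.
  by rewrite mul_tr_dot.
by apply/matrixP => i j; rewrite mxE !NX hs.
Qed.

End HypersurfaceChart.

Section Conjugation.
Context {R : realType} {n m : nat}.

Lemma eigenvalues_conj (J S T : 'M[R]_n) :
  J \in unitmx -> S *m J = J *m T -> eigenvalues S = eigenvalues T.
Proof. by move=> uJ SJ; rewrite /eigenvalues (char_poly_conj uJ SJ). Qed.

Lemma tangent_coord_change (J : 'M[R]_n) (X Y : 'M[R]_(n, m)) (a b : 'rV[R]_n) (y z : 'rV[R]_m) :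
  row_free Y -> X = J *m Y -> y = a *m X + z -> y = b *m Y + z -> b = a *m J.
Proof.
move=> fY XE ya yb; apply: (row_free_inj fY); apply: (@addIr _ z).
by rewrite -yb ya XE mulmxA.
Qed.

Lemma newton_mx_conj_eq k (J S T : 'M[R]_n) (l l' : 'rV[R]_n) :
  S *m J = J *m T -> l = l' ->
  newton_mx (elem_sym ^~ l) S k *m J = J *m newton_mx (elem_sym ^~ l') T k.
Proof. by move=> SJ ->; exact: newton_mx_conj. Qed.

End Conjugation.

Section ChainRule.
Context {R : realType} {n : nat} {M : topologicalType} {W : normedModType R}.

Lemma derive_chart_change (c d : chart R n M) (G : M -> W) p v :
  compatible c d -> chart_dom c p -> chart_dom d p ->
  differentiable (G \o chart_inv d) (chart_map d p) ->
  'D_v (G \o chart_inv c) (chart_map c p) =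
  'D_(v *m 'J (transition c d) (chart_map c p)) (G \o chart_inv d) (chart_map d p).
Proof.
move=> [smt _] cp dp dG; set u := chart_map c p; set tau := transition c d.
have tu : tau u = chart_map d p by rewrite /tau /transition /= chart_mapK.
have dtau : differentiable tau u by apply: (smt 1%N).1; exists p.
have E : \forall y \near u, (G \o chart_inv c) y = ((G \o chart_inv d) \o tau) y.
  have := near_chart_inv cp (near_chart_dom dp); apply: filterS => y dy.
  by rewrite /= chart_mapK.
rewrite (near_eq_derive _ E) -tu.
have dG' : differentiable (G \o chart_inv d) (tau u) by rewrite tu.
rewrite deriveE; last exact: differentiable_comp.
by rewrite diff_comp// [in RHS]deriveE// -deriveEjacobian// deriveE.
Qed.

End ChainRule.

Section DirectionalExpansion.
Context {R : realType} {n : nat}.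

Lemma derive_coord_sum (f : 'rV[R]_n -> R) u v : differentiable f u ->
  'D_v f u = \sum_i v 0 i * 'D_(delta_mx 0 i) f u.
Proof.
move=> df; rewrite deriveE// {1}[v]row_sum_delta linear_sum.
by apply: eq_bigr => i _; rewrite linearZ /= deriveE.
Qed.

End DirectionalExpansion.

Section Curvature.
Context {R : realType} {n : nat} {M : topologicalType}
  (At : set (chart R n M)) (x nu : M -> 'rV[R]_n.+1).
Hypothesis H : immersed_hypersurface At x nu.

(** The coordinates of $x^T$ in the chart. On an immersed hypersurface the bracket lies in the row
    space of the differential, where the pseudoinverse inverts exactly ([tangentialE]). *)
Definition tangential (c : chart R n M) p : 'rV[R]_n :=
  (x p - dot (x p) (nu p) *: nu p) *m pinvmx (coord_diff c x p).

Definition newton_field k (c : chart R n M) p : 'rV[R]_n :=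
  tangential c p *m newton x nu k c p.

Lemma newton_newton_mx j (c : chart R n M) p :
  newton x nu j c p =
  newton_mx (elem_sym ^~ (eigenvalues (shape_operator x nu c p))) (shape_operator x nu c p) j.
Proof. by elim: j => //= j ->. Qed.

Section AtPoint.
Variables (c : chart R n M) (p : M).
Hypotheses (Atc : At c) (cp : chart_dom c p).

Let cu := chart_map_codom cp.

Lemma coord_jac_free : row_free (coord_diff c x p).
Proof. exact: hyp_immersion H _ _ Atc cp. Qed.

Lemma coord_normal v : dot (v *m coord_diff c x p) (nu p) = 0.
Proof. exact: hyp_normal_orth H _ _ Atc cp v. Qed.

Lemma coord_shape : coord_diff c nu p = shape_operator x nu c p *m coord_diff c x p.
Proof. exact: (shape_mul H Atc cu). Qed.

Lemma coord_shape_adjoint v w :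
  dot (v *m shape_operator x nu c p *m coord_diff c x p) (w *m coord_diff c x p) =
  dot (v *m coord_diff c x p) (w *m shape_operator x nu c p *m coord_diff c x p).
Proof. exact: (shape_symmetric H Atc v w cu). Qed.

(** Self-adjointness excludes the default value 0 of [eigenvalues]. *)
Lemma shape_split : char_poly (shape_operator x nu c p) =
  \prod_(i < n) ('X - (eigenvalues (shape_operator x nu c p) 0 i)%:P).
Proof.
have [l lE _] := self_adjoint_spectrum coord_jac_free coord_shape_adjoint.
by rewrite /eigenvalues; apply: (@xgetPex _ 0 [set l : 'rV[R]_n |
  char_poly (shape_operator x nu c p) = \prod_(i < n) ('X - (l 0 i)%:P)]); exists l.
Qed.

Lemma tangentialE :
  x p = tangential c p *m coord_diff c x p + dot (x p) (nu p) *: nu p.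
Proof.
rewrite /tangential mulmxKpV ?subrK//.
have [a xE] := frame_decomposition coord_jac_free (normal_dot H p) coord_normal (x p).
by rewrite {1}xE addrK submxMl.
Qed.

End AtPoint.

Section Change.
Variables (c d : chart R n M) (p : M).
Hypotheses (Atc : At c) (Atd : At d) (cp : chart_dom c p) (dp : chart_dom d p).

Let J := 'J (transition c d) (chart_map c p).

Lemma charts_compatible : compatible c d.
Proof. by have [_ _ [_ +]] := hyp_manifold H; exact. Qed.

Lemma coord_diff_change m (F : M -> 'rV[R]_m) : smooth_map At F ->
  coord_diff c F p = J *m coord_diff d F p.
Proof.
move=> sF; apply/row_matrixP => i; rewrite !rowE mulmxA.
have dF e : At e -> chart_dom e p -> differentiable (F \o chart_inv e) (chart_map e p).
  by move=> Ate ep; apply: (smooth_on_differentiable (sF e Ate)); exact: chart_map_codom.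
rewrite /coord_diff -[LHS]deriveEjacobian; last exact: dF.
by rewrite (derive_chart_change _ charts_compatible)// ?deriveEjacobian//; exact: dF.
Qed.

Lemma shape_change : J \in unitmx /\
  shape_operator x nu c p *m J = J *m shape_operator x nu d p.
Proof.
have XE := coord_diff_change (hyp_position_smooth H).
have NE := coord_diff_change (hyp_normal_smooth H).
have SX : shape_operator x nu c p *m coord_diff c x p =
    J *m (shape_operator x nu d p *m coord_diff d x p).
  exact: etrans (esym (coord_shape Atc cp)) (etrans NE (congr1 (mulmx J) (coord_shape Atd dp))).
exact: (change_of_frame (coord_jac_free Atc cp) (coord_jac_free Atd dp) XE SX).
Qed.

Lemma eigenvalues_change :
  eigenvalues (shape_operator x nu c p) = eigenvalues (shape_operator x nu d p).
Proof.
by have [uJ SJ] := shape_change; exact: eigenvalues_conj SJ.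
Qed.

Lemma sigma_change j : sigma x nu j c p = sigma x nu j d p.
Proof. exact (congr1 (@elem_sym R n j) eigenvalues_change). Qed.

(** The coordinates of $x^T$ transform by $J$, and the matrices of $P_k$ are conjugate under $J$
    because the shape operators are and their eigenvalues agree. *)
Lemma newton_field_change k : newton_field k d p = newton_field k c p *m J.
Proof.
have [uJ SJ] := shape_change.
have aJ : tangential d p = tangential c p *m J.
  exact: (tangent_coord_change (coord_jac_free Atd dp)
    (coord_diff_change (hyp_position_smooth H)) (tangentialE Atc cp) (tangentialE Atd dp)).
have nJ : newton x nu k c p *m J = J *m newton x nu k d p.
  exact: etrans (congr1 (mulmx^~ J) (newton_newton_mx k c p))
    (etrans (newton_mx_conj_eq k SJ eigenvalues_change)
      (congr1 (mulmx J) (esym (newton_newton_mx k d p)))).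
exact: etrans (congr1 (mulmx^~ (newton x nu k d p)) aJ) (etrans (esym (mulmxA _ _ _))
  (etrans (congr1 (mulmx (tangential c p)) (esym nJ)) (mulmxA _ _ _))).
Qed.

End Change.

End Curvature.

Section LocalField.
Context {R : realType} {n k : nat} {M : topologicalType}
  (At : set (chart R n M)) (x nu : M -> 'rV[R]_n.+1).
Hypothesis H : immersed_hypersurface At x nu.
Hypothesis kn : (k < n)%N.
Variable c : chart R n M.
Hypothesis Atc : At c.
Variable w : 'I_n -> R.
Hypothesis wP : forall j : 'I_n, \sum_i w i * i%:R ^+ j = (j == Ordinal kn)%:R.

Let U := chart_codom c.
Let xi := x \o chart_inv c.
Let ni := nu \o chart_inv c.

(** The signed volume density: its absolute value is [chart_density], and as a determinant of $\nu$
    and the $\partial_jx$ it is $C^1$ without any square root. *)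
Definition frame_det (u : 'rV[R]_n) : R :=
  \det (col_mx (nu (chart_inv c u)) ('J (x \o chart_inv c) u) : 'M[R]_(1 + n)).

Definition newton_flux i (u : 'rV[R]_n) : R :=
  \sum_j w j * flux (x \o chart_inv c) (nu \o chart_inv c) j%:R i u.

Lemma shape_at u : U u ->
  shape_operator x nu c (chart_inv c u) = 'J ni u *m pinvmx ('J xi u).
Proof. by move=> Uu; rewrite /shape_operator /coord_diff chart_invK. Qed.

Lemma coord_diff_at u : U u -> coord_diff c x (chart_inv c u) = 'J xi u.
Proof. by move=> Uu; rewrite /coord_diff chart_invK. Qed.

Lemma jac_shape u : U u ->
  'J ni u = shape_operator x nu c (chart_inv c u) *m 'J xi u.
Proof.
move=> Uu; exact (etrans (shape_mul H Atc Uu) (congr1 (mulmx^~ ('J xi u)) (esym (shape_at Uu)))).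
Qed.

Lemma position_frame u : U u -> xi u =
  tangential x nu c (chart_inv c u) *m 'J xi u + dot (xi u) (ni u) *: ni u.
Proof.
move=> Uu; have := tangentialE H Atc (chart_inv_dom Uu).
by rewrite (coord_diff_at Uu).
Qed.

Lemma flux_frame t i u : U u -> flux xi ni t i u = frame_det u *
  (tangential x nu c (chart_inv c u) *m
     \adj (1%:M + t *: shape_operator x nu c (chart_inv c u))) 0 i.
Proof.
move=> Uu; rewrite /flux /frame_det -(det_frame _ _ _ _ _ (dot (xi u) (ni u))).
rewrite -position_frame//; congr (\det (col_mx _ (rowset _ _ _))).
by rewrite (jac_shape Uu) mulmxDl mul1mx scalemxAl.
Qed.

Lemma newton_interpolation p : chart_dom c p ->
  newton x nu k c p = \sum_j w j *: \adj (1%:M + j%:R *: shape_operator x nu c p).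
Proof.
move=> cp; rewrite newton_newton_mx.
exact: (newton_mx_interpolation (shape_split H Atc cp) wP).
Qed.

Lemma newton_fluxE i u : U u ->
  newton_flux i u = frame_det u * newton_field x nu k c (chart_inv c u) 0 i.
Proof.
move=> Uu; rewrite /newton_field (newton_interpolation (chart_inv_dom Uu)).
rewrite mulmx_sumr summxE mulr_sumr; apply: eq_bigr => j _.
rewrite flux_frame// mulrCA -scalemxAr; congr (_ * _).
by rewrite [RHS]mxE.
Qed.

Lemma C1_at_newton_flux i u : U u -> C1_at u (newton_flux i).
Proof.
move=> Uu; apply: C1_at_sum => j _; apply: C1_atM; first exact: C1_at_cst.
exact: (C1_at_flux (@open_chart_codom _ _ _ c) (smooth_xi H Atc) (smooth_ni H Atc) _ _ Uu).
Qed.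

(** Summing [divergence_flux] against the weights [w] turns the traces of adjugates into
    $\mathrm{tr}\,P_k$ and $\mathrm{tr}(SP_k)$. *)
Lemma divergence_newton_flux u : U u ->
  \sum_i 'D_(delta_mx 0 i) (newton_flux i) u = frame_det u *
   ((n - k)%:R * sigma x nu k c (chart_inv c u)
    - dot (xi u) (ni u) * (k.+1%:R * sigma x nu k.+1 c (chart_inv c u))).
Proof.
move=> Uu; set S := shape_operator x nu c (chart_inv c u).
have sS : char_poly S = \prod_(i < n) ('X - (eigenvalues S 0 i)%:P).
  exact: (shape_split H Atc (chart_inv_dom Uu)).
have dW i : 'D_(delta_mx 0 i) (newton_flux i) u =
    \sum_j w j * 'D_(delta_mx 0 i) (flux xi ni j%:R i) u.
  have df j : is_derive u (delta_mx 0 i) (fun p => w j * flux xi ni j%:R i p)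
      (w j * 'D_(delta_mx 0 i) (flux xi ni j%:R i) u).
    apply: is_deriveZ; apply: C1_at_is_derive.
    exact: (C1_at_flux (@open_chart_codom _ _ _ c) (smooth_xi H Atc) (smooth_ni H Atc) _ _ Uu).
  by have [_ ->] := is_derive_bigsum (index_enum 'I_n) (fun j (_ : true) => df j).
under eq_bigr do rewrite dW.
rewrite exchange_big /=.
have dF j : \sum_i w j * 'D_(delta_mx 0 i) (flux xi ni j%:R i) u =
    frame_det u * (w j * \tr (\adj (1%:M + j%:R *: S)) -
     dot (xi u) (ni u) * (w j * \tr (S *m \adj (1%:M + j%:R *: S)))).
  rewrite -mulr_sumr (divergence_flux (@open_chart_codom _ _ _ c) (smooth_xi H Atc)
    (smooth_ni H Atc) _ Uu (jac_shape Uu) (position_frame Uu)).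
  by rewrite /frame_det; ring.
under eq_bigr do rewrite dF.
rewrite -mulr_sumr sumrB -mulr_sumr; congr (_ * (_ - _ * _)).
  rewrite -(trace_newton_mx sS kn).
  rewrite [newton_mx _ _ _](newton_mx_interpolation sS wP) raddf_sum.
  by apply: eq_bigr => j _; rewrite /= mxtraceZ.
rewrite -(trace_mul_newton_mx sS kn).
rewrite [newton_mx _ _ _](newton_mx_interpolation sS wP) mulmx_sumr raddf_sum.
by apply: eq_bigr => j _; rewrite /= -scalemxAr mxtraceZ.
Qed.

Lemma frame_det_neq0 u : U u -> frame_det u != 0.
Proof.
move=> Uu; apply: frame_unit; first exact: (jac_row_free H Atc Uu).
  exact: (normal_dot H).
by move=> v; exact: (jac_normal H Atc).
Qed.

Lemma C1_at_frame_det u : U u -> C1_at u frame_det.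
Proof.
move=> Uu; apply: (@C1_at_det R n u (1 + n)) => r j.
case: (split_ordP r) => r' ->.
  rewrite (_ : (fun p => _) = (fun p => ni p 0 j)); last first.
    by apply/funext => p; rewrite col_mxEu (ord1 r').
  exact: (smooth_on_C1_at (@open_chart_codom _ _ _ c) (smooth_ni H Atc) _ Uu).
rewrite (_ : (fun p => _) = (fun p => 'J xi p r' j)); last first.
  by apply/funext => p; rewrite col_mxEd.
exact: (C1_at_jacobian (@open_chart_codom _ _ _ c) (smooth_xi H Atc) _ _ Uu).
Qed.

Lemma chart_densityE u : U u -> chart_density x c u = `|frame_det u|.
Proof.
move=> Uu; rewrite /chart_density -sqrtr_sqr; congr Num.sqrt.
rewrite /frame_det -(@frame_gram _ _ ('J xi u) (ni u)); last 2 first.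
- exact: (normal_dot H).
- by move=> v; exact: (jac_normal H Atc).
congr (\det _); apply/matrixP => i j; rewrite mul_tr_dot mxE /metric coord_diff_at//.
by rewrite !rowE.
Qed.

Lemma chart_density_cont u : U u -> {for u, continuous (chart_density x c)}.
Proof.
move=> Uu; have cf := C1_at_continuous (C1_at_frame_det Uu).
have cn : {for u, continuous (fun v => `|frame_det v|)}.
  exact: (continuous_comp cf (@norm_continuous _ _ _)).
have E : \forall v \near u, `|frame_det v| = chart_density x c v.
  by apply: filterS (near_chart_codom Uu) => v Uv; rewrite chart_densityE.
rewrite /prop_for /continuous_at -(nbhs_singleton E).
exact: cvg_trans (near_eq_cvg E) cn.
Qed.

End LocalField.

(** If [P K] failed, the sets [A] with [P (K \ A)] would form a proper filter containing [K]. It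
    would cluster at some point of [K], against the neighbourhood of that point on which [P]
    holds. *)
Lemma compact_induction {T : topologicalType} (P : set T -> Prop) (K : set T) :
  compact K -> P set0 -> (forall A B, P A -> P B -> P (A `|` B)) ->
  (forall A B, A `<=` B -> P B -> P A) ->
  (forall p, K p -> exists2 B, nbhs p B & P B) -> P K.
Proof.
move=> cK P0 PU PS Ploc; apply: contrapT => nPK.
pose F : set_system T := [set A | P (K `\` A)].
have FP : ProperFilter F.
  split; first by rewrite /F /= setD0.
  split.
  - by rewrite /F /= setDT.
  - move=> A B FA FB; rewrite /F /=; apply: PS (PU _ _ FA FB).
    by rewrite -setDIr.
  - by move=> A B AB; apply: PS => t [Kt nB]; split => // /AB.
have [p [Kp clp]] := cK F FP (eq_ind_r P P0 (setDv K)).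
have [B Bp PB] := Ploc p Kp.
have FB : F (~` B) by apply: (PS _ B) => // t [_ /contrapT].
by have [t []] := clp _ _ FB Bp.
Qed.

Lemma coord_le_norm {R : realType} {n} (v : 'rV[R]_n) i : `|v 0 i| <= `|v|.
Proof. by rewrite [`|v|]mx_normrE; exact: (le_bigmax _ _ (0, i)). Qed.

Lemma near_continuous_lt {R : realType} {T : topologicalType} (f : T -> R) p b :
  {for p, continuous f} -> f p < b -> \forall q \near p, f q < b.
Proof.
move=> cf fp; have h : nbhs (f p) [set t : R | t < b].
  by apply: open_nbhs_nbhs; split; [exact: open_lt|].
exact: (cf _ h).
Qed.

Lemma box_near {R : realType} {n} (u : 'rV[R]_n) :
  exists L, \forall v \near u, box L v.
Proof.
exists (`|u| + 1); have : \forall v \near u, `|v| < `|u| + 1.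
  by apply: near_continuous_lt; [exact: (@norm_continuous R 'rV[R]_n u)|rewrite ltrDl].
by apply: filterS => v vL i; apply: (le_trans (coord_le_norm v i)); exact: ltW.
Qed.

(** * Divergence theorem for compact supports *)

Section LocallyFinite.
Context {R : realType} {n m : nat} {M : ptopologicalType}.
Variables (At : set (chart R n M)) (x : M -> 'rV[R]_m)
  (mu : {measure set (borel M) -> \bar R}).
Hypothesis vol : riemannian_volume At x mu.
Hypothesis cover : forall p, exists2 c, At c & chart_dom c p.
Hypothesis cdens : forall c, At c -> forall u, chart_codom c u ->
  {for u, continuous (chart_density x c)}.

(** Near [p] the chart takes values in a box, of finite Lebesgue measure, and by continuity the
    density stays below its value at [p] plus 1. *)
Lemma volume_locally_finite p : exists O : set M, [/\ open O, O p & (mu O < +oo)%E].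
Proof.
have [c Atc cp] := cover p; have Uu := chart_map_codom cp.
set u := chart_map c p in Uu.
have [L hL] := box_near u.
have hD : \forall v \near u, chart_density x c v < chart_density x c u + 1.
  by apply: near_continuous_lt; [exact: cdens|rewrite ltrDl].
set D := chart_density x c u + 1 in hD.
have hp : \forall q \near p, [/\ chart_dom c q, box L (chart_map c q)
    & chart_density x c (chart_map c q) < D].
  have hLp := near_chart_map cp hL; have hDp := near_chart_map cp hD.
  by near=> q; split; near: q => //; exact: near_chart_dom.
exists (interior [set q | [/\ chart_dom c q, box L (chart_map c q)
    & chart_density x c (chart_map c q) < D]]); split.
- exact: open_interior.
- exact: hp.
set O := interior _.
have OE q : O q -> [/\ chart_dom c q, box L (chart_map c q)
    & chart_density x c (chart_map c q) < D] by exact: interior_subset.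
have mO : measurable (O : set (borel M)) by apply: measurable_open; exact: open_interior.
rewrite (chart_volume vol Atc (cdens Atc) mO) => [|q /OE[]//].
have D0 : 0 <= D by rewrite addr_ge0// sqrtr_ge0.
apply: (@le_lt_trans _ _ (\int[lebesgue_rV n]_v (D * \1_(box L) v)%:E)%E).
  apply: ge0_le_integral => //.
  - by move=> v _; rewrite lee_fin mulr_ge0// rho_ge0.
  - apply/measurable_EFinP; apply: measurable_funM; last exact: (measurable_rho (cdens Atc)).
    have mi : measurable_fun setT (\1_O : borel M -> R) by exact: measurable_indic.
    exact: (measurableT_comp mi (measurable_kap c)).
  - apply/measurable_EFinP; apply: measurable_funM; first exact: measurable_cst.
    by apply: measurable_indic; exact: measurable_box.
  - move=> v _; rewrite lee_fin; case: asboolP => Uv; last by rewrite mulr0 mulr_ge0.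
    rewrite !indicE; case: (boolP (chart_inv c v \in (O : set M))) => [|_]; last by rewrite mul0r mulr_ge0.
    rewrite inE => /OE[_]; rewrite chart_invK// => Lv Dv.
    by rewrite mem_set// mul1r mulr1 ltW.
under eq_integral do rewrite EFinM.
rewrite ge0_integralZl//; last first.
  by apply/measurable_EFinP; apply: measurable_indic; exact: measurable_box.
rewrite integral_indic//; last exact: measurable_box.
by rewrite setIT lte_mul_pinfty// ?lebesgue_rV_box.
Unshelve. all: by end_near. Qed.

Lemma volume_compact (K : set M) : hausdorff_space M -> compact K -> (mu K < +oo)%E.
Proof.
move=> hM cK; pose P (A : set M) := exists B : set M, [/\ open B, A `<=` B & (mu B < +oo)%E].
have mo (O : set M) : open O -> measurable (O : set (borel M)) by exact: measurable_open.
have [C [oC KC muC]] : P K.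
  apply: (compact_induction cK).
  - by exists set0; split=> //; [exact: open0|rewrite measure0].
  - move=> A B [C [oC AC mC]] [D [oD BD mD]]; exists (C `|` D); split.
    + exact: openU.
    + exact: setUSS.
    + have h := @measureU2 _ (borel M) _ mu C D (mo _ oC) (mo _ oD).
      exact: (le_lt_trans h (lte_add_pinfty mC mD)).
  - by move=> A B AB [C [oC BC mC]]; exists C; split => //; exact: subset_trans BC.
  - move=> p _; have [C [oC Cp mC]] := volume_locally_finite p.
    by exists C; [exact: (open_nbhs_nbhs (conj oC Cp))|exists C; split].
have mK : measurable (K : set (borel M)).
  rewrite -(setCK K); apply: measurableC; apply: mo; apply: closed_openC.
  exact: compact_closed.
by apply: le_lt_trans muC; apply: le_measure; rewrite ?inE//; exact: mo.
Qed.

End LocallyFinite.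

Section NearContinuity.
Context {R : realType}.

Lemma near_eq_continuous {T S : topologicalType} (f g : T -> S) u :
  (\forall v \near u, f v = g v) -> {for u, continuous f} -> {for u, continuous g}.
Proof.
move=> fg cf; rewrite /prop_for /continuous_at -(nbhs_singleton fg).
exact: cvg_trans (near_eq_cvg fg) cf.
Qed.

Lemma continuous_sum {T : topologicalType} (I : Type) (r : seq I) (f : I -> T -> R) u :
  (forall i, {for u, continuous (f i)}) ->
  {for u, continuous (fun v => \sum_(i <- r) f i v)}.
Proof.
move=> cf; elim: r => [|i r IH]; rewrite /prop_for /continuous_at.
  by under eq_fun do rewrite big_nil; rewrite big_nil; exact: cvg_cst.
by under eq_fun do rewrite big_cons; rewrite big_cons; exact: (cvgD (cf i) IH).
Qed.

Lemma near_sgr {T : topologicalType} (f : T -> R) u : f u != 0 ->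
  {for u, continuous f} -> \forall v \near u, Num.sg (f v) = Num.sg (f u).
Proof.
move=> fu cf; case: (ltrgt0P (f u)) fu => // fu _.
  have : nbhs (f u) [set t : R | 0 < t].
    by apply: open_nbhs_nbhs; split; [exact: open_gt|].
  by move=> /cf; rewrite nbhs_simpl /=; apply: filterS => v fv; rewrite !gtr0_sg.
have := near_continuous_lt cf fu.
by apply: filterS => v fv; rewrite !ltr0_sg.
Qed.

End NearContinuity.

Section Divergence.
Context {R : realType} {n : nat} (k : nat) {M : ptopologicalType}
  (At : set (chart R n M)) (x nu : M -> 'rV[R]_n.+1).
Hypothesis H : immersed_hypersurface At x nu.
Hypothesis kn : (k < n)%N.
Variable w : 'I_n -> R.
Hypothesis wP : forall j : 'I_n, \sum_i w i * i%:R ^+ j = (j == Ordinal kn)%:R.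
Variable cc : M -> chart R n M.
Hypotheses (ccA : forall p, At (cc p)) (ccd : forall p, chart_dom (cc p) p).

Definition C1_fun (psi : M -> R) := forall c p, At c -> chart_dom c p ->
  C1_at (chart_map c p) (psi \o chart_inv c).

(* The divergence of psi * P_k(x^T). *)
Definition newton_div (psi : M -> R) (p : M) : R :=
  psi p * ((n - k)%:R * sigma x nu k (cc p) p
    - dot (x p) (nu p) * (k.+1%:R * sigma x nu k.+1 (cc p) p)) +
  'D_(newton_field x nu k (cc p) p) (psi \o chart_inv (cc p)) (chart_map (cc p) p).

(** The chart [cc p], which varies with [p] in no regular way, may be replaced by a fixed one: the
    $\sigma_j$ are invariant and the chain rule compensates the change of the field. *)
Lemma newton_divE psi c p : C1_fun psi -> At c -> chart_dom c p ->
  newton_div psi p =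
  psi p * ((n - k)%:R * sigma x nu k c p
    - dot (x p) (nu p) * (k.+1%:R * sigma x nu k.+1 c p)) +
  'D_(newton_field x nu k c p) (psi \o chart_inv c) (chart_map c p).
Proof.
move=> Cpsi Atc cp; rewrite /newton_div.
have sE j := sigma_change H Atc (ccA p) cp (ccd p) j.
have nE := newton_field_change H Atc (ccA p) cp (ccd p) k.
have dpsi := C1_at_differentiable (Cpsi _ _ (ccA p) (ccd p)).
have dE := derive_chart_change (newton_field x nu k c p)
  (charts_compatible H Atc (ccA p)) cp (ccd p) dpsi.
rewrite -!sE; congr (_ + _); rewrite dE; exact (congr1 (fun v => 'D_v _ _) nE).
Qed.

(** The coordinate formula $\rho\,\mathrm{div}\,V=\sum_i\partial_i(\rho V^i)$, with the signed
    density for $\rho$. *)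
Lemma newton_div_local psi c u : C1_fun psi -> At c -> chart_codom c u ->
  frame_det x nu c u * newton_div psi (chart_inv c u) =
  \sum_i 'D_(delta_mx 0 i) ((psi \o chart_inv c) * newton_flux x nu c w i) u.
Proof.
move=> Cpsi Atc Uu; have cp := chart_inv_dom Uu.
rewrite (newton_divE Cpsi Atc cp).
have Cu : C1_at u (psi \o chart_inv c) by have := Cpsi _ _ Atc cp; rewrite chart_invK.
have dM i : 'D_(delta_mx 0 i) ((psi \o chart_inv c) * newton_flux x nu c w i) u =
    psi (chart_inv c u) * 'D_(delta_mx 0 i) (newton_flux x nu c w i) u +
    newton_flux x nu c w i u * 'D_(delta_mx 0 i) (psi \o chart_inv c) u.
  have d1 := C1_at_is_derive (delta_mx 0 i) Cu.
  have d2 := C1_at_is_derive (delta_mx 0 i) (C1_at_newton_flux H Atc w i Uu).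
  exact: (deriveM (@ex_derive _ _ _ _ _ _ _ d1) (@ex_derive _ _ _ _ _ _ _ d2)).
under eq_bigr do rewrite dM.
rewrite big_split /= -mulr_sumr (divergence_newton_flux H Atc wP Uu).
rewrite (chart_invK Uu) (derive_coord_sum _ (C1_at_differentiable Cu)) mulrDr; congr (_ + _).
  by rewrite mulrCA.
rewrite mulr_sumr; apply: eq_bigr => i _.
by rewrite (newton_fluxE H Atc wP i Uu) mulrA.
Qed.

(** The definition goes through chosen eigenvalues and chosen charts, so continuity is read off the
    local formula divided by the nonvanishing [frame_det]. *)
Lemma continuous_newton_div psi : C1_fun psi -> continuous (newton_div psi).
Proof.
move=> Cpsi p; have cp := ccd p; apply: (continuous_in_chart cp).
have Up := chart_map_codom cp; have Atc := ccA p.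
set c := cc p in cp Up Atc *; set u := chart_map c p in Up *.
pose G (v : 'rV[R]_n) : R := (\sum_i 'D_(delta_mx 0 i) ((psi \o chart_inv c) * newton_flux x nu c w i) v)
  / frame_det x nu c v.
apply: (@near_eq_continuous _ _ G).
  apply: filterS (near_chart_codom Up) => v Uv.
  rewrite /G -(newton_div_local Cpsi Atc Uv) mulrAC mulfV ?mul1r//.
  exact: (frame_det_neq0 H Atc Uv).
have cf : {for u, continuous (frame_det x nu c)}.
  exact: (C1_at_continuous (C1_at_frame_det H Atc Up)).
have cV : {for u, continuous (fun v => (frame_det x nu c v)^-1)}.
  exact: (cvgV (frame_det_neq0 H Atc Up) cf).
apply: cvgM cV; apply: continuous_sum => i.
exact: (C1_atM (Cpsi _ _ Atc cp) (C1_at_newton_flux H Atc w i Up)).2.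
Qed.

Lemma newton_div_eq0 psi K p : closed K -> (forall q, ~ K q -> psi q = 0) ->
  ~ K p -> newton_div psi p = 0.
Proof.
move=> cK psi0 Kp; rewrite /newton_div psi0// mul0r add0r.
have hK : \forall q \near p, ~ K q.
  by apply: open_nbhs_nbhs; split => //; exact: closed_openC.
have E : \forall u \near chart_map (cc p) p, (psi \o chart_inv (cc p)) u = cst 0 u.
  by apply: filterS (near_chart_inv (ccd p) hK) => u /psi0.
by rewrite (near_eq_derive _ E) derive_cst.
Qed.

End Divergence.

Section SignedDivergence.
Context {R : realType} {n : nat}.

Lemma C1_at_support (f : 'rV[R]_n -> R) (K : set 'rV[R]_n) :
  compact K -> (forall u, K u -> C1_at u f) -> (forall u, ~ K u -> f u = 0) ->
  [/\ forall u, C1_at u f, exists L, K `<=` box L & forall u i, ~ K u -> 'D_(delta_mx 0 i) f u = 0].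
Proof.
move=> cK Cf f0.
have nK u : ~ K u -> \forall v \near u, f v = cst 0 v.
  move=> Ku; have : \forall v \near u, ~ K v.
    apply: open_nbhs_nbhs; split => //; apply: closed_openC.
    exact: compact_closed (@hausdorff_rV R n) cK.
  by apply: filterS => v /f0.
split.
- move=> u; have [/Cf//|/nK E] := pselect (K u).
  apply: (@C1_at_near _ _ (cst 0)); last exact: C1_at_cst.
  by apply: filterS E => v ->.
- have [N [_ hN]] := compact_bounded cK.
  exists (N + 1) => u Ku i; apply: le_trans (coord_le_norm u i) _.
  by apply: (hN (N + 1)) => //; rewrite ltrDl.
- by move=> u i /nK E; rewrite (near_eq_derive _ E) derive_cst.
Qed.

Let guard (U : set 'rV[R]_n) (g h : 'rV[R]_n -> R) u : R :=
  if `[< U u >] then Num.sg (g u) * h u else 0.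

(** A continuous nonvanishing [g] has locally constant sign, so [Num.sg (g u)] commutes with
    derivatives; since each [h i] vanishes off the compact [K], extension by zero keeps it $C^1$,
    and every summand integrates to 0. *)
Lemma integral_signed_divergence (U K : set 'rV[R]_n) (g : 'rV[R]_n -> R)
    (h : 'I_n -> 'rV[R]_n -> R) :
  open U -> compact K -> K `<=` U ->
  (forall u, U u -> {for u, continuous g}) -> (forall u, U u -> g u != 0) ->
  (forall i u, U u -> C1_at u (h i)) -> (forall i u, U u -> ~ K u -> h i u = 0) ->
  (\int[lebesgue_rV n]_u (if `[< U u >] then
     Num.sg (g u) * \sum_i 'D_(delta_mx 0 i) (h i) u else 0)%:E = 0)%E.
Proof.
move=> oU cK KU cg g0 Ch h0; pose f i := guard U g (h i).
have floc i u : U u -> \forall v \near u, Num.sg (g u) * h i v = f i v.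
  move=> Uu; have nU : \forall v \near u, U v by exact: open_nbhs_nbhs.
  apply: filterS2 nU (near_sgr (g0 u Uu) (cg u Uu)) => v Uv sv.
  by rewrite /f /guard asboolT// sv.
have f0 i u : ~ K u -> f i u = 0.
  by move=> Ku; rewrite /f /guard; case: asboolP => // Uu; rewrite h0// mulr0.
have Cf i u : K u -> C1_at u (f i).
  move=> /KU Uu; apply: (C1_at_near (floc i u Uu)).
  exact: (C1_atM (C1_at_cst _ _) (Ch i u Uu)).
have df i u : U u -> 'D_(delta_mx 0 i) (f i) u = Num.sg (g u) * 'D_(delta_mx 0 i) (h i) u.
  move=> Uu; rewrite -(near_eq_derive _ (floc i u Uu)).
  have dh := C1_at_is_derive (delta_mx 0 i) (Ch i u Uu).
  exact: (deriveZ _ (@ex_derive _ _ _ _ _ _ _ dh)).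
transitivity (\int[lebesgue_rV n]_u (\sum_i ('D_(delta_mx 0 i) (f i) u)%:E))%E.
  apply: eq_integral => u _; rewrite sumEFin; congr EFin.
  case: asboolP => Uu; first by under [RHS]eq_bigr do rewrite df//; rewrite mulr_sumr.
  rewrite big1// => i _; have [_ _ ->//] := C1_at_support cK (Cf i) (f0 i).
  by move=> /KU.
rewrite integral_sum//; last first.
  move=> i; have [Cfi [L KL] dfi] := C1_at_support cK (Cf i) (f0 i).
  apply: (@integrable_rV _ _ _ L) => [u|u uL]; first exact: (Cfi u).2.
  by apply: dfi => /KL.
apply: big1 => i _; have [Cfi [L KL] dfi] := C1_at_support cK (Cf i) (f0 i).
apply: (@integral_derive_eq0 _ n i (f i) _ L).
- by move=> u; apply: C1_at_is_derive.
- by move=> u; exact: (Cfi u).2.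
- by move=> u uL; split; [apply: f0 => /KL|apply: dfi => /KL].
Qed.

End SignedDivergence.

Section ChartSupport.
Context {R : realType} {n k : nat} {M : ptopologicalType}
  (At : set (chart R n M)) (x nu : M -> 'rV[R]_n.+1)
  (mu : {measure set (borel M) -> \bar R}).
Hypothesis H : immersed_hypersurface At x nu.
Hypothesis kn : (k < n)%N.
Variable w : 'I_n -> R.
Hypothesis wP : forall j : 'I_n, \sum_i w i * i%:R ^+ j = (j == Ordinal kn)%:R.
Variable cc : M -> chart R n M.
Hypotheses (ccA : forall p, At (cc p)) (ccd : forall p, chart_dom (cc p) p).
Hypothesis vol : riemannian_volume At x mu.

Lemma integral_newton_div_chart psi c K : C1_fun At psi -> At c ->
  compact K -> K `<=` chart_dom c -> (forall p, ~ K p -> psi p = 0) ->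
  (\int[mu]_p (newton_div k x nu cc psi p)%:E = 0)%E.
Proof.
move=> Cpsi Atc cK Kc psi0.
have [hM _ _] := hyp_manifold H.
have clK : closed K by exact: compact_closed.
have F0 p : ~ K p -> newton_div k x nu cc psi p = 0 by exact: newton_div_eq0.
have Fc p : ~ chart_dom c p -> newton_div k x nu cc psi p = 0 by move=> cp; apply: F0 => /Kc.
have cF := continuous_newton_div H wP ccA ccd Cpsi.
refine (etrans (chart_integral vol Atc (chart_density_cont H Atc) cF Fc) _).
have KU : chart_map c @` K `<=` chart_codom c.
  by move=> _ [p Kp <-]; apply: chart_map_codom; exact: Kc.
have cKU : compact (chart_map c @` K).
  exact: (continuous_compact (continuous_subspaceW Kc (@chart_map_continuous _ _ _ c)) cK).
have Ch i u : chart_codom c u -> C1_at u ((psi \o chart_inv c) * newton_flux x nu c w i).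
  move=> Uu; apply: C1_atM (C1_at_newton_flux H Atc w i Uu).
  by have := Cpsi _ _ Atc (chart_inv_dom Uu); rewrite chart_invK.
have h0 i u : chart_codom c u -> ~ (chart_map c @` K) u ->
    ((psi \o chart_inv c) * newton_flux x nu c w i) u = 0.
  move=> Uu Ku; have Ku' : ~ K (chart_inv c u).
    by move=> Ku'; apply: Ku; exists (chart_inv c u) => //; exact: chart_invK.
  exact: etrans (congr1 (fun t => t * newton_flux x nu c w i u) (psi0 _ Ku')) (mul0r _).
have cg u : chart_codom c u -> {for u, continuous (frame_det x nu c)}.
  by move=> Uu; exact: (C1_at_continuous (C1_at_frame_det H Atc Uu)).
have I0 := integral_signed_divergence (@open_chart_codom _ _ _ c) cKU KU cg
  (fun u => @frame_det_neq0 _ _ _ _ _ _ H _ Atc u) Ch h0.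
refine (etrans _ I0); apply: eq_integral => u _; congr EFin.
case: asboolP => // Uu.
rewrite -(newton_div_local H wP ccA ccd Cpsi Atc Uu) (chart_densityE H Atc Uu).
by rewrite mulrA -normrEsg mulrC.
Qed.

End ChartSupport.

(** * Cutoff functions and passage from charts to compact supports *)

Section PositivePowers.
Context {R : realType}.

Lemma near_eq_is_derive {V W : normedModType R} (f g : V -> W) (u v : V) df :
  (\forall p \near u, f p = g p) -> is_derive u v f df -> is_derive u v g df.
Proof.
move=> fg [df1 <-]; apply: DeriveDef; first exact: near_eq_derivable fg df1.
exact: esym (near_eq_derive _ fg).
Qed.

Lemma continuous_pospow p : continuous (fun t : R => Num.max 0 t ^+ p).
Proof.
move=> t; have cm : {for t, continuous (fun s : R => Num.max 0 s)}.
  by apply: continuous_max; [exact: cvg_cst|exact: cvg_id].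
exact: (continuous_comp cm (@exprn_continuous R p _)).
Qed.

(** Treats the kink of a power of the positive part: near 0 it has the form [s * g s] with [g]
    continuous. *)
Lemma is_derive_mul_id (g : R -> R) : {for 0, continuous g} ->
  is_derive (0 : R) (1 : R) (fun s => s * g s) (g 0).
Proof.
move=> cg.
have h : (fun h => h^-1 *: (((fun s => s * g s) \o shift 0) (h *: (1 : R)) - 0 * g 0))
    @ (0 : R)^' --> g 0.
  have c0 : g s @[s --> (0 : R)^'] --> g 0.
    by apply: cvg_trans cg; apply: cvg_app; exact: cvg_within.
  apply: cvg_trans c0.
  apply: near_eq_cvg; near=> s => /=.
  rewrite [_%:A]mulr1 addr0 mul0r subr0 [_ *: _]mulrA mulVf ?mul1r//.
  near: s; exact: nbhs_dnbhs_neq.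
apply: DeriveDef; first exact: (cvgP _ h).
exact: cvg_lim h.
Unshelve. all: by end_near. Qed.

(** The exponent [p.+2] is at least 2, so the derivative is again a positive power of the positive
    part and hence continuous. *)
Lemma is_derive_pospow p (t : R) : is_derive t (1 : R)
  (fun s => Num.max 0 s ^+ p.+2) (p.+2%:R * Num.max 0 t ^+ p.+1).
Proof.
case: (ltrgt0P t) => [t0|t0|->].
- apply: (near_eq_is_derive (f := fun s : R => s ^+ p.+2)).
    have : \forall s \near t, 0 < s by apply: open_nbhs_nbhs; split; [exact: open_gt|].
    by apply: filterS => s s0; rewrite max_r// ltW.
  have := is_deriveX p.+2 (is_derive_id t (1 : R)).
  by rewrite [_ *: _]mulr1 exprfctE.
- apply: (near_eq_is_derive (f := (cst 0 : R -> R))).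
    have : \forall s \near t, s < 0 by apply: open_nbhs_nbhs; split; [exact: open_lt|].
    by apply: filterS => s s0; rewrite max_l ?expr0n// ltW.
  by rewrite expr0n mulr0; exact: is_derive_cst.
- rewrite expr0n mulr0.
  rewrite (_ : (fun s => _) = (fun s => s * Num.max 0 s ^+ p.+1)); last first.
    by apply/funext => s; rewrite exprS; case: (leP s 0) => // s0; rewrite expr0n !mulr0.
  have := is_derive_mul_id (@continuous_pospow p.+1 0).
  by rewrite maxxx expr0n.
Qed.

End PositivePowers.

Section Bumps.
Context {R : realType} {n : nat}.

Lemma C1_at_pospow p u (f : 'rV[R]_n -> R) : C1_at u f ->
  C1_at u (fun v => Num.max 0 (f v) ^+ p.+2).
Proof.
apply: (@C1_at_comp _ _ u f (fun s => Num.max 0 s ^+ p.+2) _ (is_derive_pospow p)).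
by move=> t; apply: cvgM; [exact: cvg_cst|exact: continuous_pospow].
Qed.

Lemma C1_atB1 u (f : 'rV[R]_n -> R) : C1_at u f -> C1_at u (fun v => 1 - f v).
Proof.
move=> Cf; have := C1_atD (C1_at_cst u 1) (C1_atM (C1_at_cst u (- 1)) Cf).
by apply: C1_at_near; near=> v => /=; rewrite /cst /= mulN1r.
Unshelve. all: by end_near. Qed.

(* C^1 cutoffs suffice, so squares of positive parts can replace the usual smooth bumps. *)
Definition plateau (t : R) : R := 1 - Num.max 0 (1 - Num.max 0 t ^+ 2) ^+ 2.

Lemma C1_at_plateau u (f : 'rV[R]_n -> R) : C1_at u f -> C1_at u (plateau \o f).
Proof. by move=> Cf; do 2 apply/C1_atB1/C1_at_pospow. Qed.

Lemma plateau_le0 t : t <= 0 -> plateau t = 0.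
Proof. by move=> t0; rewrite /plateau (max_l t0) expr0n subr0 (max_r ler01) expr1n subrr. Qed.

Lemma plateau_ge1 t : 1 <= t -> plateau t = 1.
Proof.
move=> t1; rewrite /plateau (max_r (le_trans ler01 t1)).
by rewrite max_l ?subr_le0 ?exprn_ege1// expr0n subr0.
Qed.

(* Its superlevel sets are Euclidean balls: the sup norm of ['rV[R]_n] is not C^1. *)
Definition well (u0 : 'rV[R]_n) (a : R) (u : 'rV[R]_n) : R :=
  2 - a * \sum_i (u 0 i - u0 0 i) ^+ 2.

Lemma C1_at_well u0 a v (tau : 'rV[R]_n -> 'rV[R]_n) :
  (forall i, C1_at v (fun u => tau u 0 i)) -> C1_at v (well u0 a \o tau).
Proof.
move=> Ctau.
have Ci i : C1_at v (fun u => (tau u 0 i - u0 0 i) ^+ 2).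
  have := C1_atD (Ctau i) (C1_at_cst v (- u0 0 i)).
  by move=> C1; have := C1_atM C1 C1; apply: C1_at_near; near=> u; rewrite expr2.
have := C1_atD (C1_at_cst v 2) (C1_atM (C1_at_cst v (- a))
  (@C1_at_sum _ _ v _ (index_enum 'I_n) predT _ (fun i _ => Ci i))).
by apply: C1_at_near; near=> u; rewrite /well /= /cst mulNr.
Unshelve. all: by end_near. Qed.

Lemma continuous_well u0 a : continuous (well u0 a).
Proof.
move=> u; have cs : {for u, continuous (fun v : 'rV[R]_n => \sum_i (v 0 i - u0 0 i) ^+ 2)}.
  apply: continuous_sum => i.
  have ci : {for u, continuous (fun v : 'rV[R]_n => v 0 i - u0 0 i)}.
    have c0 : {for u, continuous (fun _ : 'rV[R]_n => u0 0 i)} by exact: cst_continuous.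
    exact: (cvgB (@coord_continuous R 1 n 0 i u) c0).
  exact: (continuous_comp ci (@exprn_continuous R 2 _)).
have c2 : {for u, continuous (fun _ : 'rV[R]_n => 2 : R)} by exact: cst_continuous.
have ca : {for u, continuous (fun _ : 'rV[R]_n => a : R)} by exact: cst_continuous.
exact: (cvgB c2 (cvgM ca cs)).
Qed.

Lemma well_support (u0 : 'rV[R]_n) (V : set 'rV[R]_n) : nbhs u0 V ->
  exists a, [/\ well u0 a u0 = 2, compact [set u | 0 <= well u0 a u]
    & [set u | 0 <= well u0 a u] `<=` V].
Proof.
(* With this [a], [0 <= well u0 a u] says that the squared Euclidean distance to [u0] is at most
   $e^2/2$, so every coordinate differs by less than [e]. *)
move=> /nbhs_ballP[e /= e0 eV]; exists (4 / e ^+ 2).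
have well_lt u : 0 <= well u0 (4 / e ^+ 2) u -> forall i, `|u 0 i - u0 0 i| < e.
  rewrite /well subr_ge0 => h i.
  have hi : (u 0 i - u0 0 i) ^+ 2 <= \sum_i (u 0 i - u0 0 i) ^+ 2.
    by rewrite (bigD1 i)//= lerDl sumr_ge0// => j _; exact: sqr_ge0.
  rewrite -(@ltr_pXn2r _ 2) ?nnegrE// ?ltW// real_normK ?num_real//.
  apply: le_lt_trans hi _; move: h; rewrite mulrAC ler_pdivrMr ?exprn_gt0//.
  have e2 : 0 < e ^+ 2 by rewrite exprn_gt0.
  by move: e2; set s := \sum__ _; set t := e ^+ 2; lra.
split.
- by rewrite /well big1 ?mulr0 ?subr0// => i _; rewrite subrr expr0n.
- apply: (@subclosed_compact _ _ (box (`|u0| + e))); last 2 first.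
  + exact: compact_box.
  + move=> u /well_lt h i; have := h i; have := coord_le_norm u0 i.
    rewrite !ler_norml ltr_norml; lra.
  exact: (closed_comp (fun u _ => @continuous_well u0 _ u) (@closed_ge R 0)).
- move=> u /well_lt h; apply: eV; split => // i j.
  by rewrite (ord1 i) /ball /= distrC; exact: h.
Unshelve. all: by end_near. Qed.

End Bumps.

Section ManifoldBumps.
Context {R : realType} {n : nat} {M : ptopologicalType} (At : set (chart R n M)).
Hypothesis hM : hausdorff_space M.
Hypothesis sA : smooth_atlas At.

Lemma open_transition_dom (c d : chart R n M) : open (transition_dom c d).
Proof.
rewrite openE => v [q [cq dq] <-].
have h1 := near_chart_codom (chart_map_codom cq).
have h2 := near_chart_inv cq (near_chart_dom dq).
apply: filterS2 h1 h2 => u Uu du; exists (chart_inv c u); last exact: chart_invK.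
by split => //; exact: chart_inv_dom.
Qed.

Lemma C1_fun_near (b : M -> R) c p : At c -> chart_dom c p ->
  (\forall q \near p, b q = 0) -> C1_at (chart_map c p) (b \o chart_inv c).
Proof.
move=> Atc cp /(near_chart_inv cp) b0.
apply: (@C1_at_near _ _ (cst 0)); last exact: C1_at_cst.
by apply: filterS b0 => u; exact: esym.
Qed.

(** [plateau] of [well], extended by zero off the chart. [well] equals 2 at the centre, which leaves
    a neighbourhood where it exceeds 1 and [plateau] is constantly 1. *)
Lemma exists_bump (p : M) : exists b : M -> R, exists K c,
  [/\ C1_fun At b, At c, compact K, K `<=` chart_dom c & forall q, ~ K q -> b q = 0] /\
  \forall q \near p, b q = 1.
Proof.
have [c Atc cp] := sA.1 p; pose u0 := chart_map c p.
have [a [wu0 cW WU]] := well_support (near_chart_codom (chart_map_codom cp)).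
set W := [set u | 0 <= well u0 a u] in cW WU.
have WK : chart_inv c @` W `<=` chart_dom c.
  by move=> _ [u Wu <-]; apply: chart_inv_dom; exact: WU.
have cK : compact (chart_inv c @` W).
  exact: (continuous_compact (continuous_subspaceW WU (@chart_inv_continuous _ _ _ c)) cW).
pose b q : R := if `[< chart_dom c q >] then plateau (well u0 a (chart_map c q)) else 0.
have b0 q : ~ (chart_inv c @` W) q -> b q = 0.
  move=> Kq; rewrite /b; case: asboolP => // cq; apply: plateau_le0.
  rewrite leNgt; apply/negP => /ltW wq; apply: Kq.
  by exists (chart_map c q) => //; exact: chart_mapK.
exists b, (chart_inv c @` W), c; split; last first.
  have : \forall u \near u0, 1 < well u0 a u.
    have : nbhs (well u0 a u0) [set t : R | 1 < t].
      by apply: open_nbhs_nbhs; split; [exact: open_gt|rewrite wu0 /= ltr1n].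
    exact: (@continuous_well _ _ u0 a u0).
  move=> /(near_chart_map cp) h; apply: filterS2 h (near_chart_dom cp) => q wq cq.
  by rewrite /b asboolT// plateau_ge1// ltW.
split => // d q Atd dq.
(* In another chart [d] the bump is smoothened by the transition map on the overlap; off the domain
   of [c], the closed set [K] is avoided by a whole neighbourhood, where the bump is 0. *)
have [cq|cq] := pselect (chart_dom c q); last first.
  apply: C1_fun_near => //.
  have : \forall q' \near q, ~ (chart_inv c @` W) q'.
    apply: open_nbhs_nbhs; split; last by move=> /WK.
    by apply: closed_openC; exact: compact_closed.
  by apply: filterS.
have Ct : C1_at (chart_map d q) (plateau \o (well u0 a \o transition d c)).
  apply/C1_at_plateau/C1_at_well => i.
  have [sT _] := sA.2 d c Atd Atc.
  have tq : transition_dom d c (chart_map d q) by exists q.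
  exact: (smooth_on_C1_at (@open_transition_dom d c) sT i tq).
apply: C1_at_near Ct.
have := near_chart_inv dq (near_chart_dom cq); apply: filterS => v cv.
by rewrite /= /b asboolT.
Qed.

End ManifoldBumps.

Section CompactSupport.
Context {R : realType} {n k : nat} {M : ptopologicalType}
  (At : set (chart R n M)) (x nu : M -> 'rV[R]_n.+1)
  (mu : {measure set (borel M) -> \bar R}).
Hypothesis H : immersed_hypersurface At x nu.
Hypothesis kn : (k < n)%N.
Variable cc : M -> chart R n M.
Hypotheses (ccA : forall p, At (cc p)) (ccd : forall p, chart_dom (cc p) p).
Hypothesis vol : riemannian_volume At x mu.

Let hM : hausdorff_space M. Proof. by have [] := hyp_manifold H. Qed.
Let sA : smooth_atlas At. Proof. by have [] := hyp_manifold H. Qed.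
Let F psi := newton_div k x nu cc psi.

Lemma volume_compact_immersed (K : set M) : compact K -> (mu K < +oo)%E.
Proof.
apply: (volume_compact vol sA.1 _ hM) => c Atc u; exact: (chart_density_cont H Atc).
Qed.

Lemma C1_funM f g : C1_fun At f -> C1_fun At g -> C1_fun At (f * g).
Proof. by move=> Cf Cg c p Atc cp; exact: (C1_atM (Cf _ _ Atc cp) (Cg _ _ Atc cp)). Qed.

Lemma C1_funD f g : C1_fun At f -> C1_fun At g -> C1_fun At (f + g).
Proof. by move=> Cf Cg c p Atc cp; exact: (C1_atD (Cf _ _ Atc cp) (Cg _ _ Atc cp)). Qed.

Lemma C1_fun_cst (a : R) : C1_fun At (cst a).
Proof. by move=> c p Atc cp; exact: C1_at_cst. Qed.

Lemma newton_divD f g p : C1_fun At f -> C1_fun At g -> F (f + g) p = F f p + F g p.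
Proof.
move=> Cf Cg; rewrite /F /newton_div.
have df := C1_at_is_derive (newton_field x nu k (cc p) p) (Cf _ _ (ccA p) (ccd p)).
have dg := C1_at_is_derive (newton_field x nu k (cc p) p) (Cg _ _ (ccA p) (ccd p)).
have -> : 'D_(newton_field x nu k (cc p) p) ((f + g) \o chart_inv (cc p)) (chart_map (cc p) p) =
  'D_(newton_field x nu k (cc p) p) (f \o chart_inv (cc p)) (chart_map (cc p) p) +
  'D_(newton_field x nu k (cc p) p) (g \o chart_inv (cc p)) (chart_map (cc p) p).
  exact: (deriveD (@ex_derive _ _ _ _ _ _ _ df) (@ex_derive _ _ _ _ _ _ _ dg)).
by rewrite mulrDl addrACA.
Qed.

Lemma newton_div_integrable psi K : C1_fun At psi -> compact K ->
  (forall p, ~ K p -> psi p = 0) -> mu.-integrable setT (EFin \o F psi).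
Proof.
move=> Cpsi cK psi0.
have [w wP] := @interpolation_weights R n (Ordinal kn).
apply: (compact_support_integrable hM cK (volume_compact_immersed cK)).
  exact: (continuous_newton_div H wP ccA ccd Cpsi).
by move=> p; exact: (@newton_div_eq0 R n k M x nu cc ccd psi K p (compact_closed hM cK) psi0).
Qed.

(** Compact induction takes the place of a partition of unity: a function equal to 1 on [K] is
    assembled from bumps, and multiplying [psi] by it changes nothing. *)
Lemma integral_newton_div psi K : C1_fun At psi -> compact K ->
  (forall p, ~ K p -> psi p = 0) -> (\int[mu]_p (F psi p)%:E = 0)%E.
Proof.
move=> Cpsi cK psi0; have [w wP] := @interpolation_weights R n (Ordinal kn).
have C11 : C1_fun At (cst (1 : R)) by exact: C1_fun_cst.
(* The test function is quantified inside the predicate, because the union step applies it to a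
   modified one. *)
pose P (A : set M) := exists eta : M -> R, [/\ C1_fun At eta,
  (forall p, A p -> eta p = 1) & forall psi K, C1_fun At psi -> compact K ->
  (forall p, ~ K p -> psi p = 0) -> (\int[mu]_p (F (psi * eta) p)%:E = 0)%E].
have [eta [Ceta eta1 I0]] : P K.
  apply: (compact_induction cK).
  - exists (cst 0); split; [exact (C1_fun_cst 0)|by []|].
    move=> f K' Cf cK' f0; have -> : f * cst 0 = cst 0 by apply/funext => p; exact: mulr0.
    apply: integral0_eq => p _; congr EFin.
    apply: (@newton_div_eq0 _ _ _ _ x nu cc ccd (cst 0) set0) => //; exact: closed0.
  - move=> A B [eta [Ceta eta1 Ieta]] [xi [Cxi xi1 Ixi]].
    have Cr : C1_fun At (1 - eta).
      have -> : 1 - eta = cst 1 + cst (- 1) * eta.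
        by apply/funext => p; rewrite !fctE /cst mulN1r.
      exact (C1_funD C11 (C1_funM (C1_fun_cst (- 1)) Ceta)).
    (* This is $1-(1-\eta)(1-\xi)$, equal to 1 where either factor function is. The second summand
       is handled by the hypothesis on [xi] with test function [f * (1 - eta)]. *)
    exists (eta + (1 - eta) * xi); split.
    + exact (C1_funD Ceta (C1_funM Cr Cxi)).
    + move=> p [/eta1 e1|/xi1 e1]; rewrite !fctE e1 ?subrr ?mul0r ?addr0// mulr1.
      by rewrite addrC subrK.
    + move=> f K' Cf cK' f0.
      have f0' p : ~ K' p -> (f * (1 - eta)) p = 0 by move=> /f0 E; rewrite !fctE E mul0r.
      have C1 : C1_fun At (f * eta) by exact: C1_funM.
      have C2 : C1_fun At (f * (1 - eta)) by exact: C1_funM.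
      have C3 : C1_fun At (f * (1 - eta) * xi) by exact: C1_funM.
      have -> : f * (eta + (1 - eta) * xi) = f * eta + f * (1 - eta) * xi.
        by rewrite mulrDr mulrA.
      under eq_integral do rewrite newton_divD// EFinD.
      rewrite integralD//; last 2 first.
      * apply: (newton_div_integrable C1 cK') => p /f0 E.
        by rewrite fctE E mul0r.
      * by apply: (newton_div_integrable C3 cK') => p /f0' E; rewrite fctE E mul0r.
      by rewrite (Ieta _ _ Cf cK' f0) (Ixi _ _ C2 cK' f0') adde0.
  - move=> A B AB [eta [Ceta eta1 Ieta]]; exists eta; split => // p /AB; exact: eta1.
  - move=> p _; have [b [K' [c [[Cb Atc cK' K'c b0] b1]]]] := exists_bump hM sA p.
    exists [set q | b q = 1] => //; exists b; split => // f K1 Cf _ _.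
    apply: (integral_newton_div_chart H wP ccA ccd vol (C1_funM Cf Cb) Atc cK' K'c) => q /b0 E.
    by rewrite fctE E mulr0.
rewrite -(I0 psi K Cpsi cK psi0); apply: eq_integral => p _; congr (F _ _)%:E.
apply/funext => q; rewrite fctE; have [/eta1 ->|/psi0 ->] := pselect (K q).
  by rewrite mulr1.
by rewrite mul0r.
Qed.

End CompactSupport.

(** * Volume growth *)

Section SpectralBound.
Context {R : realType} {n m : nat}.

(** The trace is the sum of the real eigenvalues, and coercivity on an eigenvector bounds each below
    by [delta]. *)
Lemma trace_ge_of_coercive (X : 'M[R]_(n, m)) (P : 'M[R]_n) (delta : R) : row_free X ->
  (forall v w, dot (v *m P *m X) (w *m X) = dot (v *m X) (w *m P *m X)) ->
  (forall v, delta * dot (v *m X) (v *m X) <= dot (v *m P *m X) (v *m X)) ->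
  n%:R * delta <= \tr P.
Proof.
case: n X P => [|n'] X P fX sP dP; first by rewrite mul0r /mxtrace big_ord0.
have [l lE lv] := self_adjoint_spectrum fX sP.
have -> : \tr P = \sum_i l 0 i.
  apply: oppr_inj; rewrite -char_poly_trace// lE.
  have := @coefPn_prod_XsubC R [seq l 0 i | i <- enum 'I_n'.+1].
  rewrite size_map size_enum_ord !big_map -!enumT /= !big_enum => -> //.
rewrite mulr_natl -[X in _ *+ X]card_ord -sumr_const; apply: ler_sum => i _.
have [v vP v0] := lv i.
by rewrite -(ler_pM2r v0) (le_trans (dP v))// vP -scalemxAl dotZl.
Qed.

Lemma dot_frame_double (X : 'M[R]_(n, m)) (v a : 'rV[R]_n) (y z : 'rV[R]_m) b :
  y = a *m X + b *: z -> dot (v *m X) z = 0 ->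
  dot y (v *m X) + dot (v *m X) y = 2 * dot (v *m X) (a *m X).
Proof.
by move=> yE vz; rewrite (dotC y) yE !dotDr !dotZr vz mulr0 addr0 mulr_natl mulr2n.
Qed.

End SpectralBound.

Lemma is_derive_comp_differentiable {R : realType} {V : normedModType R} (h : R -> R) (f : V -> R) u v
    df dh : differentiable f u -> is_derive u v f df -> is_derive (f u) (1 : R) h dh ->
  is_derive u v (h \o f) (dh * df).
Proof.
move=> fu [_ <-] [hu <-]; have {}hu : differentiable h (f u) by apply/derivable1_diffP.
have dc := differentiable_comp fu hu.
apply: DeriveDef; first exact: diff_derivable.
rewrite deriveE// [in RHS]deriveE// [X in _ * X]deriveE// diff_comp// /=.
by rewrite -[X in 'd h _ X = _]mulr1 [LHS]linearZ mulrC.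
Qed.

Section RadialDerivative.
Context {R : realType} {n k : nat} {M : ptopologicalType}
  (At : set (chart R n M)) (x nu : M -> 'rV[R]_n.+1).
Hypothesis H : immersed_hypersurface At x nu.
Hypothesis kn : (k < n)%N.

Let sq (p : M) : R := dot (x p) (x p).

(** From $n\delta\le\mathrm{tr}\,P_k=(n-k)\sigma_k$ and $0<n-k\le n$. In particular $\sigma_k$ is
    positive. *)
Lemma newton_symmetric_sigma_ge delta c p : At c -> chart_dom c p ->
  (forall v w, metric x c p (v *m newton x nu k c p) w = metric x c p v (w *m newton x nu k c p)) ->
  (forall v, delta * metric x c p v v <= metric x c p (v *m newton x nu k c p) v) ->
  0 < delta -> delta <= sigma x nu k c p.
Proof.
move=> Atc cp sP dP d0.
have := trace_ge_of_coercive (coord_jac_free H Atc cp) sP dP.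
rewrite newton_newton_mx (trace_newton_mx (shape_split H Atc cp) kn) => h.
have nk0 : (0 : R) < (n - k)%:R by rewrite ltr0n subn_gt0.
rewrite -(ler_pM2l nk0); apply: le_trans h.
by rewrite ler_pM2r// ler_nat leq_subr.
Qed.

Lemma is_derive_sq c p v : At c -> chart_dom c p ->
  is_derive (chart_map c p) v (sq \o chart_inv c)
    (2 * metric x c p v (tangential x nu c p)).
Proof.
move=> Atc cp; have Up := chart_map_codom cp.
have sx := smooth_xi H Atc.
have D := is_derive_coord sx _ v Up.
have := is_derive_dot D D.
rewrite deriveEjacobian; last exact: (smooth_on_differentiable sx Up).
move=> [d1 d2]; apply: DeriveDef; first exact d1.
refine (etrans d2 _).
have px : (x \o chart_inv c) (chart_map c p) = x p by rewrite /= chart_mapK.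
rewrite px; exact: (dot_frame_double (tangentialE H Atc cp) (coord_normal H Atc cp v)).
Qed.

Lemma sq_split c p : At c -> chart_dom c p ->
  sq p = metric x c p (tangential x nu c p) (tangential x nu c p) + dot (x p) (nu p) ^+ 2.
Proof.
move=> Atc cp; rewrite /sq {1 2}(tangentialE H Atc cp) !dotDl !dotDr !dotZl !dotZr.
rewrite (coord_normal H Atc cp) [dot (nu p) (_ *m _)]dotC (coord_normal H Atc cp).
by rewrite (normal_dot H) /metric; ring.
Qed.

Lemma C1_fun_sq : C1_fun At sq.
Proof.
move=> c p Atc cp; apply: C1_at_sum => i _.
have C := smooth_on_C1_at (@open_chart_codom _ _ _ c) (smooth_xi H Atc) i (chart_map_codom cp).
exact (C1_atM C C).
Qed.

(** The $\psi$ of the overview. It is used with exponent [p.+2], which ensures $C^1$, while [p.+1]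
    appears in its derivative. *)
Definition cutoff (r : R) p (q : M) : R := Num.max 0 (r - sq q) ^+ p.

Lemma C1_fun_cutoff r p : C1_fun At (cutoff r p.+2).
Proof.
move=> c q Atc cq.
have C := C1_atD (C1_at_cst (chart_map c q) r)
  (C1_atM (C1_at_cst (chart_map c q) (- 1)) (C1_fun_sq Atc cq)).
have {}C : C1_at (chart_map c q) (fun u => r - sq (chart_inv c u)).
  by apply: C1_at_near C; near=> u; rewrite !fctE /cst mulN1r.
exact: (C1_at_pospow p C).
Unshelve. all: by end_near. Qed.

Lemma is_derive_cutoff r p c q v : At c -> chart_dom c q ->
  is_derive (chart_map c q) v (cutoff r p.+2 \o chart_inv c)
    (p.+2%:R * cutoff r p.+1 q * - (2 * metric x c q v (tangential x nu c q))).
Proof.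
move=> Atc cq; have ds := is_derive_sq v Atc cq.
have dsq := C1_at_differentiable (C1_fun_sq Atc cq).
have dc := is_derive_cst r (chart_map c q) v.
have df := is_deriveB dc ds; rewrite sub0r in df.
have dff := differentiableB (differentiable_cst r (chart_map c q)) dsq.
have dp := is_derive_pospow p (r - sq q).
have E : (cst r - (sq \o chart_inv c)) (chart_map c q) = r - sq q.
  by rewrite !fctE /= chart_mapK.
rewrite -E in dp.
have := is_derive_comp_differentiable dff df dp.
by rewrite E.
Qed.

End RadialDerivative.

(** * The integral inequality for the cutoffs *)

Section MainInequality.
Context {R : realType} {n k : nat} {M : ptopologicalType}
  (At : set (chart R n M)) (x nu : M -> 'rV[R]_n.+1)
  (mu : {measure set (borel M) -> \bar R}).
Hypothesis kn : (k < n)%N.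
Hypothesis H : immersed_hypersurface At x nu.
Hypothesis vol : riemannian_volume At x mu.
Hypothesis px : proper_map x.
Hypothesis sh : Qk_self_shrinker k At x nu.
Hypothesis sb : sigma_bounded k At x nu.
Hypothesis co : coercive At x (newton x nu k).

(** Here [g], [b2], [m] stand for $|x^T|^2$, $\langle x,\nu\rangle^2$, $\langle P_kx^T,x^T\rangle$,
    and [psi'] for $-d\psi/d|x|^2$. Both negative terms are weakened to the common factor
    $\frac{\delta}{2}\min(\psi,\psi')$, so that [g + b2] becomes $|x|^2$. *)
Lemma cutoff_estimate (psi psi' N K b2 g m delta sig : R) :
  0 <= psi -> 0 <= psi' -> 0 <= N -> 0 <= b2 -> 0 <= g -> 0 < delta ->
  delta * g <= m -> delta <= sig -> sig <= K ->
  psi * (N * sig - sig * b2 / 2) + psi' * - (2 * m) <=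
    psi * (N * K) - delta / 2 * (Num.min psi psi' * (g + b2)).
Proof.
move=> p0 q0 N0 b0 g0 d0 dm ds sK.
set mn := Num.min psi psi'.
have mp : mn <= psi by rewrite ge_min lexx.
have mq : mn <= psi' by rewrite ge_min lexx orbT.
have mn0 : 0 <= mn by rewrite le_min p0.
have h1 : psi * (N * sig) <= psi * (N * K) by rewrite !ler_wpM2l.
have h2 : mn * b2 * delta <= psi * b2 * sig.
  by rewrite ler_pM ?mulr_ge0 ?ler_wpM2r// ltW.
have h3 : mn * (delta * g) <= psi' * m by rewrite ler_pM// mulr_ge0// ltW.
have h4 : 0 <= mn * (delta * g) by rewrite !mulr_ge0// ltW.
nra.
Qed.

Lemma compact_dot_ball (d : nat) (r : R) : compact [set y : 'rV[R]_d | dot y y <= r].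
Proof.
apply: (@subclosed_compact _ _ (box (`|r| + 1))).
- have cd : continuous (fun y : 'rV[R]_d => dot y y).
    move=> y; apply: continuous_sum => i.
    exact: (cvgM (@coord_continuous R 1 d 0 i y) (@coord_continuous R 1 d 0 i y)).
  exact: (closed_comp (fun u _ => cd u) (@closed_le R r)).
- exact: compact_box.
- move=> y /= yr i; have yi : y 0 i ^+ 2 <= r.
    apply: le_trans yr; rewrite /dot (bigD1 i)//= -expr2 lerDl.
    by apply: sumr_ge0 => j _; rewrite -expr2 sqr_ge0.
  have := ler_norm r; have := normr_ge0 r; have := normr_ge0 (y 0 i).
  rewrite -real_normK ?num_real// in yi.
  set a := `|y 0 i| in yi *; set t := `|r|; nra.
Qed.

Let sq (p : M) : R := dot (x p) (x p).

Lemma compact_sublevel r : compact [set p | sq p <= r].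
Proof. by have [_ h] := px; exact: (h _ (@compact_dot_ball n.+1 r)). Qed.

Lemma continuous_sq : continuous sq.
Proof.
have [cx _] := px => p; apply: continuous_sum => i.
have c1 := continuous_comp (cx p) (@coord_continuous R 1 n.+1 0 i (x p)).
exact: (cvgM c1 c1).
Qed.

Lemma continuous_cutoff r p : continuous (cutoff x r p).
Proof.
move=> q; have c1 : {for q, continuous (fun q => r - sq q)}.
  have c0 : {for q, continuous (fun _ : M => r)} by exact: cst_continuous.
  exact: (cvgB c0 (@continuous_sq q)).
exact: (continuous_comp c1 (@continuous_pospow R p _)).
Qed.

(** Pointwise, the divergence is at most $\delta/2$ times the integrand, and it integrates to 0.
    Properness makes the support of the cutoff compact. *)
Lemma integral_cutoff_ge0 : exists2 A : R, 0 <= A & forall r p,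
  let f q := (cutoff x r p.+2 q * A -
    Num.min (cutoff x r p.+2 q) (p.+2%:R * cutoff x r p.+1 q) * sq q)%:E in
  mu.-integrable setT f /\ (0 <= \int[mu]_q f q)%E.
Proof.
have [hM _ sA] := hyp_manifold H.
have [sP [delta d0 dP]] := co; have [K sK] := sb.
have cov p := cid2 (sA.1 p).
pose cc p := s2val (cov p).
have ccA p : At (cc p) := s2valP (cov p).
have ccd p : chart_dom (cc p) p := s2valP' (cov p).
have [c0 Atc0 c0p] := sA.1 point.
have sigd c p (Atc : At c) (cp : chart_dom c p) : delta <= sigma x nu k c p.
  exact (newton_symmetric_sigma_ge H kn Atc cp (sP c p Atc cp) (dP c p Atc cp) d0).
have sigK c p (Atc : At c) (cp : chart_dom c p) : sigma x nu k c p <= K.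
  exact: le_trans (ler_norm _) (sK c p Atc cp).
have K0 : 0 <= K.
  by apply: le_trans (sigK _ _ Atc0 c0p); apply: le_trans (sigd _ _ Atc0 c0p); exact: ltW.
have N0 : (0 : R) <= (n - k)%:R by [].
have d2 : 0 < delta / 2 by rewrite divr_gt0.
(* The bound $(n-k)K$ for the zeroth-order term, divided by the factor $\delta/2$ that
   [cutoff_estimate] puts in front of $|x|^2$. *)
exists ((n - k)%:R * K / (delta / 2)); first by rewrite divr_ge0 ?mulr_ge0// ltW.
move=> r p; set A := _ / (delta / 2); 
pose f q := cutoff x r p.+2 q * A -
  Num.min (cutoff x r p.+2 q) (p.+2%:R * cutoff x r p.+1 q) * sq q.
change (mu.-integrable setT (EFin \o f) /\ (0 <= \int[mu]_q (f q)%:E)%E).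
have Cpsi := C1_fun_cutoff H r p.
have cK := @compact_sublevel r.
have off q j : ~ sq q <= r -> cutoff x r j.+1 q = 0.
  move=> /negP; rewrite -ltNge => h; rewrite /cutoff max_l ?expr0n// subr_le0; exact: ltW.
have I0 := integral_newton_div H kn ccA ccd vol Cpsi cK (fun q => @off q p.+1).
have J0 := newton_div_integrable H kn ccA ccd vol Cpsi cK (fun q => @off q p.+1).
have If : mu.-integrable setT (EFin \o f).
  apply: (compact_support_integrable hM cK (volume_compact_immersed H vol cK)).
  - move=> q; have c1 := @continuous_cutoff r p.+2 q.
    have cp : {for q, continuous (fun _ : M => p.+2%:R : R)} by exact: cst_continuous.
    have cA : {for q, continuous (fun _ : M => A)} by exact: cst_continuous.
    have c2 : {for q, continuous (fun q => p.+2%:R * cutoff x r p.+1 q)}.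
      exact: (cvgM cp (@continuous_cutoff r p.+1 q)).
    have c3 : {for q, continuous (fun q => Num.min (cutoff x r p.+2 q) (p.+2%:R * cutoff x r p.+1 q))}.
      exact: (continuous_min c1 c2).
    exact: (cvgB (cvgM c1 cA) (cvgM c3 (@continuous_sq q))).
  - by move=> q qr; rewrite /f !off// mulr0 minxx !mul0r subrr.
have le q : newton_div k x nu cc (cutoff x r p.+2) q <= delta / 2 * f q.
  rewrite /newton_div.
  have [_ dE] := is_derive_cutoff H r p (newton_field x nu k (cc q) q) (ccA q) (ccd q).
  rewrite dE; have [s0 sE] := sh (ccA q) (ccd q).
  set sig := sigma x nu k (cc q) q in s0 sE *; set sig1 := sigma x nu k.+1 (cc q) q in sE *.
  set b := dot (x q) (nu q) in sE *.
  have k1 : k.+1%:R != 0 :> R by rewrite pnatr_eq0.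
  (* The shrinker equation, the only place where it enters. *)
  have E : b * (k.+1%:R * sig1) = sig * b ^+ 2 / 2.
    have -> : sig1 = (2 * k.+1%:R)^-1 * b * sig by rewrite -sE divfK.
    by field.
  rewrite E.
  set a := tangential x nu (cc q) q.
  have sqE : sq q = metric x (cc q) q a a + b ^+ 2 by exact: (sq_split H (ccA q) (ccd q)).
  have h := @cutoff_estimate (cutoff x r p.+2 q) (p.+2%:R * cutoff x r p.+1 q) (n - k)%:R K
    (b ^+ 2) (metric x (cc q) q a a) (metric x (cc q) q (newton_field x nu k (cc q) q) a) delta sig.
  apply: le_trans (h _ _ _ _ _ _ _ _ _) _ => //.
  + by rewrite exprn_ge0// le_max lexx.
  + by rewrite mulr_ge0// exprn_ge0// le_max lexx.
  + exact: sqr_ge0.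
  + exact: dot_ge0.
  + exact: (dP _ _ (ccA q) (ccd q) a).
  + exact: (sigd _ _ (ccA q) (ccd q)).
  + exact: (sigK _ _ (ccA q) (ccd q)).
  + rewrite /f -sqE /A mulrBr [X in _ <= X - _]mulrCA [delta / 2 * (_ / _)]mulrC.
    by rewrite divfK ?gt_eqF.
split=> //; have : (0 <= (delta / 2)%:E * \int[mu]_q (f q)%:E)%E.
  rewrite -integralZl// -I0; apply: le_integral => //.
    exact: integrableZl.
  by move=> q _; rewrite -EFinM lee_fin.
by rewrite pmule_rge0.
Qed.

End MainInequality.

(** * From the integral inequality to volume bounds *)

Section RealEstimates.
Context {R : realType}.

(** The integrand of [integral_cutoff_ge0] as a function of $t=|x|^2$. *)
Definition excess (A r : R) p (t : R) : R := Num.max 0 (r - t) ^+ p.+2 * A -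
  Num.min (Num.max 0 (r - t) ^+ p.+2) (p.+2%:R * Num.max 0 (r - t) ^+ p.+1) * t.

(** With $m=(r-t)_+\le r$ where positive, [w * m] is at most [p.+2], so [w * m ^+ p.+2] lies below
    both entries of the minimum. *)
Lemma excess_le A r p t (w : R) : 0 <= t -> 0 <= w <= 1 -> r * w <= p.+2%:R ->
  excess A r p t <= Num.max 0 (r - t) ^+ p.+2 * (A - w * t).
Proof.
move=> t0 /andP[w0 w1] rw; rewrite /excess; set m := Num.max 0 (r - t).
have m0 : 0 <= m by rewrite /m le_max lexx.
have wm : w * m <= p.+2%:R.
  rewrite /m maxEle; case: ifP => _; last by rewrite mulr0.
  by apply: le_trans rw; rewrite mulrC ler_wpM2r// lerBlDr lerDl.
have : m ^+ p.+2 * w <= Num.min (m ^+ p.+2) (p.+2%:R * m ^+ p.+1).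
  rewrite le_min ler_piMr ?exprn_ge0//= exprS mulrAC [m * w]mulrC.
  by rewrite ler_wpM2r ?exprn_ge0.
by move=> /(ler_wpM2r t0); rewrite mulrBr mulrA; lra.
Qed.

(** The case of [exp_excess_le] outside the final sublevel set, whose indicator has been evaluated
    to [false]: the negative excess absorbs the exponential. *)
Lemma guarded_le (X Y E M a : R) (b : bool) : X <= - M -> 0 <= M ->
  (b -> E * Y <= M) -> X + Y * (E * b%:R) <= Y * (a * false%:R).
Proof.
move=> XM M0 bE; rewrite !mulr0; case: b bE => bE.
  by rewrite mulr1 mulrC; have := bE isT; lra.
by rewrite !mulr0 addr0 (le_trans XM)// oppr_le0.
Qed.

(** Since $e^{2y}\ge 1+2y$ and $(1-y)(1+2y)=1+y(1-2y)\ge 1$. *)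
Lemma expR_double_le (y : R) : 0 <= y <= 1 / 2 -> expR (- (2 * y)) <= 1 - y.
Proof.
move=> /andP[y0 y1]; rewrite expRN -div1r ler_pdivrMr ?expR_gt0//.
have := expR_ge1Dx (2 * y); set e := expR _; nra.
Qed.

(** The previous bound at $y=t/(8p)$, with $p$ standing for [P.+1], raised to the power $p$: the
    exponent $2yp$ is exactly $t/4$. *)
Lemma expR_le_pow (t : R) P : 0 <= t -> t <= 4 * P.+1%:R ->
  expR (- (t / 4)) * (8 * P.+1%:R) ^+ P.+1 <= (8 * P.+1%:R - t) ^+ P.+1.
Proof.
move=> t0 tP.
have P0 : 0 < P.+1%:R :> R by [].
set P' := P.+1%:R in tP P0 *.
have -> : expR (- (t / 4)) = expR (- (2 * (t / (8 * P')))) ^+ P.+1.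
  rewrite -expRM_natr; congr expR; rewrite -/P'; field; exact: lt0r_neq0.
have P8 : 0 < 8 * P' by rewrite mulr_gt0.
rewrite -exprMn; apply: lerXn2r; rewrite ?nnegrE.
- by rewrite mulr_ge0 ?expR_ge0// ltW.
- lra.
have -> : 8 * P' - t = (1 - t / (8 * P')) * (8 * P') by field; exact: lt0r_neq0.
rewrite ler_pM2r//; apply: expR_double_le.
by rewrite (divr_ge0 t0 (ltW P8)) /= ler_pdivrMr//; lra.
Qed.

(** Weight $w=1/8$. Up to $8A+8$ the crude bounds $r^pA$ and $r^p$ suffice, $p$ standing for [p.+2];
    beyond it $A-t/8<-1$, so the excess is at most $-\psi$ and outweighs the exponential. *)
Lemma exp_excess_le (A t r : R) p : 0 <= A -> 0 <= t -> r = 8 * p.+2%:R ->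
  excess A r p t + r ^+ p.+2 * (expR (- (t / 4)) * (t <= 4 * p.+2%:R)%R%:R) <=
    r ^+ p.+2 * ((A + 1) * (t <= 8 * A + 8)%R%:R).
Proof.
move=> A0 t0 rE.
have P0 : (0 : R) < p.+2%:R by [].
have w01 : 0 <= (1 / 8 : R) <= 1 by lra.
have rw : r * (1 / 8) <= p.+2%:R by rewrite rE; lra.
have eP := excess_le A t0 w01 rw; move: eP; set m := Num.max 0 (r - t) => eP.
have m0 : 0 <= m by rewrite /m le_max lexx.
have mP0 : 0 <= m ^+ p.+2 by rewrite exprn_ge0.
have r00 : 0 <= r by rewrite rE mulr_ge0.
have rP0 : 0 <= r ^+ p.+2 by rewrite exprn_ge0.
have mr : m ^+ p.+2 <= r ^+ p.+2.
  by rewrite lerXn2r ?nnegrE// /m ge_max r00 /= lerBlDr lerDl.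
have [tB|tB] := leP t (8 * A + 8).
  have mA : m ^+ p.+2 * (A - 1 / 8 * t) <= r ^+ p.+2 * A.
    apply: le_trans (_ : m ^+ p.+2 * A <= _); last by rewrite ler_wpM2r.
    by apply: ler_wpM2l => //; rewrite gerBl mulr_ge0.
  rewrite (mulr1 (A + 1)) (mulrDr (r ^+ p.+2) A 1) (mulr1 (r ^+ p.+2)); apply: lerD; first exact: le_trans eP mA.
  apply: ler_piMr => //; case: (t <= _); last by rewrite mulr0.
  by rewrite mulr1 -expR0 ler_expR oppr_le0 divr_ge0.
apply: (@guarded_le _ _ _ (m ^+ p.+2)) => // [|t4].
  apply: le_trans eP _; rewrite -[leRHS]mulrN1; apply: ler_wpM2l => //; lra.
have -> : m = r - t by rewrite /m max_r// subr_ge0; lra.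
by rewrite rE; exact: expR_le_pow.
Qed.

(** Halve [t] until it falls in $[t_0,2t_0]$; each halving costs $2^N$. The factor 2 in [2 * t / t0]
    pays for monotonicity on that last interval. *)
Lemma doubling_growth (h : R -> R) (t0 : R) N : 0 < t0 ->
  (forall t, 0 <= h t) -> {homo h : s t / s <= t} ->
  (forall t, t0 <= t -> h (2 * t) <= 2 ^+ N * h t) ->
  forall t, t0 <= t -> h t <= (2 * t / t0) ^+ N * h t0.
Proof.
move=> t00 h0 hm hd.
suff claim j t : t0 <= t -> t <= 2 ^+ j * t0 -> h t <= (2 * t / t0) ^+ N * h t0.
  move=> t tt; apply: (claim (Num.bound (t / t0))) => //.
  rewrite -ler_pdivrMr// ltW// (lt_le_trans (archi_boundP _))//; last first.
    by rewrite -natrX ler_nat ltnW// ltn_expl.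
  by rewrite divr_ge0// ltW// (lt_le_trans t00).
have base s : t0 <= s -> s <= 2 * t0 -> h s <= (2 * s / t0) ^+ N * h t0.
  move=> t1 t2; apply: le_trans (hm _ _ t2) _; apply: le_trans (hd _ (lexx _)) _.
  have s20 : 2 <= 2 * s / t0 by rewrite ler_pdivlMr// ler_pM2l.
  by rewrite ler_wpM2r// lerXn2r ?nnegrE// (le_trans _ s20).
elim: j t => [|j IH] t t1.
  by rewrite expr0 mul1r => t2; apply: base => //; lra.
move=> t2; case: (leP t (2 * t0)) => [|t3]; first exact: base.
have t4 : t0 <= t / 2 by lra.
have {t2}t5 : t / 2 <= 2 ^+ j * t0 by move: t2; rewrite exprS; lra.
have {1}-> : t = 2 * (t / 2) by lra.
apply: le_trans (hd _ t4) _; apply: le_trans (ler_wpM2l _ (IH _ t4 t5)) _.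
  by rewrite exprn_ge0.
rewrite [leLHS]mulrA -exprMn.
have -> : 2 * (2 * (t / 2) / t0) = 2 * t / t0 by field; rewrite gt_eqF.
exact: lexx.
Qed.

End RealEstimates.

Section Growth.
Context {d} {T : measurableType d} {R : realType} (mu : {measure set T -> \bar R}).
Variables (s : T -> R) (A : R).
Hypotheses (s0 : forall q, 0 <= s q) (A0 : 0 <= A).
Hypothesis mfs : measurable_fun setT s.
Hypothesis fs : forall t, (mu [set q | (s q <= t)%R] < +oo)%E.
Hypothesis ex : forall r p, mu.-integrable setT (fun q => (excess A r p (s q))%:E) /\
  (0 <= \int[mu]_q (excess A r p (s q))%:E)%E.

Let B t := [set q | s q <= t].

Lemma measurable_sublevel t : measurable (B t).
Proof.
have -> : B t = setT `&` s @^-1` [set` `]-oo, t]].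
  by rewrite setTI; apply/seteqP; split=> q /=; rewrite in_itv.
exact: mfs measurableT _ (measurable_itv _).
Qed.
Let ms := measurable_sublevel.

Lemma mem_sublevel q t : (q \in B t) = (s q <= t).
Proof. by apply/idP/idP; rewrite inE. Qed.

(** The integral of the excess is nonnegative, so adding it to that of [v] does no harm; a pointwise
    inequality then bounds one integral by the other. *)
Lemma le_integral_of_excess r p (u v : T -> R) :
  mu.-integrable setT (EFin \o u) -> mu.-integrable setT (EFin \o v) ->
  (forall q, excess A r p (s q) + v q <= u q) ->
  (\int[mu]_q (v q)%:E <= \int[mu]_q (u q)%:E)%E.
Proof.
move=> iu iv le; have [ie e0] := ex r p.
apply: (@le_trans _ _ (\int[mu]_q ((excess A r p (s q))%:E + (v q)%:E))%E).
  by rewrite integralD// leeDr.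
apply: le_integral => //; first exact: integrableD.
by move=> q _; rewrite -EFinD lee_fin.
Qed.

Lemma integrable_indic_sublevel t : mu.-integrable setT (fun q => (\1_(B t) q)%:E).
Proof.
apply/integrableP; split; first exact/measurable_EFinP/measurable_indic.
rewrite (eq_integral (fun q => (\1_(B t) q)%:E)); last first.
  by move=> q _; rewrite gee0_abs// lee_fin.
by rewrite integral_indic// setIT; exact: fs.
Qed.

Lemma integrable_sublevel (c : R) t : mu.-integrable setT (fun q => (c * \1_(B t) q)%:E).
Proof.
under eq_fun do rewrite EFinM; apply: integrableZl => //.
exact: integrable_indic_sublevel.
Qed.

Lemma integral_sublevel (c : R) t : (\int[mu]_q (c * \1_(B t) q)%:E = c%:E * mu (B t))%E.
Proof.
under eq_integral do rewrite EFinM.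
rewrite integralZl//; last exact: integrable_indic_sublevel.
by rewrite integral_indic// setIT.
Qed.

(** On [B (r / 4)] the excess is at most $Ar^p$; between $r/4$ and $r/2$ it is at most $-(r/2)^p$,
    with $p$ for [p.+2]. Dividing by $(r/2)^p$ gives the constant. *)
Lemma sublevel_doubling p (r : R) : 4 * A + 4 <= p.+2%:R -> p.+2%:R <= r ->
  (mu (B (r / 2)%R) <= (A * 2 ^+ p.+2 + 1)%:E * mu (B (r / 4)%R))%E.
Proof.
move=> pA pr; have P0 : (0 : R) < p.+2%:R by [].
set P : R := p.+2%:R in pA pr P0.
have r0 : 0 < r by exact: lt_le_trans pr.
have P00 := ltW P0; have r00 := ltW r0.
have r20 : 0 < (r / 2) ^+ p.+2 by rewrite exprn_gt0// divr_gt0.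
have : (((r / 2) ^+ p.+2)%:E * mu (B (r / 2)%R) <=
    (A * r ^+ p.+2 + (r / 2) ^+ p.+2)%:E * mu (B (r / 4)%R))%E.
  rewrite -!integral_sublevel.
  apply: (@le_integral_of_excess r p); [exact: integrable_sublevel|exact: integrable_sublevel|].
  move=> q; set t := s q; have t0 : 0 <= t by exact: s0.
  (* The largest weight that [excess_le] admits; it is at most 1 because [P <= r]. *)
  have w01 : 0 <= P / r <= 1 by rewrite divr_ge0//= ler_pdivrMr// mul1r.
  have rw : r * (P / r) <= P by rewrite mulrC divfK// gt_eqF.
  have eP := excess_le A t0 w01 rw; set m := Num.max 0 (r - t) in eP.
  have m0 : 0 <= m by rewrite /m le_max lexx.
  have mP0 : 0 <= m ^+ p.+2 by rewrite exprn_ge0.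
  have mr : m ^+ p.+2 <= r ^+ p.+2.
    by rewrite lerXn2r ?nnegrE// /m ge_max r00 /= lerBlDr lerDl.
  have wt : 0 <= P / r * t by rewrite mulr_ge0//; case/andP: w01.
  rewrite !indicE !mem_sublevel -/t; have [t4|t4] := leP t (r / 4).
    have -> : t <= r / 2 by lra.
    rewrite !mulr1 lerD2r; apply: le_trans eP _; rewrite mulrBr lerBlDr.
    apply: le_trans (_ : m ^+ p.+2 * A <= _); first by [].
    by rewrite mulrC ler_wpDr ?ler_wpM2l// mulr_ge0.
  rewrite [leRHS]mulr0.
  (* Beyond $r/4$ the product is at least $P/4$, which is why $P\ge 4A+4$ is required. *)
  have wt1 : A + 1 <= P / r * t.
    apply: (@le_trans _ _ (P / r * (r / 4))); last by rewrite ler_wpM2l ?(ltW t4)//; case/andP: w01.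
    by rewrite mulrA divfK ?gt_eqF//; lra.
  have eP' : excess A r p t <= - m ^+ p.+2.
    by apply: le_trans eP _; rewrite -[leRHS]mulrN1 ler_wpM2l//; lra.
  have [t2|t2] := leP t (r / 2).
    rewrite mulr1.
    have : (r / 2) ^+ p.+2 <= m ^+ p.+2.
      by rewrite lerXn2r ?nnegrE ?divr_ge0// /m le_max; apply/orP; right; lra.
    lra.
  by rewrite mulr0; lra.
rewrite -lee_pdivlMl// muleA -EFinM.
by congr (_ <= _ * _)%E; congr EFin; rewrite expr_div_n; field; rewrite !expf_neq0//; lra.
Qed.

Lemma sublevel_growth : exists C t0 : R, exists N,
  [/\ 0 <= C, 0 < t0 & forall t, t0 <= t -> (mu (B t) <= (C * t ^+ N)%:E)%E].
Proof.
pose p := Num.bound (4 * A + 4).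
have pA : 4 * A + 4 <= p.+2%:R.
  have b0 : 0 <= 4 * A + 4 by rewrite addr_ge0// mulr_ge0.
  apply: ltW; apply: lt_le_trans (archi_boundP b0) _.
  by rewrite ler_nat leqW// leqW.
pose N := Num.bound (A * 2 ^+ p.+2 + 1).
have QN : A * 2 ^+ p.+2 + 1 <= 2 ^+ N.
  have b0 : 0 <= A * 2 ^+ p.+2 + 1 by rewrite addr_ge0// mulr_ge0// exprn_ge0.
  apply: ltW; apply: lt_le_trans (archi_boundP b0) _.
  by rewrite -/N -natrX ler_nat ltnW// ltn_expl.
have fB t : mu (B t) \is a fin_num by rewrite ge0_fin_numE// fs.
pose h t := fine (mu (B t)).
have hE t : mu (B t) = (h t)%:E by rewrite fineK.
have h0 t : 0 <= h t by exact: fine_ge0.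
have hm : {homo h : a b / a <= b}.
  move=> a b ab; rewrite -lee_fin -!hE; apply: le_measure; rewrite ?inE; [exact: ms|exact: ms|].
  by move=> q /= /le_trans; apply.
have t00 : (0 : R) < p.+2%:R by [].
(* [sublevel_doubling] at radius parameter [4 * t]; its constant was rounded up to the power $2^N$
   that [doubling_growth] expects. *)
have hd t : p.+2%:R <= t -> h (2 * t) <= 2 ^+ N * h t.
  move=> tp; have := @sublevel_doubling p (4 * t) pA.
  have -> : 4 * t / 2 = 2 * t by field.
  have -> : 4 * t / 4 = t by field.
  rewrite !hE -EFinM lee_fin => h1; apply: le_trans (h1 _) _; first by lra.
  by rewrite ler_wpM2r.
exists ((2 / p.+2%:R) ^+ N * h p.+2%:R), p.+2%:R, N; split => //.
  by rewrite mulr_ge0// exprn_ge0.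
move=> t tp; rewrite hE lee_fin; apply: le_trans (doubling_growth t00 h0 hm hd tp) _.
by rewrite [2 * t / _]mulrAC exprMn [leLHS]mulrAC.
Qed.

(** The point is that the right-hand side does not depend on [p]: the common factor $r^p$ of
    [exp_excess_le] is cancelled after integration. *)
Lemma integral_exp_sublevel_le p :
  (\int[mu]_q (expR (- (s q / 4)) * \1_(B (4 * p.+2%:R)%R) q)%:E <=
   (A + 1)%:E * mu (B (8 * A + 8)%R))%E.
Proof.
rewrite -integral_sublevel.
have [r rE] : exists r : R, r = 8 * p.+2%:R by exists (8 * p.+2%:R).
have r0 : 0 < r ^+ p.+2 by rewrite rE exprn_gt0// mulr_gt0.
have ie : mu.-integrable setT (fun q => (expR (- (s q / 4)) * \1_(B (4 * p.+2%:R)) q)%:E).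
  apply: (le_integrable measurableT _ _ (integrable_sublevel 1 (4 * p.+2%:R))).
    apply/measurable_EFinP; apply: measurable_funM; last by apply: measurable_indic; exact: ms.
    apply: measurableT_comp => //; apply: measurable_funN; apply: measurable_funM => //.
  move=> q _; rewrite /= lee_fin mul1r normrM ger0_norm ?expR_ge0// ler_piMl//.
  by rewrite -expR0 ler_expR oppr_le0 divr_ge0.
rewrite -(@lee_pmul2l _ (r ^+ p.+2)%:E) ?lte_fin// -!integralZl//; last exact: integrable_sublevel.
under eq_integral do rewrite -EFinM.
under [leRHS]eq_integral do rewrite -EFinM.
apply: (@le_integral_of_excess r p).
- have := integrableZl measurableT (r ^+ p.+2) (integrable_sublevel (A + 1) (8 * A + 8)).
  by [].
- have := integrableZl measurableT (r ^+ p.+2) ie.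
  by [].
move=> q; rewrite !indicE !mem_sublevel.
exact: (exp_excess_le A0 (s0 q) rE).
Qed.

(** The sublevel sets [B (4 * p.+2%:R)] exhaust the space, so the uniform bound passes to the limit
    by monotone convergence. *)
Lemma integral_exp_lty : (\int[mu]_q (expR (- (s q / 4)))%:E < +oo)%E.
Proof.
pose g p q : \bar R := (expR (- (s q / 4)) * \1_(B (4 * p.+2%:R)) q)%:E.
have mg p : measurable_fun setT (g p).
  apply/measurable_EFinP; apply: measurable_funM; last by apply: measurable_indic; exact: ms.
  apply: measurableT_comp => //; apply: measurable_funN; apply: measurable_funM => //.
have g0 p q : setT q -> (0 <= g p q)%E by rewrite lee_fin mulr_ge0 ?expR_ge0.
have ndg q : setT q -> {homo g ^~ q : a b / (a <= b)%N >-> (a <= b)%E}.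
  move=> _ a b ab; rewrite lee_fin ler_wpM2l ?expR_ge0// !indicE ler_nat.
  have : B (4 * a.+2%:R) `<=` B (4 * b.+2%:R).
    by move=> y /= /le_trans; apply; rewrite ler_pM2l// ler_nat.
  move=> h; case: (boolP (q \in B (4 * a.+2%:R))) => // /set_mem/h qb.
  by rewrite mem_set.
have lg q : limn (g ^~ q) = (expR (- (s q / 4)))%:E.
  apply: lim_near_cst => //; near=> p; rewrite /g indicE mem_sublevel.
  have -> : s q <= 4 * p.+2%:R; last by rewrite mulr1.
  have sp : s q <= p%:R by near: p; exact: nbhs_infty_ger.
  by apply: le_trans sp _; rewrite -natrM ler_nat; lia.
rewrite (_ : (\int[mu]_q _)%E = (\int[mu]_q limn (g ^~ q))%E); last first.
  by apply: eq_integral => q _; rewrite lg.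
rewrite monotone_convergence//.
apply: (@le_lt_trans _ _ ((A + 1)%:E * mu (B (8 * A + 8)%R))%E).
  apply: lime_le.
    apply: ereal_nondecreasing_is_cvgn => a b ab; apply: ge0_le_integral => //.
    - by move=> q _; exact: g0.
    - by move=> q _; exact: ndg.
  near=> p; exact: integral_exp_sublevel_le.
by rewrite lte_mul_pinfty// ?lee_fin ?addr_ge0// fs.
Unshelve. all: by end_near. Qed.

End Growth.

Theorem corollary4p2 (R : realType) (n k : nat) (M : ptopologicalType)
    (At : set (chart R n M)) (x nu : M -> 'rV[R]_n.+1)
    (mu : {measure set (borel M) -> \bar R}) :
  (k < n)%N ->
  immersed_hypersurface At x nu ->
  riemannian_volume At x mu ->
  connected [set: M] ->
  orientable At ->
  proper_map x ->
  Qk_self_shrinker k At x nu ->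
  sigma_bounded k At x nu ->
  coercive At x (newton x nu k) ->
  finite_weighted_volume x mu /\ polynomial_volume_growth x mu.
Proof.
move=> kn H vol _ _ px sh sb co.
have [A A0 ex] := integral_cutoff_ge0 kn H vol px sh sb co.
pose s q := dot (x q) (x q).
have s0 q : 0 <= s q by exact: dot_ge0.
have cs : continuous s by exact: (continuous_sq px).
have mfs : measurable_fun setT (s : borel M -> R).
  by apply: (@measurable_fun_continuous_real R M setT s openT) => q _; exact: cs.
have fs t : (mu [set q | (s q <= t)%R] < +oo)%E.
  exact: (volume_compact_immersed H vol (@compact_sublevel _ _ _ _ px t)).
have enE q : enorm (x q) ^+ 2 = s q by rewrite /enorm sqr_sqrtr ?dot_ge0.
split.
  rewrite /finite_weighted_volume; under eq_integral do rewrite enE.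
  exact: (@integral_exp_lty _ (borel M) R mu s A s0 A0 mfs fs ex).
have [C [t0 [N [C0 t00 hN]]]] :=
  @sublevel_growth _ (borel M) R mu s A s0 A0 mfs fs ex.
(* [sublevel_growth] measures in $t=|x|^2$; with $t=r^2$ the exponent doubles, and $r\ge 1$ together
   with $r\ge t_0$ gives $r^2\ge t_0$. *)
exists C, (2 * N)%:R; split => //.
near=> r.
have r0 : 0 <= r by near: r; exact: (nbhs_pinfty_ge (num_real _)).
have r1 : 1 <= r by near: r; exact: (nbhs_pinfty_ge (num_real _)).
have rt : t0 <= r by near: r; exact: (nbhs_pinfty_ge (num_real _)).
have -> : [set q | (enorm (x q) <= r)%R] = [set q | (s q <= r ^+ 2)%R].
  by apply/seteqP; split=> q /=; rewrite -enE ler_sqr// nnegrE sqrtr_ge0.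
rewrite powR_mulrn// exprM; apply: hN; apply: le_trans rt _.
by rewrite expr2 ler_peMl.
Unshelve. all: by end_near. Qed.
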